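(* Let $H\in(\frac12,\frac34)$, let $\theta\in(0,1)$, and let $\xi=(\xi_t)_{t\in\mathbb Z}$ be a centered stationary Gaussian sequence satisfying the Hypothesis stated in the context with this $H$. Let $X_0=0$, $X_t=\theta X_{t-1}+\xi_t$ for $t\ge1$, and let $\tilde\theta_n=f^{-1}\big(\frac1n\sum_{t=1}^nX_t^2\big)$ be the second moment estimator of $\theta$, with $f$ as in the context. Then, as $n\to\infty$, $$\sqrt n\,(\tilde\theta_n-\theta)\xrightarrow{\text{law}}\mathcal N\Big(0,\frac{\sigma_H^2}{[f'(\theta)]^2}\Big),$$ where $\sigma_H^2=2\sum_{k\in\mathbb Z}R^2(k)$, $R(k)=\mathbb E(Y_0Y_k)$ is the covariance function of the stationary solution $Y_t=\sum_{j=0}^\infty\theta^j\xi_{t-j}$, and $f'$ is the derivative of $f$.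
   Context: **Slow variation.** A positive function $L$ defined for $x>x_0$ is slowly varying at infinity in Zygmund's sense if for every $\delta>0$, $x^{\delta}L(x)$ is increasing and $x^{-\delta}L(x)$ is decreasing for $x$ large enough. **Hypothesis (on $\xi$).** $\xi=(\xi_t)_{t\in\mathbb Z}$ is a centered stationary Gaussian sequence whose covariance function $\rho(k)=\mathbb E(\xi_0\xi_k)$ satisfies $\rho(0)=1$ and $\rho(k)=L(|k|)\,|k|^{2H-2}$ for $k\in\mathbb Z\setminus\{0\}$, where $H\in(\frac12,1)$, $L:(0,\infty)\to(0,\infty)$ is slowly varying at infinity in Zygmund's sense, and $\lambda\mapsto L(1/\lambda)$ is of bounded variation on $(a,\pi)$ for every $a>0$. **Function $f$.** For $\vartheta\in(0,1)$, $f(\vartheta)=\sum_{i,j=0}^\infty\vartheta^{i+j}\rho(i-j)$; it equals $\mathbb E(Y_t^2)$ for the stationary solution $Y_t=\sum_{j\ge0}\vartheta^j\xi_{t-j}$ of the autoregression with parameter $\vartheta$. It is positive and strictly increasing on $(0,1)$, and $f^{-1}$ denotes its inverse function. Almost surely, $\frac1n\sum_{t=1}^nX_t^2$ belongs to the range of $f$ when $n$ is large enough, so that then $\tilde\theta_n\in(0,1)$. *)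

(* Defs.v *)
From HB Require Import structures.
From mathcomp Require Import all_boot all_order all_algebra.
From mathcomp Require Import all_classical all_reals all_analysis.

Set Implicit Arguments.
Unset Strict Implicit.
Unset Printing Implicit Defensive.

Import Order.TTheory GRing.Theory Num.Theory.
Import numFieldNormedType.Exports.

Local Open Scope classical_set_scope.
Local Open Scope ring_scope.

(* N(m, v), parametrised by the variance v. The library's normal_prob takes the
   standard deviation, and normal_prob m 0 is not the Dirac mass at m. *)
Definition normal_law (R : realType) (m v : R) : set R -> \bar R :=
  if v == 0 then \d_m else normal_prob m (Num.sqrt v).

Section normal_law.
Context (R : realType) (m v : R).
Let normal_law0 : normal_law m v set0 = 0%E.
Proof. by rewrite /normal_law; case: ifP => _; rewrite measure0. Qed.

Let normal_law_ge0 A : (0 <= normal_law m v A)%E.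
Proof. rewrite /normal_law; case: ifP => _; exact: measure_ge0. Qed.

Let normal_law_sigma_additive : semi_sigma_additive (normal_law m v).
Proof.
rewrite /normal_law; case: ifP => _ F mF tF mUF.
  exact: measure_semi_sigma_additive.
exact: (@measure_semi_sigma_additive _ _ _ (normal_prob m (Num.sqrt v))).
Qed.

HB.instance Definition _ := isMeasure.Build _ R R (normal_law m v)
  normal_law0 normal_law_ge0 normal_law_sigma_additive.

Let normal_law_setT : normal_law m v [set: R] = 1%E.
Proof.
rewrite /normal_law; case: ifP => _; first by rewrite diracT.
exact: (@probability_setT _ _ _ (normal_prob m (Num.sqrt v))).
Qed.

HB.instance Definition _ :=
  Measure_isProbability.Build _ R R (normal_law m v) normal_law_setT.
End normal_law.

Definition gaussian_variable (d : measure_display) (Omega : measurableType d)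
    (R : realType) (P : probability Omega R) (X : Omega -> R) : Prop :=
  exists m v : R, 0 <= v /\
    forall A : set R, measurable A -> P (X @^-1` A) = normal_law m v A.

Definition gaussian_sequence (d : measure_display) (Omega : measurableType d)
    (R : realType) (P : probability Omega R) (X : int -> Omega -> R) : Prop :=
  forall (n : nat) (c : 'I_n -> R) (t : 'I_n -> int),
    gaussian_variable P (fun w => \sum_(i < n) c i * X (t i) w).

Definition centered (d : measure_display) (Omega : measurableType d)
    (R : realType) (P : probability Omega R) (X : int -> Omega -> R) : Prop :=
  forall t : int, ('E_P[X t] = 0)%E.

Definition stationary (d : measure_display) (Omega : measurableType d)
    (R : realType) (P : probability Omega R) (X : int -> Omega -> R) : Prop :=
  forall (n : nat) (t : 'I_n -> int) (h : int) (A : set (n.-tuple R)),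
    measurable A ->
    pushforward P (fun w => [tuple X (t i + h) w | i < n]) A =
    pushforward P (fun w => [tuple X (t i) w | i < n]) A.

(* k |-> E(X_0 X_k), the covariance function of a centered stationary X. *)
Definition covariance_function (d : measure_display) (Omega : measurableType d)
    (R : realType) (P : probability Omega R) (X : int -> Omega -> R)
    (k : int) : R :=
  fine 'E_P[fun w => X 0 w * X k w].

Definition zygmund_slowly_varying (R : realType) (L : R -> R) : Prop :=
  (\forall x \near +oo, 0 < L x) /\
  forall delta : R, 0 < delta -> exists x0 : R,
    {in `]x0, +oo[ &, nondecreasing_fun (fun x => x `^ delta * L x)} /\
    {in `]x0, +oo[ &, nonincreasing_fun (fun x => x `^ (- delta) * L x)}.

(* Bounded variation on the open interval (a, b): the library's
   bounded_variation is about [a, b]. *)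
Definition bounded_variation_oo (R : realType) (a b : R) (g : R -> R) : Prop :=
  has_ubound [set v | exists c e : R,
    [/\ a < c, c <= e, e < b & variations c e g v]].

Definition long_memory_noise (d : measure_display) (Omega : measurableType d)
    (R : realType) (P : probability Omega R) (xi : int -> {RV P >-> R})
    (H : R) (L : R -> R) : Prop :=
  [/\ gaussian_sequence P xi, centered P xi & stationary P xi] /\
  (covariance_function P xi 0 = 1 /\
   forall k : int, k != 0 ->
     covariance_function P xi k = L `|k|%:~R * `|k|%:~R `^ (2 * H - 2)) /\
  [/\ 1 / 2 < H < 1,
      forall x : R, 0 < x -> 0 < L x,
      zygmund_slowly_varying L &
      forall a : R, 0 < a -> bounded_variation_oo a pi (fun x => L x^-1)].

Definition second_moment_function (R : realType) (rho : int -> R) (v : R) : R :=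
  fine (\sum_(0 <= i <oo) \sum_(0 <= j <oo)
          (v ^+ (i + j) * rho (i%:Z - j%:Z))%:E)%E.

Fixpoint ar1 (Omega : Type) (R : realType) (theta : R) (xi : int -> Omega -> R)
    (t : nat) (w : Omega) : R :=
  if t is s.+1 then theta * ar1 theta xi s w + xi s.+1%:Z w else 0.

(* The series converges almost surely; limn is 0 where it does not. *)
Definition stationary_solution (Omega : Type) (R : realType) (theta : R)
    (xi : int -> Omega -> R) (t : int) (w : Omega) : R :=
  limn (series (fun j : nat => theta ^+ j * xi (t - j%:Z) w)).

Definition empirical_second_moment (Omega : Type) (R : realType)
    (X : nat -> Omega -> R) (n : nat) (w : Omega) : R :=
  n%:R^-1 * \sum_(1 <= t < n.+1) X t w ^+ 2.

(* The inverse of f : (0, 1) -> f((0, 1)); outside the range of f, which the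
   empirical second moment a.s. eventually enters, the estimator is set to 0. *)
Definition second_moment_estimator (Omega : Type) (R : realType) (f : R -> R)
    (X : nat -> Omega -> R) (n : nat) (w : Omega) : R :=
  'pinv_(fun=> 0) `]0, 1[ f (empirical_second_moment X n w).

Definition converges_in_law (d : measure_display) (Omega : measurableType d)
    (R : realType) (P : probability Omega R) (X : nat -> Omega -> R)
    (mu : probability R R) : Prop :=
  (forall n, measurable_fun [set: Omega] (X n)) /\
  forall g : R -> R, continuous g -> bounded_fun g ->
    ('E_P[g \o X n] @[n --> \oo] --> \int[mu]_x (g x)%:E)%E.

Definition limit_variance (R : realType) (r : int -> R) : R :=
  2 * fine (\esum_(k in [set: int]) (r k ^+ 2)%:E)%E.

(* Main.v *)
(* The estimator is the inverse of f at the empirical second moment, so by the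
   delta method it is enough to treat Q_n = c_n (sum_t X_t^2 - E sum_t X_t^2) with
   c_n = 1 / (sqrt n f'(theta)), a quadratic functional of a Gaussian vector with
   covariance matrix A_n. Gaussian integration by parts, obtained from the moment
   recursion in dimension one by polarization, gives for
   M_(k,m) = c^(k+1) E(<X, A^k X> Q^m) the recursions
     E Q^(m+1) = 2 m M_(1,m-1),
     M_(k,m) = c^(k+1) tr(A^(k+1)) E Q^m + 2 m M_(k+1,m-1),
   so the moments of Q_n converge to those of N(0, v) as soon as
   c_n^2 tr(A_n^2) -> v / 2 and c_n^k tr(A_n^k) -> 0 for k >= 3. Since H < 3/4, rho
   is square summable; hence tr(A_n^2) / n converges to the sum of R^2, while the row
   sums of A_n are o(sqrt n) and bound tr(A_n^k) by o(sqrt n)^(k-2) tr(A_n^2).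

   Moments determine the limit law: expectations of cosines converge because the
   Taylor remainder is controlled by the even moments, and on a compact set a
   continuous function is uniformly approximated by Bernstein polynomials in
   sin(a x), which are combinations of such cosines.

   The identity (1 - v^2) f(v) = 2 sum_k rho(k) v^k - 1 makes f differentiable; its
   derivative is positive because rho >= 0. *)

Require Import Defs.
From HB Require Import structures.
From mathcomp Require Import all_boot all_order all_algebra.
From mathcomp Require Import all_classical all_reals all_analysis.
From mathcomp Require Import measurable_realfun ring lra.

Import Order.TTheory GRing.Theory Num.Theory.
Import numFieldNormedType.Exports.

Set Implicit Arguments.
Unset Strict Implicit.
Unset Printing Implicit Defensive.

Local Open Scope classical_set_scope.
Local Open Scope ring_scope.

(** * Moments of the normal law *)

(** The hypothesis says only that every finite linear combination of the noise is normal, possibly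
    degenerate, so no joint density is used. The whole Gaussian input is E U^(m+1) = m Var(U) E
    U^(m-1), valid for variance 0 as well. Applied to U + e V for all real e, both sides are
    polynomials in e, and the coefficient of degree 1 is an integration by parts; multiplication by
    one more factor is polarized in the same way. The bound H < 3/4 enters once: rho(k)^2 is
    k^(4H-4) up to slow variation, which is summable when 4H - 4 < -1. Since X_0 = 0, E(X_i X_j) is
    a finite box sum of nonnegative terms, increasing with the truncation and bounded by R(j - i);
    monotonicity replaces most estimates of remainders. Starting at 0 instead of in the stationary
    regime costs a deterministic bias O(1/n) of the empirical second moment, negligible against
    1/sqrt n. The delta method is deterministic too: the normalized estimation error is a function
    of n and Q_n, uniformly close to Q_n while |Q_n| <= A, and the second moment of Q_n bounds the
    rest. *)

Section normal_moments.
Context {R : realType}.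
Implicit Types m s x : R.
Local Notation mu := (@lebesgue_measure R).

(** The change of variables holds for the Radon-Nikodym derivative, which agrees almost everywhere
    with the explicit density because both have the same integral over every measurable set. *)
Lemma ge0_integral_normal_prob m s (f : R -> \bar R) :
  (forall x, 0 <= f x)%E -> measurable_fun setT f ->
  (\int[normal_prob m s]_x f x = \int[mu]_x (f x * (normal_pdf m s x)%:E))%E.
Proof.
move=> f0 mf; have dom := normal_prob_dominates m s.
rewrite -(Radon_Nikodym_SigmaFinite.change_of_variables dom)//=.
set g := Radon_Nikodym_SigmaFinite.f _ _.
have ig : mu.-integrable setT g by exact: Radon_Nikodym_SigmaFinite.f_integrable.
apply: ae_eq_integral => //.
- by apply: emeasurable_funM => //; exact: measurable_int ig.
- by apply: emeasurable_funM => //; apply/measurable_EFinP; exact: measurable_normal_pdf.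
- apply: ae_eqe_mul2l; apply: integral_ae_eq => //=.
    by apply/measurable_EFinP; exact: measurable_normal_pdf.
  by move=> E _ mE; rewrite /g -Radon_Nikodym_SigmaFinite.f_integral.
Qed.

Lemma integral_normal_prob m s (f : R -> R) :
  measurable_fun setT f ->
  mu.-integrable setT (fun x => (f x * normal_pdf m s x)%:E) ->
  (normal_prob m s).-integrable setT (EFin \o f) /\
  (\int[normal_prob m s]_x (f x)%:E = \int[mu]_x (f x * normal_pdf m s x)%:E)%E.
Proof.
move=> mf fi.
have mfE : measurable_fun setT (EFin \o f) by exact/measurable_EFinP.
have mfp : measurable_fun setT (fun x => (f x * normal_pdf m s x)%:E).
  exact: measurable_int fi.
have H (g : R -> R) : (forall x, 0 <= g x) -> measurable_fun setT g ->
  (\int[normal_prob m s]_x (g x)%:E = \int[mu]_x (g x * normal_pdf m s x)%:E)%E.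
  move=> g0 mg; rewrite ge0_integral_normal_prob//.
  exact/measurable_EFinP.
have fi' : (normal_prob m s).-integrable setT (EFin \o f).
  apply/integrableP; split=> //.
  rewrite [X in (X < _)%E](H (fun x => `|f x|))//; last first.
    exact: measurableT_comp.
  case/integrableP : fi => _; congr (_ < _)%E.
  apply: eq_integral => x _ /=.
  by rewrite normrM (ger0_norm (normal_pdf_ge0 m s x)).
split=> //.
rewrite [LHS]integralE [RHS]integralE; congr (_ - _)%E.
- transitivity (\int[normal_prob m s]_x (Num.max (f x) 0)%:E)%E.
    by apply: eq_integral => x _; rewrite funeposE EFin_max.
  rewrite (H (fun x => Num.max (f x) 0)).
  + apply: eq_integral => x _; rewrite funeposE /= -EFin_max; congr (_%:E).
    by rewrite maxr_pMl ?normal_pdf_ge0// mul0r.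
  + by move=> x; rewrite le_max lexx orbT.
  + by apply: measurable_maxr => //; exact: measurable_cst.
- transitivity (\int[normal_prob m s]_x (Num.max (- f x) 0)%:E)%E.
    by apply: eq_integral => x _; rewrite funenegE EFin_max.
  rewrite (H (fun x => Num.max (- f x) 0)).
  + apply: eq_integral => x _; rewrite funenegE /= -EFin_max; congr (_%:E).
    by rewrite maxr_pMl ?normal_pdf_ge0// mul0r mulNr.
  + by move=> x; rewrite le_max lexx orbT.
  + by apply: measurable_maxr => //; exact: measurableT_comp.
Qed.

Lemma exprn_le_expR x n : 0 <= x -> x ^+ n <= n`!%:R * expR x.
Proof.
move=> x0; case: n => [|n]; first by rewrite fact0 mul1r expr0 -expR0 ler_expR.
rewrite -ler_pdivrMl ?ltr0n ?fact_gt0// mulrC.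
by apply: le_trans (expR_ge1Dxn n x0); rewrite lerDr.
Qed.

(* On the larger scale 2 s the Gaussian density absorbs any power of x - m. *)
Lemma normal_pdf_scale m s (n : nat) : 0 < s -> exists2 C, 0 <= C &
  forall x, (x - m) ^+ (2 * n) * normal_pdf m s x <= C * normal_pdf m (2 * s) x.
Proof.
move=> s0; have sn0 : s != 0 by rewrite gt_eqF.
have s20 : 0 < 2 * s by rewrite mulr_gt0.
have pk0 : 0 < normal_peak (2 * s) by rewrite normal_peak_gt0// gt_eqF.
pose b := s ^+ 2 *+ 4 : R.
have b0 : 0 < b by rewrite pmulrn_rgt0// exprn_gt0.
exists (b ^+ n * n`!%:R * normal_peak s / normal_peak (2 * s)).
  by rewrite !mulr_ge0// ?exprn_ge0 ?invr_ge0 ?normal_peak_ge0// ltW.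
move=> x; rewrite !normal_pdfE ?gt_eqF//.
rewrite [leRHS]mulrA mulfVK ?gt_eqF//.
rewrite [leLHS]mulrCA [leRHS]mulrAC [leRHS]mulrC.
apply: ler_wpM2l; first exact: normal_peak_ge0.
pose y := (x - m) ^+ 2 / b.
have y0 : 0 <= y by rewrite mulr_ge0 ?sqr_ge0// invr_ge0 ltW.
have -> : (x - m) ^+ (2 * n) = b ^+ n * y ^+ n.
  by rewrite -exprMn /y mulrC mulfVK ?gt_eqF// exprM.
rewrite -!mulrA; apply: ler_wpM2l; first by rewrite exprn_ge0// ltW.
(* One factor exp(-y) absorbs y^n through y^n <= n! exp(y); the other is below exp(-y/2), the
   profile at scale 2 s. *)
have -> : normal_fun m s x = expR (- y) * expR (- y).
  by rewrite -expRD /normal_fun /y /b; congr expR; field.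
rewrite mulrA; apply: ler_pM.
- by rewrite mulr_ge0 ?exprn_ge0 ?expR_ge0.
- exact: expR_ge0.
- rewrite expRN ler_pdivrMr ?expR_gt0//; exact: exprn_le_expR.
- rewrite /normal_fun ler_expR.
  have -> : - (x - m) ^+ 2 / ((2 * s) ^+ 2 *+ 2) = - (y / 2).
    by rewrite /y /b; field.
  by rewrite lerN2 ler_pdivrMr// ler_peMr// ler1n.
Qed.
Lemma cvg_invn : n%:R^-1 @[n --> \oo] --> (0 : R).
Proof. by rewrite -cvg_shiftS; exact: cvg_harmonic. Qed.

Lemma continuous_pow_normal_pdf m s k : s != 0 ->
  continuous (fun x => (x - m) ^+ k * normal_pdf m s x).
Proof.
move=> s0 x; apply: cvgM; last exact: continuous_normal_pdf.
apply: (cvg_comp (fun y => y - m) (fun y => y ^+ k)).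
  by apply: (@cvgB _ R^o); [exact: cvg_id|exact: cvg_cst].
exact: exprn_continuous.
Qed.

Lemma normr_exprn_le1D (u : R) k : `|u ^+ k| <= 1 + u ^+ (2 * k).
Proof.
rewrite exprM normrX; have -> : u ^+ 2 = `|u| ^+ 2 by rewrite real_normK// num_real.
rewrite -exprM mulnC exprM; set y := `|u| ^+ k.
have : 0 <= (y - 1) ^+ 2 by rewrite sqr_ge0.
have : 0 <= y by rewrite exprn_ge0.
nra.
Qed.

Lemma integrable_pow_normal_pdf m s k : 0 < s ->
  mu.-integrable setT (fun x => ((x - m) ^+ k * normal_pdf m s x)%:E).
Proof.
move=> s0; have [C C0 HC] := normal_pdf_scale m k s0.
have i1 := integrable_normal_pdf m s.
have i2 := integrableZl measurableT C (integrable_normal_pdf m (2 * s)).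
apply: le_integrable (integrableD measurableT i1 i2) => //=.
  apply/measurable_EFinP; apply: continuous_measurable_fun.
  by apply: continuous_pow_normal_pdf; rewrite gt_eqF.
move=> x _; rewrite lee_fin.
rewrite normrM (ger0_norm (normal_pdf_ge0 m s x)).
apply: le_trans (ler_norm _).
apply: (@le_trans _ _ ((1 + (x - m) ^+ (2 * k)) * normal_pdf m s x)).
  by rewrite ler_wpM2r ?normal_pdf_ge0// normr_exprn_le1D.
by rewrite mulrDl mul1r lerD2l.
Qed.

(** The sign [e] treats both ends of the line at once. Bounding the density at the exponent k + 1
    leaves a spare factor n, hence a decay of order 1/n. *)
Lemma cvg_pow_normal_pdf m s k (e : R) : 0 < s -> `|e| = 1 ->
  (e * n%:R) ^+ k * normal_pdf m s (m + e * n%:R) @[n --> \oo] --> (0 : R).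
Proof.
move=> s0 e1; have [C C0 HC] := normal_pdf_scale m k.+1 s0.
pose K := C * normal_peak (2 * s).
have K0 : 0 <= K by rewrite mulr_ge0 ?normal_peak_ge0.
have B n : (0 < n)%N ->
    `|(e * n%:R) ^+ k * normal_pdf m s (m + e * n%:R)| <= K * n%:R^-1.
  move=> n0; have := HC (m + e * n%:R); rewrite addrAC subrr add0r => H.
  have n1 : 1 <= n%:R :> R by rewrite ler1n.
  have n0' : 0 < n%:R :> R by rewrite ltr0n.
  rewrite ler_pdivlMr// normrM (ger0_norm (normal_pdf_ge0 _ _ _)).
  apply: (@le_trans _ _ ((e * n%:R) ^+ (2 * k.+1) * normal_pdf m s (m + e * n%:R))).
    rewrite mulrAC ler_wpM2r ?normal_pdf_ge0//.
    rewrite exprM -(real_normK (num_real (e * _))) normrX normrM e1 mul1r.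
    rewrite (ger0_norm (ltW n0')) -exprM -exprSr.
    by apply: ler_weXn2l => //; rewrite mul2n -addnn leq_addr.
  apply: (le_trans H); apply: ler_wpM2l => //.
  by apply: normal_pdf_ub; rewrite gt_eqF// mulr_gt0.
apply/cvgr0Pnorm_le => eps eps0.
have cK : K * n%:R^-1 @[n --> \oo] --> (0 : R).
  by rewrite -(mulr0 K); apply: cvgM; [exact: cvg_cst|exact: cvg_invn].
near=> n; apply: le_trans (B n _) _; first by near: n; exact: nbhs_infty_gt.
apply: le_trans (ler_norm _) _; near: n.
by move/cvgr0Pnorm_le: cK => /(_ _ eps0).
Unshelve. all: by end_near. Qed.
Lemma is_derive_pow_center m k x :
  is_derive x 1 (fun y : R => (y - m) ^+ k) (k%:R * (x - m) ^+ k.-1).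
Proof.
have d0 : is_derive x 1 (id - cst m : R -> R) (1 - 0).
  by apply: is_deriveB.
have := is_deriveX k d0; rewrite subr0 /GRing.scale/= mulr1.
suff -> : (id - cst m : R -> R) ^+ k = (fun y => (y - m) ^+ k) by [].
by apply/funext => y; elim: k => [//|k IH]; rewrite !exprS -IH.
Qed.

Lemma is_derive_normal_pdf m s x : s != 0 ->
  is_derive x 1 (normal_pdf m s) (- ((x - m) / s ^+ 2 * normal_pdf m s x)).
Proof.
move=> s0; rewrite normal_pdfE//.
pose g (y : R) := - (s ^+ 2 *+ 2)^-1 * (y - m) ^+ 2.
have dg : is_derive x 1 g (- (x - m) / s ^+ 2).
  have := is_deriveZ (- (s ^+ 2 *+ 2)^-1) (is_derive_pow_center m 2 x).
  by move/is_derive_eq; apply; rewrite /GRing.scale/=; field.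
have -> : (fun y => normal_peak s * normal_fun m s y) =
    normal_peak s \*: (expR \o g).
  by apply/funext => y; rewrite /normal_fun /g /= /GRing.scale/=; congr (_ * expR _); ring.
have := is_deriveZ (normal_peak s) (is_derive1_comp (is_derive_expR (g x)) dg).
move/is_derive_eq; apply; rewrite /GRing.scale/= /normal_fun.
have -> : g x = - (x - m) ^+ 2 / (s ^+ 2 *+ 2) by rewrite /g; ring.
by field.
Qed.

(** The primitive behind the moment recursion: as p' = - (x - m) p / s^2, differentiating - s^2 (x -
    m)^k p produces the difference of the two integrands. *)
Lemma is_derive_pow_normal_pdf m s k x : s != 0 ->
  is_derive x 1 (fun y => - s ^+ 2 * ((y - m) ^+ k * normal_pdf m s y))
    ((x - m) ^+ k.+1 * normal_pdf m s x
     - k%:R * s ^+ 2 * ((x - m) ^+ k.-1 * normal_pdf m s x)).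
Proof.
move=> s0.
have := is_deriveZ (- s ^+ 2)
  (is_deriveM (is_derive_pow_center m k x) (is_derive_normal_pdf m x s0)).
move/is_derive_eq; apply; rewrite /GRing.scale/= (exprS (x - m)).
move: (normal_pdf m s x) ((x - m) ^+ k) ((x - m) ^+ k.-1) => p a b.
by move: (x - m) (k%:R : R) => u c; field.
Qed.

(** The fundamental theorem of calculus on [m - n, m + n], then dominated convergence with majorant
    |h|. *)
Lemma integral_derive_vanishing (h G : R -> R) (m : R) :
  continuous h -> mu.-integrable setT (EFin \o h) ->
  (forall x, is_derive x 1 G (h x)) ->
  G (m + n%:R) @[n --> \oo] --> 0 -> G (m - n%:R) @[n --> \oo] --> 0 ->
  (\int[mu]_x (h x)%:E = 0)%E.
Proof.
move=> ch ih dG G1 G2.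
pose hn n x := ((EFin \o h) \_ `[m - n%:R, m + n%:R]) x.
have mh : measurable_fun setT (EFin \o h) by exact: measurable_int ih.
have [] := @dominated_convergence _ _ _ mu setT measurableT hn (EFin \o h)
  (abse \o (EFin \o h)).
- move=> n; apply/(measurable_restrictT (EFin \o h) (measurable_itv _)).
  exact: measurable_funTS.
- exact: mh.
- apply: aeW => x _; apply: cvg_near_cst.
  near=> n; rewrite /hn patchE ifT// inE/= in_itv/=.
  have xn : `|x - m| <= n%:R by near: n; exact: nbhs_infty_ger.
  by move: xn; rewrite ler_norml => /andP[? ?]; apply/andP; split; lra.
- exact: integrable_abse.
- apply: aeW => x n _; rewrite /hn patchE; case: ifP => //= _.
  by rewrite lee_fin normr0.
move=> _ _ L.
have L0 : [sequence (\int[mu]_x hn n x)%E]_n @ \oo --> 0%E.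
  apply: cvg_trans (_ : (G (m + n%:R) - G (m - n%:R))%:E @[n --> \oo] --> _).
    apply: near_eq_cvg; near=> n.
    have n0 : (0 < n)%N by near: n; exact: nbhs_infty_gt.
    have ab : m - n%:R < m + n%:R.
      have : (0 : R) < n%:R by rewrite ltr0n.
      by lra.
    rewrite /= /hn -integral_mkcond (@continuous_FTC2 _ h G)//.
    + exact: continuous_subspaceT.
    + have cG : continuous G.
        by move=> x; apply/differentiable_continuous/derivable1_diffP.
      by split=> //; [exact/cvg_at_right_filter/cG|exact/cvg_at_left_filter/cG].
    + by move=> x _; rewrite derive1E derive_val.
  apply: cvg_EFin; first exact: nearW.
  by rewrite -[X in _ --> X](subr0 0); exact: cvgB.
exact: (cvg_unique _ L L0).
Unshelve. all: by end_near. Qed.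
(** Integration by parts against the density. At k = 0 the factor [k%:R] makes the truncated
    predecessor harmless, and the identity says that the mean is m. *)
Lemma normal_prob_moments m s k : 0 < s ->
  (normal_prob m s).-integrable setT (EFin \o (fun x => (x - m) ^+ k)) /\
  \int[normal_prob m s]_x ((x - m) ^+ k.+1) =
  k%:R * s ^+ 2 * \int[normal_prob m s]_x ((x - m) ^+ k.-1).
Proof.
move=> s0; have sn0 : s != 0 by rewrite gt_eqF.
have mp j : measurable_fun [set: R] (fun x : R => (x - m) ^+ j).
  by apply: measurable_funX; apply: measurable_funB.
have I j := integral_normal_prob (mp j) (integrable_pow_normal_pdf m j s0).
split; first by have [] := I k.
have i1 := integrable_pow_normal_pdf m k.+1 s0.
have i2 := integrable_pow_normal_pdf m k.-1 s0.
have L e : `|e| = 1 ->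
    - s ^+ 2 * ((m + e * n%:R - m) ^+ k * normal_pdf m s (m + e * n%:R))
    @[n --> \oo] --> (0 : R).
  move=> e1; rewrite -[X in _ --> X](mulr0 (- s ^+ 2)); apply: cvgM.
    exact: cvg_cst.
  by under eq_fun do rewrite (addrAC m) subrr add0r; exact: cvg_pow_normal_pdf.
have H := @integral_derive_vanishing _ _ m _ _
  (fun x => is_derive_pow_normal_pdf m k x sn0).
have i3 : mu.-integrable setT
    (fun x => (k%:R * s ^+ 2 * ((x - m) ^+ k.-1 * normal_pdf m s x))%:E).
  by apply: eq_integrable (integrableZl measurableT (k%:R * s ^+ 2) i2).
rewrite /Rintegral (I k.+1).2 (I k.-1).2 -[RHS]RintegralZl//.
apply/eqP; rewrite -subr_eq0 -RintegralB//; apply/eqP; rewrite /Rintegral H.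
- by [].
- move=> x; apply: cvgB; first exact: continuous_pow_normal_pdf.
  by apply: cvgM; [exact: cvg_cst|exact: continuous_pow_normal_pdf].
- by apply: eq_integrable (integrableB measurableT i1 i3).
- by have := L 1 (normr1 _); under eq_fun do rewrite mul1r.
- by have := L (-1) (normrN1 _); under eq_fun do rewrite mulN1r.
Qed.

End normal_moments.

(** * Transfer of integrals along a map with known law *)

Section image_law.
Context d1 d2 (X : measurableType d1) (Y : measurableType d2) (R : realType).
Variables (phi : X -> Y) (mu : {measure set X -> \bar R}).
Variable nu : {measure set Y -> \bar R}.
Hypothesis mphi : measurable_fun [set: X] phi.
Hypothesis law : forall A, measurable A -> mu (phi @^-1` A) = nu A.
Implicit Types f : Y -> \bar R.

Let pushE f : (\int[pushforward mu phi]_y f y = \int[nu]_y f y)%E.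
Proof.
rewrite (@eq_measure_integral _ _ _ _ nu (measure_function_pushforward__canonical__measure_function_Measure mu mphi))//.
by move=> A mA _; exact: law.
Qed.

Lemma ge0_integral_image f : measurable_fun setT f -> (forall y, 0 <= f y)%E ->
  (\int[mu]_x f (phi x) = \int[nu]_y f y)%E.
Proof.
by move=> mf f0; rewrite -pushE (ge0_integral_pushforward mphi).
Qed.

Lemma integrable_image f : measurable_fun setT f ->
  nu.-integrable setT f <-> mu.-integrable setT (f \o phi).
Proof.
move=> mf.
have ma : measurable_fun setT (abse \o f) by exact: measurableT_comp.
have E := ge0_integral_image ma (fun y => abse_ge0 _).
split=> /integrableP[_ H]; apply/integrableP; split=> //.
- exact: measurableT_comp.
- by move: H; rewrite -E.
- by move: H; rewrite E.
Qed.

Lemma integral_image f : measurable_fun setT f -> nu.-integrable setT f ->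
  (\int[mu]_x f (phi x) = \int[nu]_y f y)%E.
Proof.
move=> mf nf; rewrite -pushE (integral_pushforward mphi)//.
by rewrite preimage_setT; apply/integrable_image.
Qed.
End image_law.

Section normal_law_moments.
Context {R : realType}.
Implicit Types m v : R.

Lemma normal_law0_dirac m (f : R -> \bar R) : measurable_fun setT f ->
  (\int[normal_law m 0]_x f x = f m)%E.
Proof.
move=> mf; rewrite (@eq_measure_integral _ _ _ _ \d_m); last first.
  by move=> A _ _; rewrite -[LHS]/(normal_law m 0 A) /normal_law eqxx.
by rewrite integral_dirac// diracT mul1e.
Qed.

Lemma normal_law_moments m v k : 0 <= v ->
  (normal_law m v).-integrable setT (EFin \o (fun x => (x - m) ^+ k)) /\
  \int[normal_law m v]_x ((x - m) ^+ k.+1) =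
  k%:R * v * \int[normal_law m v]_x ((x - m) ^+ k.-1).
Proof.
have mp j : measurable_fun [set: R] (fun x : R => (x - m) ^+ j).
  by apply: measurable_funX; apply: measurable_funB.
have mpE j : measurable_fun [set: R] (fun x : R => ((x - m) ^+ j)%:E).
  exact/measurable_EFinP.
(* At variance 0 the law is the Dirac mass at m and both sides of the recursion vanish. *)
rewrite le_eqVlt => /predU1P[<-|v0].
  split.
    apply/integrableP; split; first exact: mpE.
    rewrite normal_law0_dirac ?ltry//; exact: measurableT_comp (mpE k).
  rewrite mulr0 mul0r /Rintegral normal_law0_dirac; last exact: mpE.
  by rewrite subrr expr0n.
pose s := Num.sqrt v.
have sv0 : 0 < s by rewrite sqrtr_gt0.
have law (A : set R) : measurable A -> normal_prob m s (idfun @^-1` A) = normal_law m v A.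
  by move=> mA; rewrite /normal_law gt_eqF.
(* [normal_prob] is taken here on the type carrying the sigma-algebra generated by half-open
   intervals; the identity map transports its integrals to [normal_law] on [R]. *)
have mid : measurable_fun setT (idfun : g_sigma_algebraType (R.-ocitv.-measurable) -> R).
  by move=> _ Y mY; rewrite setTI preimage_id.
have I j : (normal_law m v).-integrable setT (fun x => ((x - m) ^+ j)%:E).
  apply/(integrable_image mid law (mpE j)).
  by have [] := normal_prob_moments m j sv0.
have [_] := normal_prob_moments m k sv0.
split; first exact: I.
rewrite /Rintegral -!(integral_image mid law (mpE _) (I _)).
by rewrite -(sqr_sqrtr (ltW v0)).
Qed.
End normal_law_moments.

(** Allows coefficients to be compared in polarized identities: the difference vanishes at more
    integers than its size permits. *)
Lemma horner_eq_poly (R : numDomainType) (p q : {poly R}) :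
  (forall x, p.[x] = q.[x]) -> p = q.
Proof.
move=> pq; apply/eqP; rewrite -subr_eq0; apply/eqP; set r := p - q.
pose s := [seq k%:R | k <- iota 0 (size r).+1] : seq R.
apply: (@roots_geq_poly_eq0 _ _ s).
- by apply/allP => x _; rewrite /root /r hornerD hornerN pq subrr.
- rewrite map_inj_uniq ?iota_uniq// => a b /eqP.
  by rewrite eqr_nat => /eqP.
- by rewrite size_map size_iota.
Qed.

(** * Integration by parts on a Gaussian space *)

Section all_moments.
Context d (Omega : measurableType d) (R : realType) (P : probability Omega R).
Implicit Types F G : Omega -> R.

(** This class is an algebra, so the integrability of any polynomial in Gaussian variables is
    checked along its structure. *)
Definition all_moments F := measurable_fun setT F /\
  forall k, P.-integrable setT (EFin \o (fun w => F w ^+ k)).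

Local Notation Ex F := (Rintegral P setT F).

Lemma am_measurable F : all_moments F -> measurable_fun setT F.
Proof. by case. Qed.

Lemma am_int F : all_moments F -> P.-integrable setT (EFin \o F).
Proof. by case=> _ /(_ 1%N). Qed.

Lemma am_cst (c : R) : all_moments (fun=> c).
Proof.
split; first exact: measurable_cst.
by move=> k; apply: finite_measure_integrable_cst; exact: measurableT.
Qed.

Lemma am_exp F k : all_moments F -> all_moments (fun w => F w ^+ k).
Proof.
move=> [mF iF]; split; first exact: measurable_funX.
by move=> j; under eq_fun do rewrite -exprM; exact: iF.
Qed.

Lemma integrable_le F G : measurable_fun setT F -> P.-integrable setT (EFin \o G) ->
  (forall w, `|F w| <= G w) -> P.-integrable setT (EFin \o F).
Proof.
move=> mF iG FG; apply: le_integrable iG => //; first exact/measurable_EFinP.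
move=> w _; rewrite lee_fin; exact: le_trans (FG w) (ler_norm _).
Qed.

Lemma integrable_add F G : P.-integrable setT (EFin \o F) ->
  P.-integrable setT (EFin \o G) -> P.-integrable setT (EFin \o (fun w => F w + G w)).
Proof. by move=> iF iG; apply: eq_integrable (integrableD measurableT iF iG). Qed.

Lemma integrable_scale (a : R) F : P.-integrable setT (EFin \o F) ->
  P.-integrable setT (EFin \o (fun w => a * F w)).
Proof. by move=> iF; apply: eq_integrable (integrableZl measurableT a iF). Qed.

Lemma am_mul F G : all_moments F -> all_moments G ->
  all_moments (fun w => F w * G w).
Proof.
move=> aF aG; have [mF iF] := aF; have [mG iG] := aG.
split; first exact: measurable_funM.
move=> k; apply: (integrable_le _ (integrable_add (iF (2 * k)%N) (iG (2 * k)%N))).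
  by apply: measurable_funX; exact: measurable_funM.
move=> w; rewrite exprMn !(mulnC 2) !exprM normrM.
rewrite -(real_normK (num_real (F w ^+ k))) -(real_normK (num_real (G w ^+ k))).
have := normr_ge0 (F w ^+ k); have := normr_ge0 (G w ^+ k).
by move: `|F w ^+ k| `|G w ^+ k| => a b a0 b0; nra.
Qed.

Lemma am_scale (a : R) F : all_moments F -> all_moments (fun w => a * F w).
Proof. by move=> aF; apply: am_mul => //; exact: am_cst. Qed.

Lemma integrable_bigsum n (F : 'I_n -> Omega -> R) :
  (forall i, P.-integrable setT (EFin \o F i)) ->
  P.-integrable setT (EFin \o (fun w => \sum_(i < n) F i w)).
Proof.
elim: n F => [|n IH] F iF.
  under eq_fun do rewrite big_ord0.
  exact: am_int (am_cst 0).
by under eq_fun do rewrite big_ord_recr; apply: integrable_add => //; exact: IH.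
Qed.

Lemma am_add F G : all_moments F -> all_moments G ->
  all_moments (fun w => F w + G w).
Proof.
move=> aF aG; split.
  by apply: measurable_funD; apply: am_measurable.
move=> k; under eq_fun do rewrite exprDn.
apply: integrable_bigsum => i; under eq_fun do rewrite -mulr_natl.
apply: integrable_scale; apply: am_int.
by apply: am_mul; exact: am_exp.
Qed.

Lemma am_sum n (F : 'I_n -> Omega -> R) : (forall i, all_moments (F i)) ->
  all_moments (fun w => \sum_(i < n) F i w).
Proof.
elim: n F => [|n IH] F iF; first by under eq_fun do rewrite big_ord0; exact: am_cst.
by under eq_fun do rewrite big_ord_recr; apply: am_add => //; exact: IH.
Qed.

Lemma ExD F G : all_moments F -> all_moments G ->
  Ex (fun w => F w + G w) = Ex F + Ex G.
Proof. by move=> aF aG; apply: RintegralD => //; exact: am_int. Qed.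

Lemma ExZ (a : R) F : all_moments F -> Ex (fun w => a * F w) = a * Ex F.
Proof. by move=> aF; apply: RintegralZl => //; exact: am_int. Qed.

Lemma Ex_cst (a : R) : Ex (fun=> a) = a.
Proof.
by rewrite Rintegral_cst// -[X in fine X]/(P setT) probability_setT mulr1.
Qed.

Lemma Ex_sum n (F : 'I_n -> Omega -> R) : (forall i, all_moments (F i)) ->
  Ex (fun w => \sum_(i < n) F i w) = \sum_(i < n) Ex (F i).
Proof.
elim: n F => [|n IH] F iF.
  by under eq_fun do rewrite big_ord0; rewrite big_ord0 Ex_cst.
under eq_fun do rewrite big_ord_recr/=.
by rewrite ExD ?big_ord_recr/= ?IH//; exact: am_sum.
Qed.

End all_moments.

Section gaussian_space.
Context d (Omega : measurableType d) (R : realType) (P : probability Omega R).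
Implicit Types (F U V W Z : Omega -> R) (m n : nat).
Local Notation Ex F := (Rintegral P setT F).
Local Notation am := (all_moments P).
Local Notation C U V := (Ex (fun w => U w * V w)).

(* A linear space of centered Gaussian variables, of which only the recursion
   of the moments along each line is retained. *)
Record gaussian_space (G : set (Omega -> R)) : Prop := GaussianSpace {
  gs_0 : G (fun=> 0) ;
  gs_lin : forall U V a, G U -> G V -> G (fun w => U w + a * V w) ;
  gs_am : forall U, G U -> am U ;
  gs_rec : forall U m, G U ->
    Ex (fun w => U w ^+ m.+1) = m%:R * C U U * Ex (fun w => U w ^+ m.-1) }.

(** Binomial expansion of E((U + e V)^n Z) in the parameter e; polarization reads off its
    coefficients of degree 0 and 1. *)
Definition line_poly U V Z n : {poly R} :=
  \poly_(i < n.+1) (Ex (fun w => U w ^+ (n - i) * V w ^+ i * Z w) *+ 'C(n, i)).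

Lemma horner_line_poly U V Z n (e : R) : am U -> am V -> am Z ->
  (line_poly U V Z n).[e] = Ex (fun w => (U w + e * V w) ^+ n * Z w).
Proof.
move=> aU aV aZ; rewrite horner_poly.
transitivity (Ex (fun w => \sum_(i < n.+1) ((e ^+ i *+ 'C(n, i)) *
    (U w ^+ (n - i) * V w ^+ i * Z w)))).
  rewrite Ex_sum => [|i]; last by apply: am_scale; do 2 apply: am_mul => //; exact: am_exp.
  apply: eq_bigr => i _; rewrite ExZ; last by do 2 apply: am_mul => //; exact: am_exp.
  by rewrite !mulrnAl mulrC.
congr Rintegral; apply/funext => w; rewrite exprDn mulr_suml; apply: eq_bigr => i _.
rewrite exprMn !mulrnAl; congr (_ *+ _).
by rewrite !mulrA; congr (_ * _); rewrite -!mulrA mulrCA.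
Qed.

Lemma coef0_line_poly U V Z n :
  (line_poly U V Z n)`_0 = Ex (fun w => U w ^+ n * Z w).
Proof.
rewrite coef_poly /= bin0 mulr1n subn0.
by congr Rintegral; apply/funext => w; rewrite expr0 mulr1.
Qed.

Lemma coef1_line_poly U V Z n :
  (line_poly U V Z n)`_1 = n%:R * Ex (fun w => U w ^+ n.-1 * V w * Z w).
Proof.
case: n => [|n]; first by rewrite coef_poly mul0r.
by rewrite coef_poly /= bin1 subn1 mulr_natl.
Qed.

Variable G : set (Omega -> R).
Hypothesis gG : gaussian_space G.

Let aG U : G U -> am U. Proof. exact: gs_am. Qed.

Lemma covD_l U V W a : G U -> G V -> G W ->
  C W (fun w => U w + a * V w) = C W U + a * C W V.
Proof.
move=> gU gV gW; rewrite -ExZ; last exact: am_mul (aG gW) (aG gV).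
rewrite -ExD; first by congr Rintegral; apply/funext => w; ring.
  exact: am_mul (aG gW) (aG gU).
by apply: am_scale; exact: am_mul (aG gW) (aG gV).
Qed.

Lemma covC U V : C U V = C V U.
Proof. by congr Rintegral; apply/funext => w; rewrite mulrC. Qed.

Lemma var_line U V a : G U -> G V ->
  C (fun w => U w + a * V w) (fun w => U w + a * V w) =
  C U U + 2 * a * C U V + a ^+ 2 * C V V.
Proof.
move=> gU gV; have gL := gs_lin gG a gU gV.
rewrite covD_l// (covC _ U) (covC _ V) !covD_l// (covC V U); ring.
Qed.

(** Polarization of [gs_rec] at exponent m + 1. The coefficient of degree 1 involves E(V U^(m-2)),
    hence the strong induction; the weights add up to 2 m + m (m - 1) = m (m + 1), and m + 1
    cancels. *)
Lemma gaussian_ibp_pow U V m : G U -> G V ->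
  Ex (fun w => V w * U w ^+ m) = m%:R * C V U * Ex (fun w => U w ^+ m.-1).
Proof.
move=> gU gV; elim/ltn_ind: m => m IH.
have aU := aG gU; have aV := aG gV; have a1 := am_cst P 1.
pose p := line_poly U V (fun=> 1) m.+1.
pose q := (m%:R *: ((C U U)%:P + (2 * C U V) *: 'X + C V V *: ('X * 'X)))
  * line_poly U V (fun=> 1) m.-1.
have pq : p = q.
  apply: horner_eq_poly => e; rewrite /q hornerM !hornerE !horner_line_poly//.
  have L := gs_lin gG e gU gV.
  transitivity (Ex (fun w => (U w + e * V w) ^+ m.+1)).
    by congr Rintegral; apply/funext => w; rewrite mulr1.
  rewrite (gs_rec gG m L) var_line// /=; congr (_ * _ * _); first by ring.
  by congr Rintegral; apply/funext => w; rewrite mulr1.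
have E1 Z k : Ex (fun w => U w ^+ k * Z w * 1) = Ex (fun w => Z w * U w ^+ k).
  by congr Rintegral; apply/funext => w; ring.
have E2 k : Ex (fun w => U w ^+ k * 1) = Ex (fun w => U w ^+ k).
  by congr Rintegral; apply/funext => w; ring.
have := congr1 (fun r : {poly R} => r`_1) pq.
rewrite coef1_line_poly /q -scalerAl coefZ !mulrDl !coefD coefCM -!scalerAl !coefZ.
rewrite -mulrA !coefXM /= mulr0 addr0 coef0_line_poly coef1_line_poly.
rewrite !E1 !E2 (covC U V) => H.
have m0 : (m.+1%:R : R) != 0 by rewrite pnatr_eq0.
apply: (mulfI m0); rewrite {}H.
case: m IH {p q pq} m0 => [|[|m]] IH m0; rewrite /GRing.scale/=; first by ring.
  by ring.
rewrite /GRing.scale/= IH//= (gs_rec gG _ gU).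
rewrite -[m.+3]addn1 -[m.+2]addn1 -[m.+1]addn1 !natrD.
by ring.
Qed.

(* Gaussian integration by parts [E (V U^m F) = E (D_V (U^m F))] holds for F,
   with D V the derivative of F in the direction V. *)
Definition ibp F (D : (Omega -> R) -> Omega -> R) := [/\ am F,
  forall V, G V -> am (D V) &
  forall U V m, G U -> G V -> Ex (fun w => V w * U w ^+ m * F w) =
    m%:R * C V U * Ex (fun w => U w ^+ m.-1 * F w)
    + Ex (fun w => U w ^+ m * D V w)].

Lemma ibp_cst1 : ibp (fun=> 1) (fun _ _ => 0).
Proof.
split=> [|V _|U V m gU gV]; [exact: am_cst|exact: am_cst|].
have -> : (fun w => V w * U w ^+ m * 1) = (fun w => V w * U w ^+ m).
  by apply/funext => w; rewrite mulr1.
have -> : (fun w => U w ^+ m.-1 * 1) = (fun w => U w ^+ m.-1).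
  by apply/funext => w; rewrite mulr1.
have -> : (fun w => U w ^+ m * 0) = (fun=> 0).
  by apply/funext => w; rewrite mulr0.
by rewrite gaussian_ibp_pow// Ex_cst addr0.
Qed.

(** Product rule. The formula for F at exponent m + 1 along U + e W has, in degree 1, one factor U
    replaced by W with multiplicity m + 1, a factor common to all terms. *)
Lemma ibp_mul F D W : ibp F D -> G W ->
  ibp (fun w => W w * F w) (fun V w => C V W * F w + W w * D V w).
Proof.
move=> [aF aD FD] gW; have aW := aG gW.
split=> [|V gV|U V m gU gV]; first exact: am_mul.
  apply: am_add; first exact: am_scale.
  by apply: am_mul => //; exact: aD.
have aU := aG gU; have aV := aG gV; have aDV := aD _ gV.
have aVF : am (fun w => V w * F w) by exact: am_mul.
pose p := line_poly U W (fun w => V w * F w) m.+1.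
pose q := (m.+1%:R *: ((C V U)%:P + (C V W) *: 'X))
  * line_poly U W F m + line_poly U W (D V) m.+1.
have pq : p = q.
  apply: horner_eq_poly => e; rewrite /q !hornerE !horner_line_poly//.
  have gL := gs_lin gG e gU gW.
  rewrite [_ * e]mulrC -covD_l// -FD//.
  by congr Rintegral; apply/funext => w; ring.
have := congr1 (fun r : {poly R} => r`_1) pq.
rewrite coefD !coef1_line_poly /= -scalerAl coefZ mulrDl coefD coefCM -scalerAl coefZ.
rewrite coefXM/= coef0_line_poly coef1_line_poly -mulrDr.
have m0 : (m.+1%:R : R) != 0 by rewrite pnatr_eq0.
move=> /(mulfI m0) H.
transitivity (Ex (fun w => U w ^+ m * W w * (V w * F w))).
  by congr Rintegral; apply/funext => w; ring.
rewrite H.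
have -> : Ex (fun w => U w ^+ m * (C V W * F w + W w * D V w)) =
   C V W * Ex (fun w => U w ^+ m * F w) + Ex (fun w => U w ^+ m * W w * D V w).
  have aUm k : am (fun w => U w ^+ k) by exact: am_exp.
  rewrite -ExZ; last exact: am_mul.
  rewrite -ExD; first by congr Rintegral; apply/funext => w; ring.
    by apply: am_scale; exact: am_mul.
  by apply: am_mul => //; exact: am_mul.
have -> : Ex (fun w => U w ^+ m.-1 * (W w * F w)) =
          Ex (fun w => U w ^+ m.-1 * W w * F w).
  by congr Rintegral; apply/funext => w; ring.
by ring.
Qed.

Lemma ibp_add F D F' D' a : ibp F D -> ibp F' D' ->
  ibp (fun w => F w + a * F' w) (fun V w => D V w + a * D' V w).
Proof.
move=> [aF aD FD] [aF' aD' FD'].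
split=> [|V gV|U V m gU gV].
- by apply: am_add => //; exact: am_scale.
- by apply: am_add; [exact: aD|apply: am_scale; exact: aD'].
have aUm k : am (fun w => U w ^+ k) by apply: am_exp; exact: aG.
have aV := aG gV; have aDV := aD _ gV; have aDV' := aD' _ gV.
have E Z Z' Z'' : am Z -> am Z' -> am Z'' ->
   Ex (fun w => Z w * (Z' w + a * Z'' w)) =
   Ex (fun w => Z w * Z' w) + a * Ex (fun w => Z w * Z'' w).
  move=> aZ aZ' aZ''; rewrite -ExZ; last exact: am_mul.
  rewrite -ExD; first by congr Rintegral; apply/funext => w; ring.
    exact: am_mul.
  by apply: am_scale; exact: am_mul.
have aVU : am (fun w => V w * U w ^+ m) by exact: am_mul.
by rewrite !E// FD// FD'//; ring.
Qed.

Lemma gs_sum n (X : 'I_n -> Omega -> R) (a : 'I_n -> R) : (forall i, G (X i)) ->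
  G (fun w => \sum_(i < n) a i * X i w).
Proof.
elim: n X a => [|n IH] X a gX.
  by under eq_fun do rewrite big_ord0; exact: gs_0 gG.
by under eq_fun do rewrite big_ord_recr; apply: (gs_lin gG) => //; exact: IH.
Qed.

Lemma ibp_sum n (F : 'I_n -> Omega -> R) D : (forall i, ibp (F i) (D i)) ->
  ibp (fun w => \sum_(i < n) F i w) (fun V w => \sum_(i < n) D i V w).
Proof.
elim: n F D => [|n IH] F D iF.
  (* The empty sum is obtained as 1 - 1. *)
  have := ibp_add (- 1) ibp_cst1 ibp_cst1; congr ibp.
    by apply/funext => w; rewrite big_ord0 mulN1r subrr.
  by apply/funext => V; apply/funext => w; rewrite big_ord0 mulr0 addr0.
have := ibp_add 1 (IH _ _ (fun i => iF (widen_ord (leqnSn n) i))) (iF ord_max).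
congr ibp; first by apply/funext => w; rewrite big_ord_recr mul1r.
by apply/funext => V; apply/funext => w; rewrite big_ord_recr mul1r.
Qed.

Section quadratic_functional.
Variables (n : nat) (X : 'I_n -> Omega -> R) (c : R).
Hypothesis gX : forall i, G (X i).

Definition cov_mx : 'M[R]_n := \matrix_(i, j) C (X i) (X j).

Definition quad w := c * (\sum_(i < n) X i w ^+ 2 - \tr cov_mx).

(** Half the derivative of the sum of squares in the direction V. *)
Definition quad_dir V w := \sum_(j < n) C V (X j) * X j w.

Lemma ibp_quad_mul F D : ibp F D -> ibp (fun w => quad w * F w)
  (fun V w => 2 * c * quad_dir V w * F w + quad w * D V w).
Proof.
move=> iF.
have i1 := ibp_sum (fun i => ibp_mul (ibp_mul iF (gX i)) (gX i)).
(* [ibp_add] only forms F + a F', so subtracting the trace and scaling by c are written with the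
   coefficients tr - 1 and c - 1. *)
have i2 := ibp_add (- 1) i1 (ibp_add (\tr cov_mx - 1) iF iF).
have i3 := ibp_add (c - 1) i2 i2.
move: i3; congr ibp.
  apply/funext => w; rewrite /quad.
  have -> : \sum_(i < n) X i w * (X i w * F w) = (\sum_(i < n) X i w ^+ 2) * F w.
    by rewrite mulr_suml; apply: eq_bigr => i _; ring.
  by move: (\sum_(i < n) _) => q; ring.
apply/funext => V; apply/funext => w; rewrite /quad /quad_dir.
have -> : \sum_(i < n) (C V (X i) * (X i w * F w)
    + X i w * (C V (X i) * F w + X i w * D V w)) =
    2 * (\sum_(j < n) C V (X j) * X j w) * F w + (\sum_(i < n) X i w ^+ 2) * D V w.
  rewrite -mulrA mulr_suml mulr_sumr mulr_suml -big_split/=.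
  by apply: eq_bigr => i _; ring.
move: (\sum_(i < n) _ ^+ 2) (\sum_(j < n) C V (X j) * X j w) => q s.
by ring.
Qed.

Lemma ibp_quad_exp m : ibp (fun w => quad w ^+ m)
  (fun V w => m%:R * (2 * c) * quad_dir V w * quad w ^+ m.-1).
Proof.
elim: m => [|m IH].
  have := ibp_cst1; congr ibp.
  by apply/funext => V; apply/funext => w; rewrite !mul0r.
have := ibp_quad_mul IH; congr ibp.
  by apply/funext => w; rewrite exprS.
apply/funext => V; apply/funext => w /=.
case: m IH => [|m] IH; first by rewrite expr0; ring.
by rewrite /= exprS -[m.+2]addn1 -[m.+1]addn1 !natrD; ring.
Qed.

Lemma am_quad : am quad.
Proof. by have [+ _ _] := ibp_quad_exp 1. Qed.

Definition quad_pow_dir k i w := \sum_(j < n) (cov_mx ^+ k) i j * X j w.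

(** The quantity M_(k,m) without its factor c^(k+1), which is restored where the recursions are
    applied. *)
Definition quad_moment k m :=
  Ex (fun w => (\sum_(i < n) X i w * quad_pow_dir k i w) * quad w ^+ m).

Lemma G_quad_pow_dir k i : G (quad_pow_dir k i).
Proof. exact: gs_sum. Qed.

Lemma quad_dirE i : quad_dir (X i) = quad_pow_dir 1 i.
Proof.
by apply/funext => w; apply: eq_bigr => j _; rewrite expr1 mxE.
Qed.

Lemma sum_quad_pow_dir k w :
  \sum_(i < n) quad_pow_dir k i w * quad_pow_dir 1 i w =
  \sum_(i < n) X i w * quad_pow_dir k.+1 i w.
Proof.
have symk : (cov_mx ^+ k)^T = cov_mx ^+ k.
  elim: k => [|k IH]; first by rewrite expr0 trmx1.
  have symc : cov_mx^T = cov_mx by apply/matrixP => i j; rewrite !mxE covC.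
  by rewrite exprSr [LHS]trmx_mul IH symc -exprSr exprS.
transitivity (\sum_(i < n) \sum_(j < n) (X j w * ((cov_mx ^+ k) j i * quad_pow_dir 1 i w))).
  apply: eq_bigr => i _; rewrite {1}/quad_pow_dir mulr_suml; apply: eq_bigr => j _.
  by rewrite -{1}symk mxE; ring.
rewrite exchange_big/=; apply: eq_bigr => j _; rewrite -mulr_sumr; congr (_ * _).
rewrite /quad_pow_dir expr1 [cov_mx ^+ k.+1]exprSr.
transitivity (\sum_(i < n) \sum_(l < n) ((cov_mx ^+ k) j i * cov_mx i l * X l w)).
  by apply: eq_bigr => i _; rewrite mulr_sumr; apply: eq_bigr => l _; rewrite mulrA.
by rewrite exchange_big/=; apply: eq_bigr => l _; rewrite -mulr_suml mxE.
Qed.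

(** Integration by parts in the factor X_i, with U = (A^k X)_i at power 1. Differentiating U gives
    the diagonal entry of A^(k+1); differentiating Q^m gives 2 m c (A X)_i Q^(m-1), and the symmetry
    of A merges A^k X and A X into A^(k+1). *)
Lemma quad_moment_rec k m : quad_moment k m =
  \tr (cov_mx ^+ k.+1) * Ex (fun w => quad w ^+ m)
  + m%:R * (2 * c) * quad_moment k.+1 m.-1.
Proof.
have [aS aD FD] := ibp_quad_exp m.
have aX i : am (X i) by exact: aG.
have aY j i : am (quad_pow_dir j i) by exact/aG/G_quad_pow_dir.
have aSm j : am (fun w => quad w ^+ j) by apply: am_exp; exact: am_quad.
rewrite /quad_moment.
transitivity (\sum_(i < n) Ex (fun w => X i w * quad_pow_dir k i w ^+ 1 * quad w ^+ m)).
  rewrite -Ex_sum.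
    by congr Rintegral; apply/funext => w; rewrite mulr_suml.
  move=> i; apply: am_mul => //; apply: am_mul => //; exact: am_exp.
transitivity (\sum_(i < n) ((cov_mx ^+ k.+1) i i * Ex (fun w => quad w ^+ m)
   + m%:R * (2 * c) *
     Ex (fun w => quad_pow_dir k i w * quad_pow_dir 1 i w * quad w ^+ m.-1))).
  apply: eq_bigr => i _; rewrite (FD _ _ 1%N (G_quad_pow_dir k i) (gX i)).
  congr (_ + _).
    have -> : C (X i) (quad_pow_dir k i) = (cov_mx ^+ k.+1) i i.
      rewrite exprSr mxE.
      transitivity (\sum_(j < n) Ex (fun w => (cov_mx ^+ k) i j * (X i w * X j w))).
        rewrite -Ex_sum => [|j]; last by apply: am_scale; exact: am_mul.
        congr Rintegral; apply/funext => w; rewrite mulr_sumr; apply: eq_bigr => j _.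
        by ring.
      apply: eq_bigr => j _; rewrite ExZ; last exact: am_mul.
      by rewrite [cov_mx j i]mxE covC.
    by rewrite mul1r; congr (_ * _); congr Rintegral; apply/funext => w; rewrite mul1r.
  rewrite -ExZ; last by apply: am_mul => //; exact: am_mul.
  by congr Rintegral; apply/funext => w; rewrite quad_dirE expr1; ring.
rewrite big_split/= -mulr_suml -mulr_sumr; congr (_ + _ * _).
rewrite -Ex_sum.
  by congr Rintegral; apply/funext => w; rewrite -mulr_suml sum_quad_pow_dir.
by move=> i; apply: am_mul => //; exact: am_mul.
Qed.

(** One factor Q is c (<X, X> - tr A), that is, the case k = 0 of the mixed moments; the trace term
    of its recursion cancels the centering. *)
Lemma quad_moment_recS m : Ex (fun w => quad w ^+ m.+1) =
  m%:R * (2 * c ^+ 2) * quad_moment 1 m.-1.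
Proof.
have aSm j : am (fun w => quad w ^+ j) by apply: am_exp; exact: am_quad.
have aX i : am (X i) by exact: aG.
have aQ : am (fun w => (\sum_(i < n) X i w * quad_pow_dir 0 i w) * quad w ^+ m).
  apply: am_mul => //; apply: am_sum => i; apply: am_mul => //.
  exact/aG/G_quad_pow_dir.
transitivity (c * (quad_moment 0 m - \tr cov_mx * Ex (fun w => quad w ^+ m))).
  rewrite -mulNr -ExZ// -ExD//; last exact: am_scale.
  rewrite -ExZ; last by apply: am_add => //; exact: am_scale.
  congr Rintegral; apply/funext => w; rewrite exprS {1}/quad.
  have -> : \sum_(i < n) X i w * quad_pow_dir 0 i w = \sum_(i < n) X i w ^+ 2.
    apply: eq_bigr => i _; rewrite expr2; congr (_ * _).
    rewrite /quad_pow_dir (bigD1 i)//= big1 => [|j ji].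
      by rewrite expr0 mxE eqxx mul1r addr0.
    by rewrite expr0 mxE eq_sym (negbTE ji) mul0r.
  by rewrite -mulrA mulrDl.
by rewrite quad_moment_rec expr1; ring.
Qed.

End quadratic_functional.

End gaussian_space.

Lemma cvg_ext (R : realType) (u v : nat -> R) (l : R) : (forall n, u n = v n) ->
  v n @[n --> \oo] --> l -> u n @[n --> \oo] --> l.
Proof. by move=> /funext ->. Qed.

(** * Convergence of moments *)

Section cumulant_recursion.
Context {R : realType}.
Variables (tau : R) (T s : nat -> nat -> R) (M : nat -> nat -> nat -> R).
Variable g : nat -> R.
Hypothesis s0 : forall n, s n 0 = 1.
Hypothesis sS : forall n m, s n m.+1 = 2 * m%:R * M n 1 m.-1.
Hypothesis Mrec : forall n k m,
  M n k m = T n k.+1 * s n m + 2 * m%:R * M n k.+1 m.-1.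
Hypothesis T2 : T n 2 @[n --> \oo] --> tau / 2.
Hypothesis T3 : forall k, T n k.+3 @[n --> \oo] --> 0.
Hypothesis g0 : g 0 = 1.
Hypothesis gS : forall m, g m.+1 = m%:R * tau * g m.-1.

(** From index k = 2 on, every term of the unfolded recursion of M carries a trace of order at least
    3 and tends to 0. Only M_(1,m-1) survives, through T_2, and this yields the Gaussian recursion
    for the limits. *)
Lemma cvg_cumulant_recursion m : s n m @[n --> \oo] --> g m.
Proof.
have cM (a : R) (u : nat -> R) l : u n @[n --> \oo] --> l -> a * u n @[n --> \oo] --> a * l.
  by move=> ul; apply: cvgM => //; exact: cvg_cst.
elim/ltn_ind: m => -[|m] IH.
  by rewrite g0; apply: (cvg_ext (fun n => s0 n)); exact: cvg_cst.
have M2 k j : (j <= m)%N -> M n k.+2 j @[n --> \oo] --> 0.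
  elim: j k => [|j IHj] k jm; apply: (cvg_ext (fun n => Mrec n _ _)).
    rewrite -[X in _ --> X](addr0 0) -{1}(mul0r (g 0)); apply: cvgD.
      by apply: cvgM; [exact: T3|exact: IH].
    by apply: (@cvg_ext _ _ (fun=> 0)) => [n|]; [rewrite mulr0 mul0r|exact: cvg_cst].
  have -> : 0 = 0 * g j.+1 + 2 * j.+1%:R * 0 by rewrite mulr0 mul0r addr0.
  apply: cvgD; first by apply: cvgM; [exact: T3|exact: IH].
  by apply: (@cM); apply: IHj; exact: ltnW.
apply: (cvg_ext (fun n => sS n m)); rewrite gS.
case: m IH M2 => [|m] IH M2.
  rewrite mul0r mul0r.
  by apply: (@cvg_ext _ _ (fun=> 0)) => [n|]; [rewrite mulr0 mul0r|exact: cvg_cst].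
have -> : m.+1%:R * tau * g m.+1.-1 = 2 * m.+1%:R * (tau / 2 * g m + 2 * m%:R * 0).
  by rewrite /=; field.
apply: (@cM); apply: (cvg_ext (fun n => Mrec n _ _)).
apply: cvgD; first by apply: cvgM => //; exact: IH.
apply: (@cM); apply: M2; exact: leq_trans (leq_pred _) (leqnSn _).
Qed.
End cumulant_recursion.

(** * From moments to convergence in law *)

Section weierstrass.
Context {R : realType}.
Implicit Types (G phi psi : R -> R) (e y : R).

(** Only x is confined to the segment. The Bernstein estimate uses this freedom, since it compares y
    with nodes k/n that may exceed 1. *)
Lemma uniformly_continuous_segment G (a b e : R) : continuous G -> 0 < e -> exists2 dl, 0 < dl &
  forall x y, a <= x <= b -> `|y - x| <= dl -> `|G y - G x| <= e.
Proof.
move=> cG e0.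
have /compact_near_coveringP/near_covering_withinP := @segment_compact R a b.
move=> /(_ R (0^'+) (fun dl x => forall y, `|y - x| <= dl -> `|G y - G x| <= e) _).
have main x : `[a, b]%classic x -> \forall x' \near x & dl \near 0^'+,
    `[a, b]%classic x' -> forall y, `|y - x'| <= dl -> `|G y - G x'| <= e.
  move=> _; have e20 : 0 < e / 2 by rewrite divr_gt0.
  have /cvgrPdist_le/(_ _ e20)/nbhs_ballP [r /= r0 Hr] := cG x.
  have r20 : 0 < r / 2 by rewrite divr_gt0.
  exists ([set x' | `|x - x'| < r / 2], [set dl | dl < r / 2]) => /=.
    split; first by apply/nbhs_ballP; exists (r / 2).
    exact: nbhs_right_lt.
  move=> [x' dl] /= [xx' dlr] _ y yx'.
  have H1 : `|G x - G x'| <= e / 2.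
    by apply: Hr; rewrite /ball/=; apply: lt_trans xx' _; rewrite gtr_pMr// invf_lt1// ltr1n.
  have H2 : `|G x - G y| <= e / 2.
    apply: Hr; rewrite /ball/=; have := ler_normD (x - x') (x' - y).
    rewrite addrA subrK => /le_lt_trans; apply; rewrite [ltRHS]splitr.
    by apply: ltrD => //; rewrite distrC; exact: le_lt_trans yx' dlr.
  have -> : G y - G x' = (G x - G x') - (G x - G y) by ring.
  by rewrite (splitr e); apply: (le_trans (ler_normB _ _)); exact: lerD.
move=> /(_ main) H.
have : exists dl : R, 0 < dl /\ (`[a, b]%classic `<=`
    (fun x => forall y, `|y - x| <= dl -> `|G y - G x| <= e)).
  near (0:R)^'+ => dl; exists dl; split; first by near: dl; exact: nbhs_right_gt.
  by near: dl.
by case=> dl [dl0 Hdl]; exists dl => // x y xab; apply: Hdl; rewrite /= in_itv.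
Unshelve. all: by end_near. Qed.

(* [bern n phi y] is the mean of [phi] under the binomial law of parameters
   n and y. *)
Fixpoint bern n (phi : nat -> R) y : R :=
  if n is k.+1 then y * bern k (phi \o S) y + (1 - y) * bern k phi y else phi 0%N.

Lemma ler_bern n (phi psi : nat -> R) y : 0 <= y <= 1 ->
  (forall k, phi k <= psi k) -> bern n phi y <= bern n psi y.
Proof.
move=> /andP[y0 y1]; elim: n phi psi => [|n IH] phi psi H /=; first exact: H.
by apply: lerD; apply: ler_wpM2l; rewrite ?subr_ge0//; apply: IH => k //=.
Qed.

Lemma bernD n (phi psi : nat -> R) y :
  bern n (fun k => phi k + psi k) y = bern n phi y + bern n psi y.
Proof.
elim: n phi psi => [//|n IH] phi psi /=.
by rewrite (IH (phi \o S)) IH; ring.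
Qed.

Lemma bernZ n a (phi : nat -> R) y :
  bern n (fun k => a * phi k) y = a * bern n phi y.
Proof.
elim: n phi => [//|n IH] phi /=.
by rewrite (IH (phi \o S)) IH; ring.
Qed.

Lemma bern_cst n a y : bern n (fun=> a) y = a.
Proof. by elim: n => [//|n IH] /=; rewrite -[(fun=> a) \o S]/(fun=> a) IH; ring. Qed.

(** Squared bias plus variance of the binomial law; a is arbitrary because the inductive step shifts
    it by one. *)
Lemma bern_var n a y :
  bern n (fun k => (k%:R - a) ^+ 2) y = (n%:R * y - a) ^+ 2 + n%:R * y * (1 - y).
Proof.
elim: n a => [|n IH] a; first by rewrite /=; ring.
rewrite /= IH.
have -> : (fun k : nat => (k%:R - a) ^+ 2) \o S = (fun k : nat => (k%:R - (a - 1)) ^+ 2).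
  by apply/funext => k /=; rewrite -[k.+1]addn1 natrD; ring.
by rewrite !IH -[n.+1]addn1 natrD; ring.
Qed.

Lemma ler_norm_bern n (phi : nat -> R) (M : R) y : 0 <= y <= 1 ->
  (forall k, `|phi k| <= M) -> `|bern n phi y| <= M.
Proof.
move=> y01 H; rewrite ler_norml; apply/andP; split.
  rewrite -[leLHS](bern_cst n _ y); apply: ler_bern => // k.
  by have := H k; rewrite ler_norml => /andP[].
rewrite -[leRHS](bern_cst n _ y); apply: ler_bern => // k.
by have := H k; rewrite ler_norml => /andP[].
Qed.

Lemma bernstein_approximation G (M e : R) : continuous G -> (forall y, `|G y| <= M) -> 0 < e ->
  exists n, forall y, 0 <= y <= 1 ->
    `|bern n (fun k => G (k%:R / n%:R)) y - G y| <= e.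
Proof.
move=> cG GM e0.
have M0 : 0 <= M := le_trans (normr_ge0 _) (GM 0).
have e20 : 0 < e / 2 by rewrite divr_gt0.
have [dl dl0 Hdl] := uniformly_continuous_segment 0 1 cG e20.
(* Chebyshev's argument: at distance more than dl the difference is at most 2 M, hence at most K
   times the squared distance, whose binomial mean is at most 1/n. *)
pose K := 2 * M / dl ^+ 2.
have K0 : 0 <= K by rewrite mulr_ge0 ?mulr_ge0// invr_ge0 exprn_ge0// ltW.
near \oo => n.
have n0 : (0 < n)%N by near: n; exact: nbhs_infty_gt.
have nR : 0 < n%:R :> R by rewrite ltr0n.
have nK : K / (e / 2) <= n%:R by near: n; exact: nbhs_infty_ger.
exists n => y y01; have /andP[y0 y1] := y01.
have HG k : `|G (k%:R / n%:R) - G y| <= e / 2 + K / n%:R ^+ 2 * (k%:R - n%:R * y) ^+ 2.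
  have [d1|d1] := lerP `|k%:R / n%:R - y| dl.
    apply: (le_trans (Hdl _ _ y01 d1)).
    rewrite lerDl; apply: mulr_ge0; last exact: sqr_ge0.
    by apply: divr_ge0 => //; exact: sqr_ge0.
  apply: (@le_trans _ _ (2 * M)).
    by apply: (le_trans (ler_normB _ _)); rewrite mulr2n mulrDl mul1r; exact: lerD.
  apply: ler_wpDl; first exact: ltW.
  have -> : K / n%:R ^+ 2 * (k%:R - n%:R * y) ^+ 2 = K * (k%:R / n%:R - y) ^+ 2.
    by field; rewrite gt_eqF.
  rewrite /K -mulrA ler_peMr ?mulr_ge0// mulrC ler_pdivlMr ?exprn_gt0// mul1r.
  by rewrite -[leRHS]real_normK ?num_real// ler_sqr ?nnegrE// ltW.
pose q (k : nat) := e / 2 + K / n%:R ^+ 2 * (k%:R - n%:R * y) ^+ 2.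
have Hq : bern n q y <= e.
  have -> : bern n q y = e / 2 + K / n%:R ^+ 2 *
      ((n%:R * y - n%:R * y) ^+ 2 + n%:R * y * (1 - y)).
    by rewrite -bern_var -bernZ -{1}(bern_cst n (e / 2) y) -bernD.
  rewrite subrr expr0n add0r.
  rewrite [leRHS]splitr lerD2l.
  have -> : K / n%:R ^+ 2 * (n%:R * y * (1 - y)) = K / n%:R * (y * (1 - y)).
    by field; rewrite gt_eqF.
  apply: (@le_trans _ _ (K / n%:R)).
    have yy : y * (1 - y) <= 1 by nra.
    by apply: ler_piMr => //; apply: divr_ge0.
  by rewrite ler_pdivrMr// mulrC -ler_pdivrMr.
pose p (k : nat) := G (k%:R / n%:R).
have E : bern n p y - G y = bern n (fun k => p k + -1 * G y) y.
  by rewrite bernD (bern_cst n (-1 * G y)) mulN1r.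
rewrite E ler_norml; apply/andP; split.
  apply: (@le_trans _ _ (bern n (fun k => -1 * q k) y)).
    by rewrite bernZ mulN1r lerN2.
  apply: ler_bern => // k; have := HG k; rewrite ler_norml => /andP[+ _].
  by rewrite !mulN1r.
apply: (@le_trans _ _ (bern n q y)) => //.
apply: ler_bern => // k; have := HG k; rewrite ler_norml => /andP[_].
by rewrite mulN1r.
Unshelve. all: by end_near. Qed.
End weierstrass.

(** * Taylor remainders of the cosine *)

Section cos_taylor.
Context {R : realType}.
Implicit Types a b x y : R.

Lemma is_derive_pow k x : is_derive x 1 (fun y : R => y ^+ k) (k%:R * x ^+ k.-1).
Proof.
have := is_derive_pow_center 0 k x; rewrite subr0.
by under eq_fun do rewrite subr0.
Qed.

Lemma is_derive_cos_affine a b x :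
  is_derive x 1 (fun y => cos (a * y + b)) (a * cos (a * x + b + pi / 2)).
Proof.
have d1 : is_derive x 1 ((a \*: id) + cst b : R -> R) (a *: 1 + 0).
  by apply: is_deriveD.
have := is_derive1_comp (is_derive_cos _) d1.
by move/is_derive_eq; apply; rewrite cosDpihalf addr0 /GRing.scale/=; ring.
Qed.

(** Each derivative of the cosine is a phase shift by pi/2, so these are the Taylor coefficients of
    cos(a y + b) at 0. *)
Definition cos_coef a b k : R := a ^+ k * cos (b + k%:R * (pi / 2)) / k`!%:R.

Definition cos_rem a b m y : R :=
  cos (a * y + b) - \sum_(k < m) cos_coef a b k * y ^+ k.

Lemma is_derive_cos_rem a b m x :
  is_derive x 1 (cos_rem a b m.+1) (a * cos_rem a (b + pi / 2) m x).
Proof.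
elim: m => [|m IH].
  have -> : cos_rem a b 1 = (fun y => cos (a * y + b)) - cst (cos b).
    apply/funext => y; rewrite /cos_rem big_ord1 /cos_coef.
    by rewrite !expr0 mul0r addr0 fact0 divr1 mulr1 mul1r.
  have := is_deriveB (is_derive_cos_affine a b x) (is_derive_cst (cos b) x 1).
  by move/is_derive_eq; apply; rewrite /cos_rem big_ord0 !subr0 addrA.
have -> : cos_rem a b m.+2 =
    cos_rem a b m.+1 - cos_coef a b m.+1 \*: (fun y : R => y ^+ m.+1).
  by apply/funext => y; rewrite /cos_rem big_ord_recr/= opprD addrA.
have := is_deriveB IH (is_deriveZ (cos_coef a b m.+1) (is_derive_pow m.+1 x)).
move/is_derive_eq; apply.
have -> : cos_rem a (b + pi / 2) m.+1 x =
    cos_rem a (b + pi / 2) m x - cos_coef a (b + pi / 2) m * x ^+ m.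
  by rewrite /cos_rem big_ord_recr /= opprD addrA.
rewrite [RHS]mulrBr; congr (_ - _); rewrite /GRing.scale/=; rewrite /cos_coef factS natrM exprS.
have -> : b + pi / 2 + m%:R * (pi / 2) = b + m.+1%:R * (pi / 2).
  by rewrite -[m.+1]addn1 natrD; ring.
have f0 : (m`!%:R : R) != 0 by rewrite pnatr_eq0 -lt0n fact_gt0.
have m0 : (m.+1%:R : R) != 0 by rewrite pnatr_eq0.
by move: (cos _) f0 m0 (x ^+ m) (a ^+ m) => c; move: (m.+1%:R) (m`!%:R) => p q p0 q0 s t; field; rewrite p0 q0.
Qed.

Lemma cos_rem0 a b m : cos_rem a b m.+1 0 = 0.
Proof.
rewrite /cos_rem big_ord_recl big1 => [|i _]; last by rewrite /= expr0n mulr0.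
by rewrite /cos_coef !expr0 fact0 mulr0 mul0r addr0 add0r divr1 mul1r mulr1 addr0 subrr.
Qed.

(** The majorant plus or minus the remainder vanishes at 0, and its derivative is nonnegative by the
    bound of lower order at the shifted phase. *)
Lemma ler_cos_rem a b m y : 0 <= y ->
  `|cos_rem a b m y| <= `|a| ^+ m * y ^+ m / m`!%:R.
Proof.
elim: m a b y => [|m IH] a b y y0.
  by rewrite /cos_rem big_ord0 subr0 !expr0 fact0 divr1 mulr1 cos_max.
move: y0; rewrite le_eqVlt => /predU1P[<-|y0].
  rewrite cos_rem0 normr0.
  by rewrite expr0n/= mulr0 mul0r.
pose B (x : R) := (`|a| ^+ m.+1 / m.+1`!%:R) * x ^+ m.+1.
have dB x : is_derive x 1 B (`|a| ^+ m.+1 * x ^+ m / m`!%:R).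
  have := is_deriveZ (`|a| ^+ m.+1 / m.+1`!%:R) (is_derive_pow m.+1 x).
  move/is_derive_eq; apply; rewrite /GRing.scale/= factS natrM.
  have f0 : (m`!%:R : R) != 0 by rewrite pnatr_eq0 -lt0n fact_gt0.
  have m0 : (m.+1%:R : R) != 0 by rewrite pnatr_eq0.
  by move: (m.+1%:R) m0 (m`!%:R) f0 (x ^+ m) (`|a| ^+ m.+1) => p p0 q q0 s t; field; rewrite p0 q0.
have main (e : R) : `|e| = 1 -> 0 <= B y + e * cos_rem a b m.+1 y.
  move=> e1; pose h := B + e \*: cos_rem a b m.+1.
  have dh x : is_derive x 1 h (`|a| ^+ m.+1 * x ^+ m / m`!%:R
      + e *: (a * cos_rem a (b + pi / 2) m x)).
    exact: (is_deriveD (dB x) (is_deriveZ e (is_derive_cos_rem a b m x))).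
  have ch : continuous h.
    by move=> x; apply/differentiable_continuous/derivable1_diffP.
  have [|c /[!in_itv]/= /andP[c0 cy]] := @MVT _ h _ 0 y y0 (fun x _ => dh x).
    exact: continuous_subspaceT.
  have -> : h 0 = 0.
    by rewrite -[h 0]/(B 0 + e * cos_rem a b m.+1 0) cos_rem0 mulr0 addr0 /B expr0n mulr0.
  rewrite subr0 -[h y]/(B y + e * cos_rem a b m.+1 y) => ->.
  rewrite subr0 mulr_ge0// ?(ltW y0)//.
  have := IH a (b + pi / 2) c (ltW c0).
  move: (cos_rem _ _ _ _) => r Hr.
  have H2 : `|e * (a * r)| <= `|a| ^+ m.+1 * c ^+ m / m`!%:R.
    by rewrite !normrM e1 mul1r exprS -!mulrA ler_wpM2l// mulrA.
  have := ler_norm (- (e * (a * r))); rewrite normrN /GRing.scale/=.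
  by move: H2; move: (`|a| ^+ m.+1 * c ^+ m / m`!%:R) (`|e * (a * r)|) (e * (a * r)) => u v z; lra.
have -> : `|a| ^+ m.+1 * y ^+ m.+1 / m.+1`!%:R = B y by rewrite /B; ring.
rewrite ler_norml; apply/andP; split.
  by have := main 1 (normr1 _); rewrite mul1r; lra.
by have := main (-1) (normrN1 _); rewrite mulN1r; lra.
Qed.

(** An even order makes the bound a power of y, whose mean is a moment; changing the signs of a and
    y together reduces negative y to positive y. *)
Lemma ler_cos_rem_even a b m y :
  `|cos_rem a b (2 * m) y| <= a ^+ (2 * m) * y ^+ (2 * m) / (2 * m)`!%:R.
Proof.
have ev (z : R) : z ^+ (2 * m) = `|z| ^+ (2 * m).
  by rewrite !exprM real_normK ?num_real.
rewrite (ev a); have [y0|/ltW y0] := leP 0 y; first exact: ler_cos_rem.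
have -> : cos_rem a b (2 * m) y = cos_rem (- a) b (2 * m) (- y).
  rewrite /cos_rem mulrNN; congr (_ - _); apply: eq_bigr => k _.
  rewrite /cos_coef; have E : a ^+ k * y ^+ k = (- a) ^+ k * (- y) ^+ k.
    by rewrite -!exprMn mulrNN.
  have ac (p q r s : R) : p * q / r * s = p * s * (q / r) by ring.
  by rewrite !ac E.
have -> : y ^+ (2 * m) = (- y) ^+ (2 * m) by rewrite !exprM sqrrN.
by rewrite -(normrN a); apply: ler_cos_rem; rewrite oppr_ge0.
Qed.
End cos_taylor.

(* The clamping to [-sin (1/2), sin (1/2)] makes the inverse of sin continuous on
   the whole line. *)
Lemma sin_chart (R : realType) : exists2 v : R -> R, continuous v &
  forall x, `|x| <= 2^-1 -> v ((1 + sin x) / 2) = x.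
Proof.
pose c : R := 2^-1.
have p1 := pihalf_ge1 R.
have c0 : 0 < c by rewrite invr_gt0.
have c1 : c < 1 by rewrite invf_lt1 ?ltr1n.
have inI x : - c <= x <= c -> x \in `[- (pi / 2), pi / 2].
  by move=> /andP[? ?]; rewrite in_itv/=; apply/andP; split; lra.
have sc0 : 0 < sin c by apply: sin_gt0_pihalf; apply/andP; split; lra.
have sc1 : sin c < 1.
  rewrite -[ltRHS]sin_pihalf ltr_sin; first by lra.
    by apply: inI; apply/andP; split; lra.
  by rewrite in_itv/=; apply/andP; split; lra.
pose cl (y : R) : R := Num.max (- sin c) (Num.min (sin c) (2 * y - 1)).
have clB y : - sin c <= cl y <= sin c.
  rewrite /cl le_max lexx/= ge_max ge_min lexx/= andbT; lra.
exists (fun y => asin (cl y)).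
  move=> y; apply: (cvg_comp cl asin); last first.
    by apply: continuous_asin; have := clB y; move=> /andP[? ?]; apply/andP; split; lra.
  have c2 : {for y, continuous (fun z : R => 2 * z - 1 : R)}.
    by apply: cvgB; [apply: cvgM; [exact: cvg_cst|exact: cvg_id]|exact: cvg_cst].
  have c3 : {for y, continuous (fun z : R => Num.min (sin c) (2 * z - 1) : R)}.
    by apply: (@continuous_min _ _ (fun=> sin c)) => //; exact: cvg_cst.
  suff: {for y, continuous cl} by [].
  have c4 : {for y, continuous (fun=> - sin c : R)} by exact: cvg_cst.
  exact: (continuous_max c4 c3).
move=> x; rewrite ler_norml => xc; have xI := inI _ xc; have /andP[x0 x1] := xc.
have cI : c \in `[- (pi / 2), pi / 2] by apply: inI; apply/andP; split; lra.
have NcI : - c \in `[- (pi / 2), pi / 2] by apply: inI; apply/andP; split; lra.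
have le_sin : {in `[- (pi / 2), pi / 2] &, {mono sin : a b / a <= b :> R}}.
  by move=> a b aI bI; rewrite !leNgt ltr_sin.
have -> : cl ((1 + sin x) / 2) = sin x.
  rewrite /cl; have -> : 2 * ((1 + sin x) / 2) - 1 = sin x :> R by field.
  have s1 : sin x <= sin c by rewrite le_sin.
  have s2 : - sin c <= sin x by rewrite -sinN le_sin.
  by rewrite (min_idPr s1) (max_idPr s2).
exact: sinK.
Qed.

Lemma cvg_bigsum (R : realType) N (F : nat -> nat -> R) (l : nat -> R) :
  (forall k, F k n @[n --> \oo] --> l k) ->
  \sum_(k < N) F k n @[n --> \oo] --> \sum_(k < N) l k.
Proof.
move=> Fl; elim: N => [|N IH].
  by rewrite big_ord0; apply: (@cvg_ext _ _ (fun=> 0)) => [n|];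
    [rewrite big_ord0|exact: cvg_cst].
rewrite big_ord_recr; apply: (@cvg_ext _ _ (fun n => \sum_(k < N) F k n + F N n)).
  by move=> n; rewrite big_ord_recr.
by apply: cvgD.
Qed.

Section bounded_moments.
Context d (Omega : measurableType d) (R : realType) (P : probability Omega R).
Implicit Types F Y : Omega -> R.

Lemma am_bounded F (M : R) : measurable_fun setT F -> (forall w, `|F w| <= M) ->
  all_moments P F.
Proof.
move=> mF FM; split => // k.
apply: (@integrable_le _ _ _ P _ (fun=> M ^+ k)).
- exact: measurable_funX.
- exact: am_int (am_cst P _).
- by move=> w; rewrite normrX; apply: lerXn2r; rewrite ?nnegrE//; exact: le_trans (FM w).
Qed.

Lemma ler_Ex F F' : all_moments P F -> all_moments P F' -> (forall w, F w <= F' w) ->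
  Rintegral P setT F <= Rintegral P setT F'.
Proof. by move=> aF aF' FF; apply: le_Rintegral => //; exact: am_int. Qed.

Lemma ler_norm_ExB F F' F'' : all_moments P F -> all_moments P F' ->
  all_moments P F'' -> (forall w, `|F w - F' w| <= F'' w) ->
  `|Rintegral P setT F - Rintegral P setT F'| <= Rintegral P setT F''.
Proof.
move=> aF aF' aF'' H.
have E : Rintegral P setT F - Rintegral P setT F' =
    Rintegral P setT (fun w => F w + -1 * F' w).
  by rewrite ExD// ?ExZ ?mulN1r//; exact: am_scale.
have aE : all_moments P (fun w => F w + -1 * F' w).
  by apply: am_add => //; exact: am_scale.
rewrite E ler_norml; apply/andP; split.
  rewrite -[leLHS]mulN1r -ExZ//; apply: ler_Ex => //; first exact: am_scale.
  by move=> w; have := H w; rewrite ler_norml !mulN1r => /andP[].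
by apply: ler_Ex => // w; have := H w; rewrite ler_norml mulN1r => /andP[].
Qed.

Lemma Ex_affine F (a b : R) : all_moments P F ->
  Rintegral P setT (fun w => a + b * F w) = a + b * Rintegral P setT F.
Proof.
move=> aF; rewrite ExD; [|exact: am_cst|exact: am_scale].
by rewrite Ex_cst ExZ.
Qed.

Lemma am_cos Y (a b : R) : all_moments P Y -> all_moments P (fun w => cos (a * Y w + b)).
Proof.
move=> aY; apply: (@am_bounded _ 1) => [|w]; last exact: cos_max.
apply: measurableT_comp.
  by apply: continuous_measurable_fun; exact: continuous_cos.
apply: measurable_funD => //; apply: measurable_funM => //; exact: am_measurable aY.
Qed.

Lemma ler_Ex_cos_rem Y (a b : R) m : all_moments P Y ->
  `|Rintegral P setT (fun w => cos (a * Y w + b))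
    - \sum_(k < 2 * m) cos_coef a b k * Rintegral P setT (fun w => Y w ^+ k)| <=
  a ^+ (2 * m) / (2 * m)`!%:R * Rintegral P setT (fun w => Y w ^+ (2 * m)).
Proof.
move=> aY; have aYk k : all_moments P (fun w => Y w ^+ k) by exact: am_exp.
have -> : \sum_(k < 2 * m) cos_coef a b k * Rintegral P setT (fun w => Y w ^+ k) =
   Rintegral P setT (fun w => \sum_(k < 2 * m) cos_coef a b k * Y w ^+ k).
  rewrite Ex_sum => [|k]; last exact: am_scale.
  by apply: eq_bigr => k _; rewrite ExZ.
rewrite -ExZ//; apply: ler_norm_ExB.
- exact: am_cos.
- by apply: am_sum => k; exact: am_scale.
- exact: am_scale.
- by move=> w; rewrite mulrAC; exact: ler_cos_rem_even.
Qed.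
End bounded_moments.

(** * From cosines to bounded continuous functions *)

Section moment_method.
Context d (Omega : measurableType d) (R : realType) (P : probability Omega R).
Variables (S : nat -> Omega -> R) (nu : probability R R).
Hypothesis aS : forall n, all_moments P (S n).
Hypothesis anu : all_moments nu (fun x => x).
Hypothesis cvg_moments : forall m, Rintegral P setT (fun w => S n w ^+ m) @[n --> \oo]
  --> Rintegral nu setT (fun x => x ^+ m).
Hypothesis moments_growth : forall a : R,
  a ^+ (2 * m) / (2 * m)`!%:R * Rintegral nu setT (fun x => x ^+ (2 * m))
  @[m --> \oo] --> (0 : R).
Local Notation Ex F := (Rintegral P setT F).
Local Notation En F := (Rintegral nu setT F).

(** Continuity and boundedness are carried along so that linear combinations of test functions
    remain integrable. *)
Definition cvg_test (h : R -> R) := [/\ continuous h, exists M, forall x, `|h x| <= M &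
  Ex (fun w => h (S n w)) @[n --> \oo] --> En h].

Lemma am_test (h : R -> R) M : continuous h -> (forall x, `|h x| <= M) ->
  (forall n, all_moments P (fun w => h (S n w))) /\ all_moments nu h.
Proof.
move=> ch hM; have mh : measurable_fun setT h by exact: continuous_measurable_fun.
split=> [n|]; apply: am_bounded => //.
by apply: measurableT_comp => //; exact: am_measurable (aS n).
Qed.

Lemma cvg_test_lin h k a : cvg_test h -> cvg_test k ->
  cvg_test (fun x => h x + a * k x).
Proof.
move=> [ch [M hM] Hh] [ck [N kN] Hk].
have [a1 a2] := am_test ch hM; have [b1 b2] := am_test ck kN.
split.
- by move=> x; apply: cvgD; [exact: ch|apply: cvgM; [exact: cvg_cst|exact: ck]].
- exists (M + `|a| * N) => x; apply: (le_trans (ler_normD _ _)).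
  by rewrite normrM; apply: lerD => //; exact: ler_wpM2l.
- rewrite ExD//; last exact: am_scale.
  rewrite ExZ//.
  apply: (@cvg_ext _ _ (fun n => Ex (fun w => h (S n w)) + a * Ex (fun w => k (S n w)))).
    by move=> n; rewrite ExD// ?ExZ//; exact: am_scale.
  by apply: cvgD => //; apply: cvgM => //; exact: cvg_cst.
Qed.

Lemma cvg_test_cos a b : cvg_test (fun x => cos (a * x + b)).
Proof.
have cc : continuous (fun x => cos (a * x + b)).
  by move=> x; have := is_derive_cos_affine a b x => ?; apply/differentiable_continuous/derivable1_diffP.
split=> //; first by exists 1 => x; exact: cos_max.
apply/cvgrPdist_le => e e0.
(* Four quarters: the Taylor remainder under [nu], the difference of the Taylor polynomials, and two
   for the remainder under [S n], bounded by a moment within e/4 of its limit, itself at most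
   e/4. *)
have e4 : 0 < e / 4 by rewrite divr_gt0.
have [m Hm] : exists m, a ^+ (2 * m) / (2 * m)`!%:R * En (fun x => x ^+ (2 * m)) <= e / 4.
  near \oo => m; exists m; apply: le_trans (ler_norm _) _; near: m.
  by have /cvgr0Pnorm_le := moments_growth a; apply.
pose r := a ^+ (2 * m) / (2 * m)`!%:R.
have c1 : \sum_(k < 2 * m) cos_coef a b k * Ex (fun w => S n w ^+ k) @[n --> \oo] -->
   \sum_(k < 2 * m) cos_coef a b k * En (fun x => x ^+ k).
  apply: (@cvg_bigsum _ _ (fun k n => cos_coef a b k * Ex (fun w => S n w ^+ k))
    (fun k => cos_coef a b k * En (fun x => x ^+ k))) => k; apply: cvgM; [exact: cvg_cst|exact: cvg_moments].
have c2 : r * Ex (fun w => S n w ^+ (2 * m)) @[n --> \oo] --> r * En (fun x => x ^+ (2 * m)).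
  by apply: cvgM; [exact: cvg_cst|exact: cvg_moments].
near=> n.
have H1 := ler_Ex_cos_rem a b m (aS n).
have H2 := ler_Ex_cos_rem a b m anu.
have H3 : `|\sum_(k < 2 * m) cos_coef a b k * En (fun x => x ^+ k) -
    \sum_(k < 2 * m) cos_coef a b k * Ex (fun w => S n w ^+ k)| <= e / 4.
  by near: n; move/cvgrPdist_le : c1; apply.
have H4 : `|r * En (fun x => x ^+ (2 * m)) - r * Ex (fun w => S n w ^+ (2 * m))| <= e / 4.
  by near: n; move/cvgrPdist_le : c2; apply.
move: H1 H2 H3 H4 Hm; rewrite -/r.
move: (Ex (fun w => cos _)) (En (fun w => cos _)) (\sum_(k < _) _) (\sum_(k < _) _).
move: (r * _) (r * _) => u v p q s t.
rewrite !ler_norml => /andP[H1 H1'] /andP[H2 H2'] /andP[H3 H3'] /andP[H4 H4'] H5.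
by apply/andP; split; lra.
Unshelve. all: by end_near. Qed.

(** The cosine factor closes the induction: 2 cos u sin v = sin(u + v) - sin(u - v) turns its
    product with sin(a x) into cosines of frequencies c + a and c - a. *)
Lemma cvg_test_cos_bern n (phi : nat -> R) a c d' :
  cvg_test (fun x => cos (c * x + d') * bern n phi ((1 + sin (a * x)) / 2)).
Proof.
elim: n phi c d' => [|n IH] phi c e.
  have := cvg_test_lin (phi 0%N - 1) (cvg_test_cos c e) (cvg_test_cos c e).
  by congr cvg_test; apply/funext => x /=; ring.
pose p1 : nat -> R := phi \o succn.
have H psi := cvg_test_lin 1 (IH psi (c + a) (e - pi / 2)) (IH psi (c - a) (e + pi / 2)).
have H1 := cvg_test_lin (4^-1) (cvg_test_lin (- 2^-1) (IH p1 c e) (IH p1 c e)) (H p1).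
have H2 := cvg_test_lin (- 4^-1) (cvg_test_lin (- 2^-1) (IH phi c e) (IH phi c e)) (H phi).
have := cvg_test_lin 1 H1 H2; congr cvg_test; apply/funext => x /=.
have -> : (c + a) * x + (e - pi / 2) = (c * x + e) + a * x - pi / 2 by ring.
have -> : (c - a) * x + (e + pi / 2) = (c * x + e) - a * x + pi / 2 by ring.
rewrite cosBpihalf cosDpihalf sinD sinB.
by field.
Qed.

Lemma cvg_test_bern n (phi : nat -> R) a :
  cvg_test (fun x => bern n phi ((1 + sin (a * x)) / 2)).
Proof.
have := cvg_test_cos_bern n phi a 0 0; congr cvg_test; apply/funext => x.
by rewrite mul0r addr0 cos0 mul1r.
Qed.
(** [U n] need be close to [S n] only where [S n] is bounded by A: elsewhere the error 2 M is
    dominated by a multiple of (S_n)^2 whose mean is small. *)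
Lemma cvg_bounded_continuous (U : nat -> Omega -> R) (g : R -> R) (M : R) :
  (forall n, measurable_fun setT (U n)) ->
  (forall A e, 0 < A -> 0 < e -> \forall n \near \oo,
     forall w, `|S n w| <= A -> `|U n w - S n w| <= e) ->
  continuous g -> (forall x, `|g x| <= M) ->
  Ex (fun w => g (U n w)) @[n --> \oo] --> En g.
Proof.
move=> mU US cg gM; apply/cvgrPdist_le => e e0.
have M0 : 0 <= M := le_trans (normr_ge0 _) (gM 0).
pose m2 := En (fun x => x ^+ 2).
have m20 : 0 <= m2 by apply: Rintegral_ge0 => x _; exact: sqr_ge0.
have mg : measurable_fun setT g by exact: continuous_measurable_fun.
pose e' := e / 8.
have e'0 : 0 < e' by rewrite divr_gt0.
pose K := 2 * M * (m2 + 1).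
have K0 : 0 <= K by rewrite !mulr_ge0// addr_ge0.
(* Large enough that 2 M (m2 + 1) / A^2 <= e', the price of the region beyond A once the second
   moment is at most m2 + 1. *)
pose A := 1 + K / e'.
have A1 : 1 <= A by rewrite lerDl divr_ge0// ltW.
have A0 : 0 < A by exact: lt_le_trans A1.
have KA : K / A ^+ 2 <= e'.
  rewrite ler_pdivrMr ?exprn_gt0//; apply: (@le_trans _ _ (e' * A)).
    by rewrite -ler_pdivrMl// mulrC /A lerDr.
  by apply: ler_wpM2l; [exact: ltW|rewrite expr2 ler_peMr// ltW].
have A10 : 0 < A + 1 by rewrite addr_gt0.
(* This keeps a x within [-1/2, 1/2] for |x| <= A + 1, where [sin_chart] inverts the sine. *)
pose a := (2 * (A + 1))^-1.
have a0 : 0 < a by rewrite invr_gt0 mulr_gt0.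
have [v cv Hv] := sin_chart R.
pose G y := g (v y / a).
have cG : continuous G.
  move=> y; apply: (cvg_comp (fun y => v y / a) g); last exact: cg.
  by apply: cvgM; [exact: cv|exact: cvg_cst].
have [k Hk] := bernstein_approximation cG (fun y => gM _) e'0.
pose y (x : R) := (1 + sin (a * x)) / 2.
have y01 x : 0 <= y x <= 1.
  by have := sin_max (a * x); rewrite ler_norml /y => /andP[? ?]; apply/andP; split; lra.
pose h x := bern k (fun j => G (j%:R / k%:R)) (y x).
have hM x : `|h x| <= M by apply: ler_norm_bern => // j; exact: gM.
have hg x : `|x| <= A + 1 -> `|g x - h x| <= e'.
  move=> xA; have := Hk _ (y01 x); rewrite distrC -/(h x); congr (`|_ - _| <= _).
  rewrite /G /y Hv; first by rewrite mulrAC divff ?mul1r// gt_eqF.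
  rewrite normrM (gtr0_norm a0) /a invfM -mulrA ler_piMr ?invr_ge0//.
  by rewrite ler_pdivrMl// mulr1.
have [ch _ Hh] := cvg_test_bern k (fun j => G (j%:R / k%:R)) a.
have [ahS ahn] := am_test ch hM.
have [dl dl0 Hdl] := uniformly_continuous_segment (- (A + 1)) (A + 1) cg e'0.
have aS2 n : all_moments P (fun w => S n w ^+ 2) by exact: am_exp.
have an2 : all_moments nu (fun x => x ^+ 2) by exact: (am_exp 2 anu).
pose c := 2 * M / A ^+ 2.
have c0 : 0 <= c by apply: divr_ge0; [exact: mulr_ge0|exact: sqr_ge0].
have big x : A < `|x| -> 2 * M <= c * x ^+ 2.
  move=> Ax; rewrite /c -mulrA ler_peMr ?mulr_ge0// mulrC ler_pdivlMr ?exprn_gt0// mul1r.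
  by rewrite -[leRHS]real_normK ?num_real// ler_sqr ?nnegrE// ltW.
have M2 (s t : R) : `|s| <= M -> `|t| <= M -> `|s - t| <= 2 * M.
  by move=> ? ?; rewrite mulr2n mulrDl mul1r; apply: (le_trans (ler_normB _ _)); exact: lerD.
have cm2 : c * (m2 + 1) <= e' by apply: le_trans KA; rewrite /c /K; lra.
have Bn : `|En g - En h| <= 2 * e'.
  apply: (@le_trans _ _ (En (fun x => e' + c * x ^+ 2))).
    apply: ler_norm_ExB => //.
    - exact: am_bounded mg gM.
    - by apply: am_add; [exact: am_cst|exact: am_scale].
    - move=> x; have [xA|Ax] := leP `|x| A.
        apply: ler_wpDr; first by rewrite mulr_ge0// sqr_ge0.
        by apply: hg; apply: le_trans xA _; rewrite lerDl.
      by apply: ler_wpDl; [exact: ltW|apply: le_trans (big _ Ax); exact: M2].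
  rewrite Ex_affine//.
  by move: cm2; rewrite -/m2; nra.
have c1 : \forall n \near \oo, Ex (fun w => S n w ^+ 2) <= m2 + 1.
  have /cvgrPdist_le/(_ 1 ltr01) := @cvg_moments 2%N; apply: filterS => n.
  by rewrite -/m2 ler_norml => /andP[H1 H2]; lra.
have dl1 : 0 < Num.min dl 1 by rewrite lt_min dl0 ltr01.
near=> n.
have B1 : Ex (fun w => S n w ^+ 2) <= m2 + 1 by near: n.
have B2 : `|En h - Ex (fun w => h (S n w))| <= e'.
  by near: n; move/cvgrPdist_le : Hh; apply.
have B3 w : `|S n w| <= A -> `|U n w - S n w| <= Num.min dl 1.
  by move: w; near: n; exact: US.
have B4 : `|Ex (fun w => g (U n w)) - Ex (fun w => h (S n w))| <= 3 * e'.
  apply: (@le_trans _ _ (Ex (fun w => 2 * e' + c * S n w ^+ 2))).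
    apply: ler_norm_ExB => //.
    - by apply: (@am_bounded _ _ _ _ _ M) => //; exact: measurableT_comp.
    - exact: ahS.
    - by apply: am_add; [exact: am_cst|exact: am_scale].
    - move=> w; have [xA|Ax] := leP `|S n w| A.
        apply: ler_wpDr; first by rewrite mulr_ge0// sqr_ge0.
        have H1 : `|g (U n w) - g (S n w)| <= e'.
          apply: Hdl; last by apply: le_trans (B3 _ xA) _; rewrite ge_min lexx.
          by move: xA; rewrite ler_norml => /andP[? ?]; apply/andP; split; lra.
        have H2 : `|g (S n w) - h (S n w)| <= e'.
          by apply: hg; apply: le_trans xA _; rewrite lerDl.
        by have := ler_normD (g (U n w) - g (S n w)) (g (S n w) - h (S n w)); rewrite addrA subrK; lra.
      apply: ler_wpDl; first by rewrite mulr_ge0// ltW.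
      by apply: le_trans (big _ Ax); exact: M2.
  rewrite Ex_affine//.
  have : c * Ex (fun w => S n w ^+ 2) <= c * (m2 + 1) by exact: ler_wpM2l.
  by lra.
have -> : En g - Ex (fun w => g (U n w)) = (En g - En h)
   + (En h - Ex (fun w => h (S n w)))
   - (Ex (fun w => g (U n w)) - Ex (fun w => h (S n w))) by ring.
apply: (le_trans (ler_normB _ _)).
apply: (@le_trans _ _ (2 * e' + e' + 3 * e')).
  by apply: lerD => //; apply: (le_trans (ler_normD _ _)); exact: lerD.
by rewrite /e'; lra.
Unshelve. all: by end_near. Qed.
End moment_method.

Section normal_law_method.
Context {R : realType}.
Variables (v : R) (v0 : 0 <= v).
Local Notation En F := (Rintegral (normal_law 0 v) setT F).

Lemma am_normal_law : all_moments (normal_law 0 v) (fun x : R => x).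
Proof.
split; first exact: measurable_id.
move=> k; have [H _] := normal_law_moments 0 k v0.
by move: H; congr (_.-integrable _ (EFin \o _)); apply/funext => x; rewrite subr0.
Qed.

Lemma normal_law_moment0 : En (fun x => x ^+ 0) = 1.
Proof. exact: Ex_cst. Qed.

Lemma normal_law_momentS m :
  En (fun x => x ^+ m.+1) = m%:R * v * En (fun x => x ^+ m.-1).
Proof.
have [_ H] := normal_law_moments 0 m v0.
by move: H; under eq_Rintegral do rewrite subr0;
  under [in RHS]eq_Rintegral do rewrite subr0.
Qed.

(** The moment of order 2 m is v^m (2 m)! / (2^m m!), so the sequence consists of the terms of the
    exponential series at a^2 v / 2. *)
Lemma normal_law_moments_growth (a : R) :
  a ^+ (2 * m) / (2 * m)`!%:R * En (fun x => x ^+ (2 * m)) @[m --> \oo] --> (0 : R).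
Proof.
pose z := a ^+ 2 * v / 2.
apply: (@cvg_ext _ _ (exp_coeff z)); last first.
  exact/cvg_series_cvg_0/is_cvg_series_exp_coeff.
elim=> [|m IH].
  by rewrite muln0 normal_law_moment0 /exp_coeff /= !expr0 fact0 !divr1 mulr1.
have -> : (2 * m.+1)%N = (2 * m).+2 by rewrite mulnS.
rewrite normal_law_momentS /= !factS !natrM.
transitivity (z / m.+1%:R * (a ^+ (2 * m) / (2 * m)`!%:R * En (fun x => x ^+ (2 * m)))).
  have f0 : ((2 * m)`!%:R : R) != 0 by rewrite pnatr_eq0 -lt0n fact_gt0.
  have m0 : ((2 * m).+1%:R : R) != 0 by rewrite pnatr_eq0.
  have m1 : (m.+1%:R : R) != 0 by rewrite pnatr_eq0.
  have -> : ((2 * m).+2%:R : R) = 2 * m.+1%:R by rewrite -natrM mulnS.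
  rewrite !exprS /z; move: (a ^+ (2 * m)) (En _) f0 m0 m1.
  move: ((2 * m)`!%:R : R) ((2 * m).+1%:R : R) (m.+1%:R : R) => p q r s t p0 q0 r0.
  by field; rewrite p0 q0 r0.
rewrite IH /exp_coeff /= factS natrM exprS.
have f0 : (m`!%:R : R) != 0 by rewrite pnatr_eq0 -lt0n fact_gt0.
have m1 : (m.+1%:R : R) != 0 by rewrite pnatr_eq0.
move: f0 m1; move: (m`!%:R : R) (m.+1%:R : R) (z ^+ m) => p q r p0 q0.
by field; rewrite p0 q0.
Qed.

End normal_law_method.

(** * Traces of powers of covariance matrices *)

Section weighted_sums.
Context {R : realFieldType}.

Lemma cauchy_schwarz_weighted (I : finType) (a b : I -> R) : (forall i, 0 <= a i) ->
  (\sum_i b i * a i) ^+ 2 <= (\sum_i a i) * \sum_i b i ^+ 2 * a i.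
Proof.
move=> a0; set s := \sum_i a i; set t := \sum_i b i * a i; set q := \sum_i _.
have s0 : 0 <= s by exact: sumr_ge0.
have [s1|s1] := eqVneq s 0.
  have az i : a i = 0.
    by move/eqP: s1; rewrite psumr_eq0// => /allP/(_ i (mem_index_enum _)) /eqP.
  by rewrite s1 mul0r /t big1 ?expr0n// => i _; rewrite az mulr0.
have {s1}sp : 0 < s by rewrite lt_neqAle eq_sym s1.
have : 0 <= \sum_i a i * (s * b i - t) ^+ 2.
  by apply: sumr_ge0 => i _; rewrite mulr_ge0// sqr_ge0.
have -> : \sum_i a i * (s * b i - t) ^+ 2 = s * (s * q - t ^+ 2).
  transitivity (\sum_i (s ^+ 2 * (b i ^+ 2 * a i) - 2 * s * t * (b i * a i) + t ^+ 2 * a i)).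
    by apply: eq_bigr => i _; ring.
  by rewrite big_split sumrB -!mulr_sumr /= -/q -/t -/s; ring.
by rewrite pmulr_rge0// subr_ge0.
Qed.

(** A distance to m occurs at most once on the right of m, 0 included, and at most once on its left,
    where it is at least 1. *)
Lemma sum_dist_le (F : nat -> R) n m : (forall k, 0 <= F k) ->
  \sum_(k < n) F `|k%:Z - m%:Z|%N <= \sum_(k < n) F k + \sum_(k < m) F k.+1.
Proof.
move=> F0; elim: n m => [|n IH] [|m].
- by rewrite !big_ord0 addr0.
- by rewrite !big_ord0 add0r sumr_ge0.
- rewrite [X in _ + X]big_ord0 addr0; apply: ler_sum => k _.
  by rewrite subr0 absz_nat.
have -> : \sum_(k < n.+1) F `|k%:Z - m.+1%:Z|%N =
    F m.+1 + \sum_(k < n) F `|k%:Z - m%:Z|%N.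
  rewrite big_ord_recl; congr (_ + _); first by rewrite sub0r abszN absz_nat.
  apply: eq_bigr => k _; congr (F `|_|%N).
  by rewrite lift0 -[m.+1]addn1 -[k.+1]addn1 !PoszD; ring.
have E1 : \sum_(k < n.+1) F k = \sum_(k < n) F k + F n by rewrite big_ord_recr.
have E2 : \sum_(k < m.+1) F k.+1 = \sum_(k < m) F k.+1 + F m.+1 by rewrite big_ord_recr.
by rewrite E1 E2; have := IH m; have := F0 n; lra.
Qed.
End weighted_sums.

Section trace_powers.
Context {R : realFieldType} (n : nat) (A : 'M[R]_n) (lam : R).
Hypothesis lam0 : 0 < lam.
Hypothesis A0 : forall i j, 0 <= A i j.
Hypothesis Asym : forall i j, A i j = A j i.
Hypothesis Arow : forall i, \sum_j A i j <= lam.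

(** Squared Hilbert-Schmidt norm. *)
Let hs (B : 'M[R]_n) := \sum_i \sum_j B i j ^+ 2.

(** Schur's test: Cauchy-Schwarz weighted by the entries of A, whose row and column sums are both at
    most [lam]. *)
Let hsM B : hs (B * A) <= lam ^+ 2 * hs B.
Proof.
rewrite /hs mulr_sumr; apply: ler_sum => i _.
apply: (@le_trans _ _ (\sum_j lam * \sum_l B i l ^+ 2 * A l j)).
  apply: ler_sum => j _; rewrite mxE.
  apply: (le_trans (cauchy_schwarz_weighted _ (fun l => A0 l j))).
  apply: ler_wpM2r.
    by apply: sumr_ge0 => l _; rewrite mulr_ge0// sqr_ge0.
  by under eq_bigr do rewrite Asym; exact: Arow.
rewrite -mulr_sumr exchange_big/= expr2 -mulrA; apply: ler_wpM2l; first exact: ltW.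
rewrite mulr_sumr; apply: ler_sum => l _; rewrite -mulr_sumr mulrC.
by apply: ler_wpM2r; [exact: sqr_ge0|exact: Arow].
Qed.

Lemma trace_sqr : \tr (A ^+ 2) = \sum_i \sum_j A i j ^+ 2.
Proof.
rewrite /mxtrace; apply: eq_bigr => i _; rewrite expr2 mxE; apply: eq_bigr => j _.
by rewrite (Asym j i) expr2.
Qed.

Lemma trace_pow_ge0 k : 0 <= \tr (A ^+ k).
Proof.
have Ak0 i j : 0 <= (A ^+ k) i j.
  elim: k i j => [|k IH] i j; first by rewrite expr0 mxE ler0n.
  by rewrite exprS mxE sumr_ge0// => l _; rewrite mulr_ge0.
by apply: sumr_ge0.
Qed.

(** The trace is the Hilbert-Schmidt inner product of A^(k+1) and A. Since the squared norm of the
    former is at most lam^(2k) times that of A, the inequality x y <= x^2 / (2 l) + l y^2 / 2 is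
    balanced at l = lam^k. *)
Lemma trace_pow_le k : \tr (A ^+ k.+2) <= lam ^+ k * \tr (A ^+ 2).
Proof.
have H : hs (A ^+ k.+1) <= (lam ^+ k) ^+ 2 * hs A.
  elim: k => [|k IH]; first by rewrite expr0 expr1n mul1r expr1.
  rewrite exprSr; apply: (le_trans (hsM _)).
  rewrite [lam ^+ k.+1]exprS [(lam * _) ^+ 2]exprMn -[leRHS]mulrA.
  by apply: ler_wpM2l => //; rewrite sqr_ge0.
have lk : 0 < lam ^+ k by rewrite exprn_gt0.
rewrite exprSr trace_sqr.
have -> : \tr (A ^+ k.+1 * A) = \sum_i \sum_j (A ^+ k.+1) i j * A i j.
  by rewrite /mxtrace; apply: eq_bigr => i _; rewrite mxE; apply: eq_bigr => j _; rewrite (Asym j i).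
apply: (@le_trans _ _ ((2 * lam ^+ k)^-1 * hs (A ^+ k.+1) + lam ^+ k / 2 * hs A)).
  rewrite /hs !mulr_sumr -big_split/=; apply: ler_sum => i _.
  rewrite !mulr_sumr -big_split/=; apply: ler_sum => j _.
  move: ((A ^+ k.+1) i j) (A i j) (lam ^+ k) lk => x y l l0.
  have : 0 <= (2 * l)^-1 * (x - l * y) ^+ 2.
    by rewrite mulr_ge0 ?sqr_ge0// invr_ge0 mulr_ge0// ltW.
  have -> : (2 * l)^-1 * (x - l * y) ^+ 2 =
     (2 * l)^-1 * x ^+ 2 + l / 2 * y ^+ 2 - x * y by field; rewrite gt_eqF.
  by rewrite subr_ge0.
rewrite -/(hs A); apply: (@le_trans _ _ ((2 * lam ^+ k)^-1 * ((lam ^+ k) ^+ 2 * hs A) + lam ^+ k / 2 * hs A)).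
  by rewrite lerD2r; apply: ler_wpM2l => //; rewrite invr_ge0 mulr_ge0// ltW.
rewrite le_eqVlt; apply/orP; left; apply/eqP.
by move: (lam ^+ k) lk (hs A) => l l0 h; field; rewrite gt_eqF.
Qed.
End trace_powers.

(** * Series with nonnegative terms *)

Section real_series.
Context {R : realType}.
Implicit Types F u : nat -> R.

Lemma sum_ord_add F K m :
  \sum_(k < K + m) F k = \sum_(k < K) F k + \sum_(k < m) F (K + k)%N.
Proof. by rewrite big_split_ord. Qed.

Lemma ler_sum_ord F n m : (forall k, 0 <= F k) -> (n <= m)%N ->
  \sum_(k < n) F k <= \sum_(k < m) F k.
Proof.
move=> F0 nm; rewrite -(subnKC nm) big_split_ord/= lerDl.
by apply: sumr_ge0 => i _.
Qed.

Lemma sum_geometric_le (t : R) n : 0 <= t < 1 -> \sum_(k < n) t ^+ k <= (1 - t)^-1.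
Proof.
move=> /andP[t0 t1]; have t1' : 0 < 1 - t by rewrite subr_gt0.
have E : (1 - t) * \sum_(k < n) t ^+ k = 1 - t ^+ n.
  elim: n => [|n IH]; first by rewrite big_ord0 mulr0 expr0 subrr.
  by rewrite big_ord_recr/= mulrDr IH exprS; ring.
by rewrite -[leRHS]mulr1 ler_pdivlMl// E lerBlDr lerDl exprn_ge0.
Qed.

Definition suml F : R := limn (fun n => \sum_(k < n) F k).

Lemma cvg_suml F B : (forall k, 0 <= F k) -> (forall n, \sum_(k < n) F k <= B) ->
  \sum_(k < n) F k @[n --> \oo] --> suml F.
Proof.
move=> F0 FB; have nd : nondecreasing_seq (fun n => \sum_(k < n) F k).
  by move=> n m nm; exact: ler_sum_ord.
apply: nondecreasing_is_cvgn => //.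
by exists B => _ [n _ <-].
Qed.

Lemma ler_suml F B n : (forall k, 0 <= F k) -> (forall n, \sum_(k < n) F k <= B) ->
  \sum_(k < n) F k <= suml F.
Proof.
move=> F0 FB; have nd : nondecreasing_seq (fun n => \sum_(k < n) F k).
  by move=> p q pq; exact: ler_sum_ord.
by apply: (nondecreasing_cvgn_le nd); exact: (cvg_suml F0 FB).
Qed.

Lemma cvg_sqrt_infty : (Num.sqrt (n%:R : R))^-1 @[n --> \oo] --> (0 : R).
Proof.
apply/cvgr0Pnorm_le => e e0; near=> n.
have n0 : (0 < n)%N by near: n; exact: nbhs_infty_gt.
have nR : 0 < n%:R :> R by rewrite ltr0n.
have sn : 0 < Num.sqrt (n%:R : R) by rewrite sqrtr_gt0.
rewrite ger0_norm ?invr_ge0 ?(ltW sn)// invf_ple ?posrE//.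
rewrite -(@ler_sqr R) ?nnegrE ?invr_ge0 ?(ltW e0) ?(ltW sn)// sqr_sqrtr ?(ltW nR)//.
near: n; exact: nbhs_infty_ger.
Unshelve. all: by end_near. Qed.

Lemma sum_sqr_le (u : nat -> R) K m :
  (\sum_(k < m) u (K + k)%N) ^+ 2 <= m%:R * \sum_(k < m) u (K + k)%N ^+ 2.
Proof.
have := @cauchy_schwarz_weighted R 'I_m (fun=> 1) (fun k => u (K + k)%N) (fun=> ler01).
rewrite sumr_const card_ord.
have -> : \sum_(i < m) u (K + i)%N * 1 = \sum_(i < m) u (K + i)%N.
  by apply: eq_bigr => i _; rewrite mulr1.
by under [X in _ * X]eq_bigr do rewrite mulr1.
Qed.

(** Cauchy-Schwarz on the whole sum gives only O(sqrt n). Applied beyond a fixed K it gives sqrt n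
    times the root of a small tail, and the head is negligible after division. *)
Lemma cvg_sum_sqrt (u : nat -> R) B : (forall k, 0 <= u k) ->
  (forall n, \sum_(k < n) u k ^+ 2 <= B) ->
  (Num.sqrt n%:R)^-1 * \sum_(k < n) u k @[n --> \oo] --> (0 : R).
Proof.
move=> u0 uB; have u20 k : 0 <= u k ^+ 2 by rewrite sqr_ge0.
apply/cvgr0Pnorm_le => e e0.
have e20 : 0 < (e / 2) ^+ 2 by rewrite exprn_gt0// divr_gt0.
have cs := cvg_suml u20 uB.
have [K HK] : exists K, suml (fun k => u k ^+ 2) - \sum_(k < K) u k ^+ 2 <= (e / 2) ^+ 2.
  near \oo => K; exists K; apply: le_trans (ler_norm _) _.
  by near: K; move/cvgrPdist_le : cs; apply.
pose CK := \sum_(k < K) u k.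
have CK0 : 0 <= CK by exact: sumr_ge0.
have c1 : (Num.sqrt (n%:R : R))^-1 * CK @[n --> \oo] --> (0 : R).
  by rewrite -(mul0r CK); apply: cvgM; [exact: cvg_sqrt_infty|exact: cvg_cst].
near=> n.
have Kn : (K <= n)%N by near: n; exact: nbhs_infty_ge.
have n0 : (0 < n)%N by near: n; exact: nbhs_infty_gt.
have nR : 0 < n%:R :> R by rewrite ltr0n.
have sn : 0 < Num.sqrt (n%:R : R) by rewrite sqrtr_gt0.
have H1 : (Num.sqrt (n%:R : R))^-1 * CK <= e / 2.
  apply: le_trans (ler_norm _) _; near: n.
  by move/cvgr0Pnorm_le : c1; apply; rewrite divr_gt0.
have split_sum (F : nat -> R) : \sum_(k < n) F k =
    \sum_(k < K) F k + \sum_(k < n - K) F (K + k)%N.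
  by rewrite -sum_ord_add subnKC.
pose D := \sum_(k < n - K) u (K + k)%N.
have D0 : 0 <= D by exact: sumr_ge0.
have H2 : D <= Num.sqrt n%:R * (e / 2).
  rewrite -(@ler_sqr R) ?nnegrE//; last by rewrite mulr_ge0 ?(ltW sn)// divr_ge0// ltW.
  rewrite exprMn sqr_sqrtr ?(ltW nR)//; apply: (le_trans (sum_sqr_le u K _)).
  apply: ler_pM => //; first by apply: sumr_ge0 => k _; exact: sqr_ge0.
    by rewrite ler_nat leq_subr.
  apply: le_trans HK; rewrite lerBrDl -(split_sum (fun k => u k ^+ 2)).
  exact: (ler_suml _ u20 uB).
rewrite ger0_norm; last by rewrite mulr_ge0 ?invr_ge0 ?(ltW sn)//; exact: sumr_ge0.
rewrite split_sum mulrDr [leRHS]splitr; apply: lerD => //.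
by rewrite ler_pdivrMl.
Unshelve. all: by end_near. Qed.

End real_series.

(** * Covariances of the autoregression and traces of their matrices *)

Section ar_covariance.
Context {R : realType} (theta : R) (rho : int -> R).
Hypothesis th0 : 0 < theta.
Hypothesis th1 : theta < 1.
Hypothesis rho_ge0 : forall k, 0 <= rho k.
Hypothesis rho_le1 : forall k, rho k <= 1.
Hypothesis rhoN : forall k, rho (- k) = rho k.
Hypothesis rho0 : rho 0 = 1.
Variable B : R.
Hypothesis rhoB : forall n, \sum_(k < n) rho k%:Z ^+ 2 <= B.

(* ar_box N M k is the covariance of the truncations at orders N and M, k steps
   apart, of the moving average Y; so acov i j = E(X_i X_j) and ar_cov k = R(k). *)
Definition ar_box N M k : R :=
  \sum_(a < N) \sum_(b < M) theta ^+ (a + b) * rho (k + a%:Z - b%:Z).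

Definition acov (i j : nat) : R := ar_box i j (j%:Z - i%:Z).

Definition ar_cov k : R := limn (fun N => ar_box N N k).

Let tht n : 0 <= theta ^+ n. Proof. by rewrite exprn_ge0// ltW. Qed.
Let term_ge0 k a b : 0 <= theta ^+ (a + b) * rho (k + a%:Z - b%:Z).
Proof. by rewrite mulr_ge0. Qed.
Let om0 : 0 < 1 - theta. Proof. by rewrite subr_gt0. Qed.
Let geo n : \sum_(k < n) theta ^+ k <= (1 - theta)^-1.
Proof. by apply: sum_geometric_le; rewrite th1 ltW. Qed.
Let geo2 N M : \sum_(a < N) \sum_(b < M) theta ^+ (a + b) <= (1 - theta)^-1 ^+ 2.
Proof.
have -> : \sum_(a < N) \sum_(b < M) theta ^+ (a + b) =
   (\sum_(a < N) theta ^+ a) * \sum_(b < M) theta ^+ b.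
  rewrite mulr_suml; apply: eq_bigr => a _; rewrite mulr_sumr; apply: eq_bigr => b _.
  by rewrite exprD.
by rewrite expr2; apply: ler_pM => //; exact: sumr_ge0.
Qed.

Lemma ar_box_ge0 N M k : 0 <= ar_box N M k.
Proof. by apply: sumr_ge0 => a _; apply: sumr_ge0. Qed.

(** Nonnegativity of [rho] makes the boxes monotone, so that R(k) exists as a limit and dominates
    every truncated covariance at lag k. *)
Lemma ler_ar_box N M N' M' k : (N <= N')%N -> (M <= M')%N ->
  ar_box N M k <= ar_box N' M' k.
Proof.
move=> NN MM; apply: (@le_trans _ _ (ar_box N M' k)).
  apply: ler_sum => a _.
  exact: (@ler_sum_ord _ (fun b => theta ^+ (a + b) * rho (k + a%:Z - b%:Z))).
apply: (@ler_sum_ord _ (fun a => \sum_(b < M') theta ^+ (a + b) * rho (k + a%:Z - b%:Z))) => //.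
by move=> a; apply: sumr_ge0.
Qed.

Lemma ar_box_ub N M k : ar_box N M k <= (1 - theta)^-1 ^+ 2.
Proof.
apply: le_trans (geo2 N M); apply: ler_sum => a _; apply: ler_sum => b _.
by rewrite ler_piMr.
Qed.

Lemma ar_boxN N M k : ar_box N M (- k) = ar_box M N k.
Proof.
rewrite /ar_box exchange_big/=; apply: eq_bigr => b _; apply: eq_bigr => a _.
by rewrite addnC -rhoN; congr (_ * rho _); ring.
Qed.

Lemma cvg_ar_box k : ar_box N N k @[N --> \oo] --> ar_cov k.
Proof.
apply: nondecreasing_is_cvgn.
  by move=> n m nm; exact: ler_ar_box.
by exists ((1 - theta)^-1 ^+ 2) => _ [n _ <-]; exact: ar_box_ub.
Qed.

Lemma ar_box_le_cov N M k : ar_box N M k <= ar_cov k.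
Proof.
apply: (@le_trans _ _ (ar_box (maxn N M) (maxn N M) k)).
  by apply: ler_ar_box; rewrite ?leq_maxl ?leq_maxr.
apply: (@nondecreasing_cvgn_le _ (fun n => ar_box n n k)).
  by move=> n m nm; exact: ler_ar_box.
by apply: cvgP; exact: cvg_ar_box.
Qed.

Lemma ar_cov_ge0 k : 0 <= ar_cov k.
Proof. exact: le_trans (ar_box_ge0 0 0 k) (ar_box_le_cov 0 0 k). Qed.

Lemma ar_covN k : ar_cov (- k) = ar_cov k.
Proof. by rewrite /ar_cov; under eq_fun do rewrite ar_boxN. Qed.

Lemma ar_cov0_ge1 : 1 <= ar_cov 0.
Proof.
apply: le_trans (ar_box_le_cov 1 1 0).
by rewrite /ar_box !big_ord1 expr0 mul1r addr0 subr0 rho0.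
Qed.

Lemma rho_absz k : rho k = rho `|k|%N.
Proof. by case: k => n //; rewrite NegzE rhoN abszN. Qed.

Let B0 : 0 <= B. Proof. by have := rhoB 0; rewrite big_ord0. Qed.

(** A shifted window meets each absolute value at most twice, hence the factor 2. *)
Lemma sum_rho_shift_le n (c : int) : \sum_(k < n) rho (k%:Z + c) ^+ 2 <= 2 * B.
Proof.
have F0 k : 0 <= rho k%:Z ^+ 2 by rewrite sqr_ge0.
case: c => m.
  have -> : \sum_(k < n) rho (k%:Z + m%:Z) ^+ 2 = \sum_(k < n) rho (m + k)%N ^+ 2.
    by apply: eq_bigr => k _; rewrite -PoszD addnC.
  have := sum_ord_add (fun k => rho k%:Z ^+ 2) m n; have := rhoB (m + n).
  have : 0 <= \sum_(k < m) rho k ^+ 2 by apply: sumr_ge0 => k _; exact: F0.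
  by have := B0; lra.
have -> : \sum_(k < n) rho (k%:Z + Negz m) ^+ 2 =
    \sum_(k < n) rho `|k%:Z - m.+1%:Z|%N ^+ 2.
  by apply: eq_bigr => k _; rewrite NegzE [in LHS]rho_absz.
apply: (le_trans (sum_dist_le n m.+1 F0)); rewrite mulr2n mulrDl mul1r; apply: lerD => //.
apply: (@le_trans _ _ (\sum_(k < 1 + m.+1) rho k ^+ 2)) => //.
by rewrite (sum_ord_add (fun k => rho k%:Z ^+ 2)) lerDr big_ord1.
Qed.

(** Cauchy-Schwarz with the weights theta^(a+b) moves the square onto [rho]; square summability
    thereby passes from [rho] to R. *)
Lemma ar_box_sqr N k : ar_box N N k ^+ 2 <= (1 - theta)^-1 ^+ 2 *
  \sum_(a < N) \sum_(b < N) theta ^+ (a + b) * rho (k + a%:Z - b%:Z) ^+ 2.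
Proof.
pose w (p : 'I_N * 'I_N) := theta ^+ (p.1 + p.2).
have := @cauchy_schwarz_weighted R ('I_N * 'I_N)%type w
  (fun p => rho (k + p.1%:Z - p.2%:Z)) (fun p => tht _).
have -> : \sum_(p : 'I_N * 'I_N) rho (k + p.1%:Z - p.2%:Z) * w p = ar_box N N k.
  rewrite /ar_box pair_big/=; apply: eq_bigr => p _; exact: mulrC.
have -> : \sum_(p : 'I_N * 'I_N) w p = \sum_(a < N) \sum_(b < N) theta ^+ (a + b) by rewrite pair_big.
have -> : \sum_(p : 'I_N * 'I_N) rho (k + p.1%:Z - p.2%:Z) ^+ 2 * w p =
  \sum_(a < N) \sum_(b < N) theta ^+ (a + b) * rho (k + a%:Z - b%:Z) ^+ 2.
  by rewrite pair_big/=; apply: eq_bigr => p _; exact: mulrC.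
move=> /le_trans; apply; apply: ler_wpM2r => //.
by do 2 (apply: sumr_ge0 => ? _); rewrite mulr_ge0// sqr_ge0.
Qed.

Lemma sum_ar_cov_sqr n :
  \sum_(k < n) ar_cov k%:Z ^+ 2 <= (1 - theta)^-1 ^+ 2 * ((1 - theta)^-1 ^+ 2 * (2 * B)).
Proof.
have c : \sum_(k < n) ar_box N N k%:Z ^+ 2 @[N --> \oo] --> \sum_(k < n) ar_cov k%:Z ^+ 2.
  apply: (@cvg_bigsum _ _ (fun k N => ar_box N N k%:Z ^+ 2) (fun k => ar_cov k%:Z ^+ 2)) => k.
  by rewrite expr2; apply: cvgM; exact: cvg_ar_box.
rewrite -(cvg_lim (@Rhausdorff R) c); apply: limr_le; first by apply: cvgP c.
apply: nearW => N.
apply: (@le_trans _ _ (\sum_(k < n) (1 - theta)^-1 ^+ 2 *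
    \sum_(a < N) \sum_(b < N) theta ^+ (a + b) * rho (k%:Z + a%:Z - b%:Z) ^+ 2)).
  by apply: ler_sum => k _; exact: ar_box_sqr.
rewrite -mulr_sumr; apply: ler_wpM2l; first exact: sqr_ge0.
apply: (@le_trans _ _ (\sum_(a < N) \sum_(b < N) theta ^+ (a + b) * (2 * B))).
  rewrite exchange_big/=; apply: ler_sum => a _.
  rewrite exchange_big/=; apply: ler_sum => b _.
  rewrite -mulr_sumr; apply: ler_wpM2l => //.
  by under eq_bigr do rewrite -addrA; exact: sum_rho_shift_le.
under eq_bigr do rewrite -mulr_suml; rewrite -mulr_suml.
by apply: ler_wpM2r; [rewrite mulr_ge0|exact: geo2].
Qed.

Definition acov_mx n : 'M[R]_n := \matrix_(i, j) acov i.+1 j.+1.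

Lemma acov_sym i j : acov i j = acov j i.
Proof. by rewrite /acov -ar_boxN opprB. Qed.

Lemma acov_ge0 i j : 0 <= acov i j. Proof. exact: ar_box_ge0. Qed.

Lemma acov_le i j : acov i j <= ar_cov `|i%:Z - j%:Z|%N.
Proof.
apply: (le_trans (ar_box_le_cov _ _ _)).
rewrite -opprB ar_covN; case: (i%:Z - j%:Z) => m //.
by rewrite NegzE ar_covN abszN.
Qed.

(** A bound for the row sums of A_n common to all rows: a row meets each lag at most twice. *)
Definition acov_row n : R := 2 * \sum_(k < n) ar_cov k%:Z.

Lemma acov_mx_row n (i : 'I_n) : \sum_j acov_mx n i j <= acov_row n.
Proof.
apply: (@le_trans _ _ (\sum_(j < n) ar_cov `|j%:Z - i%:Z|%N)).
  apply: ler_sum => j _; rewrite mxE acov_sym; apply: (le_trans (acov_le _ _)).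
  by rewrite -addn1 -[i.+1]addn1 !PoszD opprD addrACA subrr addr0.
apply: (le_trans (@sum_dist_le _ (fun k => ar_cov k%:Z) n i _)) => [k|].
  exact: ar_cov_ge0.
rewrite /acov_row mulr2n mulrDl mul1r lerD2l.
have F0 k : 0 <= ar_cov k%:Z by exact: ar_cov_ge0.
apply: (@le_trans _ _ (\sum_(k < 1 + i) ar_cov k%:Z)).
  by rewrite (sum_ord_add (fun k => ar_cov k%:Z)) lerDr big_ord1.
by apply: (@ler_sum_ord _ (fun k => ar_cov k%:Z)).
Qed.

Lemma acov_row_gt0 n : 0 < acov_row n.+1.
Proof.
rewrite /acov_row mulr_gt0// big_ord_recl; apply: ltr_wpDr.
  by apply: sumr_ge0 => i _; exact: ar_cov_ge0.
exact: lt_le_trans ltr01 ar_cov0_ge1.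
Qed.

Lemma cvg_acov_row : (Num.sqrt n%:R)^-1 * acov_row n @[n --> \oo] --> (0 : R).
Proof.
have := cvg_sum_sqrt (fun k => ar_cov_ge0 k%:Z) sum_ar_cov_sqr.
move=> /(cvgM (cvg_cst (2 : R))); rewrite mulr0.
by apply: cvg_ext => n; rewrite /acov_row mulrCA.
Qed.
Let R2 := (1 - theta)^-1 ^+ 2 * ((1 - theta)^-1 ^+ 2 * (2 * B)).
Let r2 k : R := ar_cov k.+1%:Z ^+ 2.
Let r2_ge0 k : 0 <= r2 k. Proof. exact: sqr_ge0. Qed.
Let r2_le n : \sum_(k < n) r2 k <= R2.
Proof.
apply: le_trans (sum_ar_cov_sqr n.+1).
by rewrite big_ord_recl/= lerDr sqr_ge0.
Qed.

(** The sum of R^2 over all integers, folded by parity; it is half of sigma_H^2. *)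
Definition ar_cov_energy : R := ar_cov 0 ^+ 2 + 2 * suml (fun k => ar_cov k.+1%:Z ^+ 2).

Let sum_sym (F : nat -> nat -> R) n : (forall i j, F i j = F j i) ->
  \sum_(i < n) \sum_(j < n) F i j = \sum_(i < n) (F i i + 2 * \sum_(j < i) F i j).
Proof.
move=> Fs; elim: n => [|n IH]; first by rewrite !big_ord0.
rewrite [RHS]big_ord_recr/= -IH big_ord_recr/=.
under eq_bigr do rewrite big_ord_recr/=.
rewrite big_split/= [X in _ + X]big_ord_recr/=.
have -> : \sum_(i < n) F i n = \sum_(i < n) F n i by apply: eq_bigr => i _; exact: Fs.
by ring.
Qed.

(** The increment of tr(A_n^2) from n = i to i + 1: the new diagonal entry and twice the new row.
    The normalized trace is then an arithmetic mean, to which Cesaro's theorem applies. *)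
Let D i : R := ar_box i.+1 i.+1 0 ^+ 2 + 2 * \sum_(k < i) ar_box (i - k) i.+1 k.+1%:Z ^+ 2.

Let trace_D n : \tr (acov_mx n ^+ 2) = \sum_(i < n) D i.
Proof.
rewrite trace_sqr; last by move=> i j; rewrite !mxE acov_sym.
transitivity (\sum_(i < n) \sum_(j < n) acov i.+1 j.+1 ^+ 2).
  by apply: eq_bigr => i _; apply: eq_bigr => j _; rewrite mxE.
rewrite (sum_sym (F := fun i j => acov i.+1 j.+1 ^+ 2)); last first.
  by move=> i j; rewrite acov_sym.
apply: eq_bigr => i _; rewrite /D /acov subrr; congr (_ + 2 * _).
rewrite (reindex_inj rev_ord_inj)/=; apply: eq_bigr => k _.
rewrite -ar_boxN subnSK//; congr (ar_box _ _ _ ^+ 2).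
by rewrite -subzn ?(ltnW (ltn_ord k))// -[i.+1]addn1 -[k.+1]addn1 !PoszD; ring.
Qed.

Let cvg_D : D i @[i --> \oo] --> ar_cov_energy.
Proof.
apply/cvgrPdist_le => e e0.
have e2 : 0 < e / 4 by rewrite divr_gt0.
have cs := cvg_suml r2_ge0 r2_le.
have [K HK] : exists K, suml r2 - \sum_(k < K) r2 k <= e / 4.
  near \oo => K; exists K; apply: le_trans (ler_norm _) _.
  by near: K; move/cvgrPdist_le : cs; apply.
(* A lower bound for D (K + i): for the first K lags both sides of the box are at least i. Its limit
   misses [ar_cov_energy] only by twice the tail of the series. *)
pose L i := ar_box i.+1 i.+1 0 ^+ 2 + 2 * \sum_(k < K) ar_box i i k.+1%:Z ^+ 2.
have cL : L i @[i --> \oo] --> ar_cov 0 ^+ 2 + 2 * \sum_(k < K) r2 k.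
  apply: cvgD.
    have : ar_box i i 0 * ar_box i i 0 @[i --> \oo] --> ar_cov 0 * ar_cov 0.
      by apply: cvgM; exact: cvg_ar_box.
    by rewrite -cvg_shiftS.
  apply: cvgM; first exact: cvg_cst.
  apply: (@cvg_bigsum _ _ (fun k i => ar_box i i k.+1%:Z ^+ 2) r2) => k.
  by rewrite /r2 expr2; apply: cvgM; exact: cvg_ar_box.
have ub i : D i <= ar_cov_energy.
  apply: lerD.
    by rewrite ler_sqr ?nnegrE ?ar_box_ge0 ?ar_cov_ge0// ar_box_le_cov.
  apply: ler_wpM2l => //; apply: le_trans (ler_suml i r2_ge0 r2_le).
  apply: ler_sum => k _.
  by rewrite ler_sqr ?nnegrE ?ar_box_ge0 ?ar_cov_ge0// ar_box_le_cov.
have lb i : L i <= D (K + i)%N.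
  apply: lerD.
    rewrite ler_sqr ?nnegrE ?ar_box_ge0//.
    by apply: ler_ar_box; rewrite ltnS leq_addl.
  apply: ler_wpM2l => //.
  apply: (@le_trans _ _ (\sum_(k < K) ar_box (K + i - k) (K + i).+1 k.+1%:Z ^+ 2)).
    apply: ler_sum => k _; rewrite ler_sqr ?nnegrE ?ar_box_ge0//.
    apply: ler_ar_box; last by rewrite leqW// leq_addl.
    by rewrite -addnBAC ?leq_addl// ltnW.
  rewrite (@sum_ord_add _ (fun k => ar_box (K + i - k) (K + i).+1 k.+1%:Z ^+ 2)) lerDl.
  by apply: sumr_ge0 => k _; exact: sqr_ge0.
near=> n.
have Kn : (K <= n)%N by near: n; exact: nbhs_infty_ge.
have H1 : `|(ar_cov 0 ^+ 2 + 2 * \sum_(k < K) r2 k) - L (n - K)%N| <= e / 4.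
  near: n.
  have /cvgrPdist_le/(_ _ e2) [N _ HN] := cL.
  exists (N + K)%N => // n /= NKn; apply: HN => /=.
  by rewrite leq_subRL ?(leq_trans _ NKn) ?leq_addl// addnC.
have H2 := lb (n - K)%N; rewrite subnKC// in H2.
have := ub n; move: H1 H2 HK; rewrite ler_norml /ar_cov_energy -/r2.
move: (suml r2) (\sum_(k < K) r2 k) (L _) (D n) (ar_cov 0 ^+ 2) => s t l q c.
move=> /andP[? ?] ? ? ?; rewrite ler_norml; apply/andP; split; lra.
Unshelve. all: by end_near. Qed.

Lemma cvg_trace_acov :
  n%:R^-1 * \tr (acov_mx n ^+ 2) @[n --> \oo] --> ar_cov_energy.
Proof.
rewrite -cvg_shiftS; apply: (@cvg_ext _ _ (arithmetic_mean D)); last exact: cesaro cvg_D.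
by move=> n; rewrite trace_D /arithmetic_mean /series/= big_mkord.
Qed.

Lemma ar_cov_energy_gt0 : 0 < ar_cov_energy.
Proof.
apply: ltr_wpDr.
  rewrite mulr_ge0//; apply: le_trans (ler_suml 0 r2_ge0 r2_le).
  by rewrite big_ord0.
by rewrite exprn_gt0// (lt_le_trans ltr01 ar_cov0_ge1).
Qed.
Section scaled_traces.
Variables (f' : R) (f'0 : 0 < f').
Let c n : R := (Num.sqrt n%:R * f')^-1.

Lemma cvg_scaled_trace2 : c n ^+ 2 * \tr (acov_mx n ^+ 2) @[n --> \oo] -->
  ar_cov_energy / f' ^+ 2.
Proof.
apply: (@cvg_ext _ _ (fun n => n%:R^-1 * \tr (acov_mx n ^+ 2) * (f' ^+ 2)^-1)) => [n|].
  by rewrite /c exprVn exprMn sqr_sqrtr ?ler0n// invfM mulrAC.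
by apply: cvgM; [exact: cvg_trace_acov|exact: cvg_cst].
Qed.

Lemma cvg_scaled_trace3 k : c n ^+ k.+3 * \tr (acov_mx n ^+ k.+3) @[n --> \oo] --> (0 : R).
Proof.
pose q n : R := c n * acov_row n.
have cq : q n @[n --> \oo] --> (0 : R).
  apply: (@cvg_ext _ _ (fun n => (Num.sqrt n%:R)^-1 * acov_row n * f'^-1)) => [n|].
    by rewrite /q /c invfM mulrAC.
  by rewrite -(mul0r f'^-1); apply: cvgM; [exact: cvg_acov_row|exact: cvg_cst].
have cqk j : q n ^+ j.+1 @[n --> \oo] --> (0 : R).
  elim: j => [|j IH]; first by apply: (@cvg_ext _ _ q).
  rewrite -(mul0r 0); under eq_fun do rewrite exprS.
  exact: cvgM.
have cb : q n ^+ k.+1 * (c n ^+ 2 * \tr (acov_mx n ^+ 2)) @[n --> \oo] --> (0 : R).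
  rewrite -(mul0r (ar_cov_energy / f' ^+ 2)); apply: cvgM => //.
  exact: cvg_scaled_trace2.
apply: (squeeze_cvgr _ (cvg_cst (0 : R)) cb).
near=> n.
have n0 : (0 < n)%N by near: n; exact: nbhs_infty_gt.
have c0 : 0 <= c n by rewrite invr_ge0 mulr_ge0// ltW.
have Ag i j : 0 <= acov_mx n i j by rewrite mxE acov_ge0.
have As i j : acov_mx n i j = acov_mx n j i by rewrite !mxE acov_sym.
apply/andP; split; first by rewrite mulr_ge0 ?exprn_ge0// trace_pow_ge0.
have l0 : 0 < acov_row n by rewrite -(prednK n0) acov_row_gt0.
have := trace_pow_le l0 Ag As (@acov_mx_row n) k.+1.
move=> /(ler_wpM2l (exprn_ge0 k.+3 c0)) /le_trans; apply.
have -> : c n ^+ k.+3 = c n ^+ k.+1 * c n ^+ 2 by rewrite -exprD addn2.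
rewrite /q [(c n * acov_row n) ^+ k.+1]exprMn; move: (c n ^+ k.+1) (c n ^+ 2) (acov_row n ^+ k.+1) (\tr _) => x y z t.
by have -> : x * y * (z * t) = x * z * (y * t) by ring.
Unshelve. all: by end_near. Qed.
End scaled_traces.

End ar_covariance.

(** * The second moment function and its inverse *)

Section second_moment.
Context {R : realType} (rho : int -> R).
Hypothesis rho_ge0 : forall k, 0 <= rho k.
Hypothesis rho_le1 : forall k, rho k <= 1.
Hypothesis rhoN : forall k, rho (- k) = rho k.
Hypothesis rho0 : rho 0 = 1.
Implicit Types v : R.

Local Notation f := (second_moment_function rho).

Let c (k : nat) : R := rho k%:Z.

Lemma nneseries_suml (F : nat -> R) B : (forall k, 0 <= F k) ->
  (forall n, \sum_(k < n) F k <= B) ->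
  (\sum_(0 <= k <oo) (F k)%:E)%E = (suml F)%:E.
Proof.
move=> F0 FB; apply: cvg_lim => //.
have -> : (fun n => \sum_(0 <= k < n) (F k)%:E)%E = EFin \o (fun n => \sum_(k < n) F k).
  by apply/funext => n /=; rewrite sumEFin big_mkord.
apply: cvg_EFin; first exact: nearW.
exact: cvg_suml F0 FB.
Qed.

(** The terms are nonnegative, so every finite box is below both the iterated sum and the limit
    along squares; each limit is therefore at most the other. *)
Lemma second_moment_ar_cov v : 0 < v -> v < 1 -> f v = ar_cov v rho 0.
Proof.
move=> v0 v1.
have vn n : 0 <= v ^+ n by rewrite exprn_ge0// ltW.
pose F i j := v ^+ (i + j) * rho (i%:Z - j%:Z).
have F0 i j : 0 <= F i j by rewrite mulr_ge0.
have boxE N M : \sum_(a < N) \sum_(b < M) F a b = ar_box v rho N M 0.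
  by apply: eq_bigr => a _; apply: eq_bigr => b _; rewrite add0r.
have Fb i n : \sum_(j < n) F i j <= (1 - v)^-1 ^+ 2.
  apply: le_trans (ar_box_ub v0 v1 rho_le1 i.+1 n 0).
  rewrite -boxE big_ord_recr/= lerDr.
  by do 2 (apply: sumr_ge0 => ? _).
have Sc N : \sum_(i < N) \sum_(j < M) F i j @[M --> \oo] --> \sum_(i < N) suml (F i).
  apply: (@cvg_bigsum _ _ (fun i M => \sum_(j < M) F i j) (fun i => suml (F i))) => i.
  exact: cvg_suml (F0 i) (Fb i).
have SF0 i : 0 <= suml (F i) by apply: le_trans (ler_suml 0 (F0 i) (Fb i)); rewrite big_ord0.
have SFb N : \sum_(i < N) suml (F i) <= ar_cov v rho 0.
  rewrite -(cvg_lim (@Rhausdorff R) (Sc N)); apply: limr_le; first exact: cvgP (Sc N).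
  by apply: nearW => M; rewrite boxE; apply: ar_box_le_cov.
rewrite /second_moment_function.
transitivity (fine (\sum_(0 <= i <oo) (suml (F i))%:E)%E).
  congr fine; apply: eq_eseriesr => i _.
  exact: nneseries_suml (F0 i) (Fb i).
rewrite (nneseries_suml SF0 SFb) /=; apply/eqP; rewrite eq_le; apply/andP; split.
  apply: limr_le; first exact: cvgP (cvg_suml SF0 SFb).
  exact: nearW.
apply: limr_le; first by apply: cvgP; exact: cvg_ar_box.
apply: nearW => N; rewrite -boxE; apply: le_trans (ler_suml N SF0 SFb).
by apply: ler_sum => i _; exact: ler_suml (F0 i) (Fb i).
Qed.

Let g v := limn (pseries c v).

(** Removing the first row and the first column leaves v^2 times the previous box, because [rho]
    depends only on the difference of the indices. In the limit this is (1 - v^2) f(v) = 2 g(v) -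
    1. *)
Lemma ar_box_rec v N : ar_box v rho N.+1 N.+1 0 =
  2 * (\sum_(k < N.+1) c k * v ^+ k) - 1 + v ^+ 2 * ar_box v rho N N 0.
Proof.
rewrite /ar_box big_ord_recl.
have -> : \sum_(b < N.+1) v ^+ (@ord0 N + b) * rho (0 + (@ord0 N)%:Z - b%:Z) =
    \sum_(k < N.+1) c k * v ^+ k.
  apply: eq_bigr => b _; rewrite add0n addr0 sub0r rhoN; exact: mulrC.
under [X in _ + X = _]eq_bigr do rewrite big_ord_recl.
rewrite big_split/=.
have -> : \sum_(i < N) v ^+ (lift ord0 i + @ord0 N) * rho (0 + (lift ord0 i)%:Z - (@ord0 N)%:Z)
   = \sum_(k < N.+1) c k * v ^+ k - 1.
  rewrite big_ord_recl /c /= rho0 expr0 mul1r addrAC subrr add0r.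
  by apply: eq_bigr => i _; rewrite addn0 subr0 add0r mulrC.
have -> : \sum_(i < N) \sum_(j < N) v ^+ (lift ord0 i + lift ord0 j) *
     rho (0 + (lift ord0 i)%:Z - (lift ord0 j)%:Z) = v ^+ 2 * ar_box v rho N N 0.
  rewrite /ar_box mulr_sumr; apply: eq_bigr => i _; rewrite mulr_sumr; apply: eq_bigr => j _.
  rewrite !lift0 mulrA -exprD; congr (v ^+ _ * rho _).
    by rewrite addSn addnS.
  by rewrite -[i.+1]addn1 -[j.+1]addn1 !PoszD; ring.
by rewrite /ar_box; ring.
Qed.

(** Since 0 <= rho <= 1, the coefficients (i + 1)(i + 2) dominate those of g and of its first two
    derivatives simultaneously. *)
Lemma sum_pow_quad_le v n : 0 <= v -> v < 1 ->
  \sum_(i < n) (i.+1%:R * i.+2%:R) * v ^+ i <= 2 / (1 - v) ^+ 3.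
Proof.
move=> v0 v1; have om : 0 < 1 - v by rewrite subr_gt0.
have vn k : 0 <= v ^+ k by rewrite exprn_ge0.
have E1 m : (1 - v) * \sum_(i < m) i.+1%:R * v ^+ i =
    \sum_(i < m) v ^+ i - m%:R * v ^+ m.
  elim: m => [|m IH]; first by rewrite !big_ord0 mulr0 mul0r subrr.
  by rewrite !big_ord_recr/= mulrDr IH exprS -[m.+1]addn1 natrD; ring.
have E2 m : (1 - v) * \sum_(i < m) (i.+1%:R * i.+2%:R) * v ^+ i =
    2 * \sum_(i < m) i.+1%:R * v ^+ i - m%:R * m.+1%:R * v ^+ m.
  elim: m => [|m IH]; first by rewrite !big_ord0 !mulr0 mul0r mul0r subrr.
  by rewrite !big_ord_recr/= mulrDr IH exprS -[m.+2]addn2 -[m.+1]addn1 !natrD; ring.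
have H1 : \sum_(i < n) i.+1%:R * v ^+ i <= (1 - v)^-1 ^+ 2.
  rewrite expr2 -ler_pdivrMl ?invr_gt0// invrK E1 lerBlDr.
  by apply: ler_wpDr; [rewrite mulr_ge0|apply: sum_geometric_le; rewrite v0 v1].
have -> : 2 / (1 - v) ^+ 3 = (1 - v)^-1 * (2 * (1 - v)^-1 ^+ 2).
  by field; rewrite gt_eqF.
rewrite -ler_pdivrMl ?invr_gt0// invrK E2 lerBlDr.
by apply: ler_wpDr; [rewrite !mulr_ge0|apply: ler_wpM2l].
Qed.

Lemma cvg_nneg_pseries (a : nat -> R) v B : 0 <= v -> (forall k, 0 <= a k) ->
  (forall n, \sum_(k < n) a k * v ^+ k <= B) ->
  (\sum_(k < n) a k * v ^+ k @[n --> \oo] --> limn (pseries a v)) /\ cvgn (pseries a v).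
Proof.
move=> v0 a0 aB; have t0 k : 0 <= a k * v ^+ k by rewrite mulr_ge0// exprn_ge0.
have E : pseries a v = (fun n => \sum_(k < n) a k * v ^+ k).
  by apply/funext => n; rewrite /pseries /series/= big_mkord.
have H := cvg_suml t0 aB; rewrite E; split=> //; exact: cvgP H.
Qed.

Let pseries_quad (a : nat -> R) v n : 0 <= v -> v < 1 ->
  (forall k, 0 <= a k <= k.+1%:R * k.+2%:R) ->
  \sum_(k < n) a k * v ^+ k <= 2 / (1 - v) ^+ 3.
Proof.
move=> v0 v1 aB; apply: le_trans (sum_pow_quad_le n v0 v1).
by apply: ler_sum => k _; apply: ler_wpM2r; [exact: exprn_ge0|case/andP: (aB k)].
Qed.

Let c_quad k : 0 <= c k <= k.+1%:R * k.+2%:R.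
Proof.
rewrite rho_ge0 (le_trans (rho_le1 _))// -natrM ler1n.
by rewrite muln_gt0.
Qed.

Let dc_quad k : 0 <= pseries_diffs c k <= k.+1%:R * k.+2%:R.
Proof.
apply/andP; split; first by rewrite /pseries_diffs mulr_ge0// rho_ge0.
by apply: ler_wpM2l => //; apply: (le_trans (rho_le1 _)); rewrite ler1n.
Qed.

Let ddc_quad k : 0 <= pseries_diffs (pseries_diffs c) k <= k.+1%:R * k.+2%:R.
Proof.
apply/andP; split; first by rewrite /pseries_diffs !mulr_ge0// rho_ge0.
by apply: ler_wpM2l => //; apply: ler_piMr => //; exact: rho_le1.
Qed.

Lemma second_moment_eq v : 0 < v -> v < 1 -> (1 - v ^+ 2) * f v = 2 * g v - 1.
Proof.
move=> v0 v1; rewrite second_moment_ar_cov//.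
have cA : ar_box v rho N N 0 @[N --> \oo] --> ar_cov v rho 0 by exact: cvg_ar_box.
have [cg _] := cvg_nneg_pseries (ltW v0) (fun k => rho_ge0 k%:Z)
  (fun n => pseries_quad n (ltW v0) v1 c_quad).
have L : ar_box v rho N.+1 N.+1 0 @[N --> \oo] --> ar_cov v rho 0.
  by rewrite (cvg_shiftS (fun N => ar_box v rho N N 0)).
have L' : ar_box v rho N.+1 N.+1 0 @[N --> \oo] --> 2 * g v - 1 + v ^+ 2 * ar_cov v rho 0.
  apply: (cvg_ext (ar_box_rec v)); apply: cvgD; last by apply: cvgM; [exact: cvg_cst|].
  apply: cvgB; last exact: cvg_cst.
  apply: cvgM; first exact: cvg_cst.
  by rewrite (cvg_shiftS (fun N => \sum_(k < N) c k * v ^+ k)).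
have E := cvg_unique (@Rhausdorff R) L L'.
by rewrite mulrBl mul1r {1}E addrK.
Qed.

Let g_cvg v (v0 : 0 < v) (v1 : v < 1) :
  (\sum_(k < n) c k * v ^+ k @[n --> \oo] --> g v) /\ cvgn (pseries c v).
Proof.
exact: (cvg_nneg_pseries (ltW v0) (fun k => rho_ge0 k%:Z)
  (fun n => pseries_quad n (ltW v0) v1 c_quad)).
Qed.

Let g_ge1 v : 0 < v -> v < 1 -> 1 <= g v.
Proof.
move=> v0 v1; have [cg _] := g_cvg v0 v1.
rewrite -(cvg_lim (@Rhausdorff R) cg); apply: limr_ge; first exact: cvgP cg.
near=> n; have n0 : (0 < n)%N by near: n; exact: nbhs_infty_gt.
rewrite -(prednK n0) big_ord_recl /c rho0 expr0 mulr1 lerDl.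
by apply: sumr_ge0 => i _; rewrite mulr_ge0// exprn_ge0// ltW.
Unshelve. all: by end_near. Qed.

Let g_le v w : 0 < v -> v <= w -> w < 1 -> g v <= g w.
Proof.
move=> v0 vw w1; have w0 := lt_le_trans v0 vw; have v1 := le_lt_trans vw w1.
have [cv _] := g_cvg v0 v1; have [cw _] := g_cvg w0 w1.
rewrite -(cvg_lim (@Rhausdorff R) cv) -(cvg_lim (@Rhausdorff R) cw).
apply: ler_lim; [exact: cvgP cv|exact: cvgP cw|apply: nearW => n].
apply: ler_sum => k _; apply: ler_wpM2l; first exact: rho_ge0.
by apply: lerXn2r => //; rewrite nnegrE ltW.
Qed.

Let om2 v : 0 < v -> v < 1 -> 0 < 1 - v ^+ 2.
Proof. by move=> v0 v1; rewrite subr_gt0 expr_lt1// ltW. Qed.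

(** In f = (2 g - 1) / (1 - u^2) the numerator is nondecreasing and at least 1, while 1 / (1 - u^2)
    increases strictly. *)
Lemma second_moment_lt v w : 0 < v -> v < w -> w < 1 -> f v < f w.
Proof.
move=> v0 vw w1; have w0 := lt_trans v0 vw; have v1 := lt_trans vw w1.
have E u : 0 < u -> u < 1 -> f u = (2 * g u - 1) / (1 - u ^+ 2).
  move=> u0 u1; rewrite -(second_moment_eq u0 u1) mulrC mulKf// gt_eqF//.
  exact: om2.
rewrite !E//; have := g_le v0 (ltW vw) w1; have := g_ge1 v0 v1.
move: (g v) (g w) => a b a1 ab.
apply: (@lt_le_trans _ _ ((2 * a - 1) / (1 - w ^+ 2))).
  rewrite ltr_pM2l; last by lra.
  rewrite ltf_pV2 ?posrE ?om2// ltrD2l ltrN2 ltr_sqr ?nnegrE ?ltW//.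
by rewrite ler_pM2r ?invr_gt0 ?om2//; lra.
Qed.

Lemma is_derive_second_moment v : 0 < v -> v < 1 ->
  exists2 df, 0 < df & is_derive v 1 f df.
Proof.
(* The midpoint of v and 1: termwise differentiation at v asks for convergence of the series and of
   its two formal derivatives at a larger point. *)
move=> v0 v1; pose K := (v + 1) / 2.
have K0 : 0 < K by rewrite /K; lra.
have K1 : K < 1 by rewrite /K; lra.
have vK : `|v| < `|K| by rewrite !gtr0_norm// /K; lra.
have dck k : 0 <= pseries_diffs c k by case/andP: (dc_quad k).
have ddck k : 0 <= pseries_diffs (pseries_diffs c) k by case/andP: (ddc_quad k).
have [_ H0] := g_cvg K0 K1.
have [_ H1] := cvg_nneg_pseries (ltW K0) dck (fun n => pseries_quad n (ltW K0) K1 dc_quad).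
have [_ H2] := cvg_nneg_pseries (ltW K0) ddck (fun n => pseries_quad n (ltW K0) K1 ddc_quad).
have dg := pseries_snd_diffs H0 H1 H2 vK.
pose g' := limn (pseries (pseries_diffs c) v).
have g'0 : 0 <= g'.
  have [cg' _] := cvg_nneg_pseries (ltW v0) dck (fun n => pseries_quad n (ltW v0) v1 dc_quad).
  rewrite /g' -(cvg_lim (@Rhausdorff R) cg'); apply: limr_ge; first exact: cvgP cg'.
  apply: nearW => n; apply: sumr_ge0 => k _.
  by rewrite mulr_ge0// exprn_ge0// ltW.
have o2 := om2 v0 v1.
pose h (u : R) := (2 * g u - 1) * (1 - u ^+ 2)^-1.
pose df := ((1 - v ^+ 2) * (2 * g') + 2 * v * (2 * g v - 1)) / (1 - v ^+ 2) ^+ 2.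
have df0 : 0 < df.
  (* The term in g' is nonnegative; strict positivity comes from 2 v (2 g - 1), as g >= 1. *)
  rewrite divr_gt0 ?exprn_gt0//; apply: ltr_wpDl; first by rewrite !mulr_ge0// ltW.
  by rewrite !mulr_gt0//; have := g_ge1 v0 v1; lra.
exists df; first exact: df0.
have d1 : is_derive v 1 (fun u : R => 1 - u ^+ 2) (- (2 * v)).
  have := is_deriveB (is_derive_cst (1 : R) v 1) (is_derive_pow 2 v).
  by move/is_derive_eq; apply; rewrite sub0r expr1.
have n2 : (fun u : R => 1 - u ^+ 2) v != 0 by rewrite gt_eqF.
have d2 : is_derive v 1 (fun u => 2 * g u - 1) (2 * g').
  have := is_deriveB (is_deriveZ (2 : R) dg) (is_derive_cst (1 : R) v 1).
  by move/is_derive_eq; apply; rewrite subr0.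
have dh : is_derive v 1 h df.
  have := is_deriveM d2 (is_deriveV (f := fun u : R => 1 - u ^+ 2) n2 d1).
  move/is_derive_eq; apply; rewrite /df /GRing.scale/=.
  by move: (g v) => a; field; rewrite gt_eqF.
have fh : {near v, f =1 h}.
  near=> u.
  have u0 : 0 < u by near: u; exact: lt_nbhsr.
  have u1 : u < 1 by near: u; exact: lt_nbhsl.
  by rewrite /h -(second_moment_eq u0 u1) mulrC mulKf// gt_eqF// om2.
by apply: (near_eq_is_derive _ dh); apply: filterS fh => u ->.
Unshelve. all: by end_near. Qed.
End second_moment.

(** The estimator is defined on the whole sample space, so its measurability involves the inverse
    outside the range of f. *)
Lemma pinv_default (aT rT : Type) (dflt : rT -> aT) (A : set aT) (f : aT -> rT) y :
  ~ (f @` A) y -> 'pinv_dflt A f y = dflt y.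
Proof.
move=> yA; rewrite /pinv_ splitV.
(* Head reduction exposes the case distinction on membership in the image. *)
match goal with |- odflt _ ?x = _ => let y := eval hnf in x in change x with y end.
by case: pselect.
Qed.

(** * The inverse of an increasing function and the delta method *)

Section monotone_inverse.
Context {R : realType} (f : R -> R) (a b : R).
Hypothesis f_lt : forall x y, a < x -> x < y -> y < b -> f x < f y.
Hypothesis f_cont : forall x, a < x -> x < b -> {for x, continuous f}.
Local Notation psi := ('pinv_(fun=> 0) `]a, b[ f).

Lemma increasing_inj_oo : {in `]a, b[%classic &, injective f}.
Proof.
move=> x y; rewrite !inE /= !in_itv/= => /andP[ax xb] /andP[ay yb] fxy.
have [xy|yx|//] := ltgtP x y.
  by have := f_lt ax xy yb; rewrite fxy ltxx.
by have := f_lt ay yx xb; rewrite fxy ltxx.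
Qed.

Lemma increasing_pinvK x : a < x -> x < b -> psi (f x) = x.
Proof.
move=> ax xb; apply: (@pinvKV _ _ (fun=> 0) _ _ increasing_inj_oo).
by rewrite inE/= in_itv/= ax xb.
Qed.

(** On the image D, itself an interval, the inverse is increasing, so the preimage of a half-line is
    an interval. *)
Lemma measurable_pinv : measurable_fun setT psi.
Proof.
pose D := f @` `]a, b[%classic.
have cont_within : {within `]a, b[, continuous f}.
  rewrite continuous_open_subspace; last exact: interval_open.
  by move=> x; rewrite inE/= in_itv/= => /andP[? ?]; exact: f_cont.
have convD : is_interval D.
  apply/connected_intervalP; apply: connected_continuous_connected => //.
  by apply/connected_intervalP; exact: interval_is_interval.
have mD : measurable D by exact: is_interval_measurable.
(* The default value 0 of the inverse is also the value of a restriction outside D. *)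
have E : psi = psi \_ D.
  apply/funext => y; rewrite patchE; case: ifPn => // /negP yD.
  by apply: pinv_default => Dy; apply: yD; rewrite inE.
rewrite E; apply/(measurable_restrictT _ mD).
apply: (measurability (@RGenCInfty.G R)) => [|/= _ [_] [r] -> <-].
  exact: RGenCInfty.measurableE.
apply: is_interval_measurable => _ _ [[s + <-] sr] [[t + <-] tr].
rewrite /= !in_itv/= => /andP[as_ sb] /andP[at_ tb].
move: sr tr; rewrite /= !in_itv/= !increasing_pinvK// !andbT => rs rt u /andP[su ut].
have : D u.
  apply: (convD (f s) (f t)) => //.
  - by exists s => //=; rewrite in_itv/= as_.
  - by exists t => //=; rewrite in_itv/= at_.
  - by rewrite su.
move=> [x + xu]; rewrite /= in_itv/= => /andP[ax xb]; split; first by exists x => //=; rewrite in_itv/= ax.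
rewrite /= in_itv/= andbT -xu increasing_pinvK//.
apply: (le_trans rs); rewrite leNgt; apply/negP => xs.
by have := f_lt ax xs sb; rewrite xu ltNge su.
Qed.

Lemma is_derive_pinv x df : a < x -> x < b -> is_derive x 1 f df -> df != 0 ->
  is_derive (f x) 1 psi df^-1.
Proof.
move=> ax xb dfx df0; apply: is_derive_inverse => //.
  near=> y; apply: increasing_pinvK; near: y; [exact: lt_nbhsr|exact: lt_nbhsl].
near=> y; apply: f_cont; near: y; [exact: lt_nbhsr|exact: lt_nbhsl].
Unshelve. all: by end_near. Qed.

(** Caratheodory's form of the derivative writes the increment of the inverse as q(y) times the
    increment of its argument, with q continuous at f(x) and q(f(x)) = 1/df. The estimate is uniform
    in |s| <= A, so that s may be replaced by a random value. *)
Lemma pinv_delta_method x df (bias : nat -> R) : a < x -> x < b ->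
  is_derive x 1 f df -> 0 < df ->
  Num.sqrt n%:R * bias n @[n --> \oo] --> (0 : R) ->
  forall A e, 0 < A -> 0 < e -> \forall n \near \oo, forall s, `|s| <= A ->
    `|Num.sqrt n%:R * (psi (f x + (df * s / Num.sqrt n%:R + bias n)) - x) - s| <= e.
Proof.
move=> ax xb dfx df0 cb A e A0 e0.
have /is_derive1_caratheodory [q [qE qc qx]] := is_derive_pinv ax xb dfx (lt0r_neq0 df0).
have e20 : 0 < e / 2 by rewrite divr_gt0.
(* Bounds sqrt n times the increment as soon as sqrt n times the bias is at most 1, the first
   argument of the minimum below; the second one controls the bias divided by df. *)
pose K := df * A + 1.
have K0 : 0 < K by rewrite addr_gt0// mulr_gt0.
have eta0 : 0 < e / 2 / K by rewrite divr_gt0.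
have /cvgrPdist_le/(_ _ eta0)/nbhs_ballP [r /= r0 Hr] := qc.
have eb : 0 < Num.min 1 (e / 2 * df) by rewrite lt_min ltr01 mulr_gt0.
have c0 : K * (Num.sqrt (n%:R : R))^-1 @[n --> \oo] --> (0 : R).
  by rewrite -(mulr0 K); apply: cvgM; [exact: cvg_cst|exact: cvg_sqrt_infty].
have Eb : \forall n \near \oo, `|Num.sqrt n%:R * bias n| <= Num.min 1 (e / 2 * df).
  by exact: (cvgr0_norm_le _ cb _ eb).
have Ec : \forall n \near \oo, `|K * (Num.sqrt (n%:R : R))^-1| < r.
  by exact: (cvgr0_norm_lt _ c0 _ r0).
near=> n.
have n0 : (0 < n)%N by near: n; exact: nbhs_infty_gt.
have Hb : `|Num.sqrt n%:R * bias n| <= Num.min 1 (e / 2 * df) by near: n; exact: Eb.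
have HK : `|K * (Num.sqrt (n%:R : R))^-1| < r by near: n; exact: Ec.
move=> s sA.
have {HK} := le_lt_trans (ler_norm _) HK.
move: Hb; set w := Num.sqrt (n%:R : R) => Hb HK.
have w0 : 0 < w by rewrite sqrtr_gt0 ltr0n.
move: Hb; rewrite le_min => /andP[Hb1 Hb2].
pose h := df * s / w + bias n.
have wh : w * h = df * s + w * bias n.
  by rewrite /h mulrDr; congr (_ + _); rewrite mulrC divfK// gt_eqF.
have whK : `|w * h| <= K.
  rewrite wh; apply: (le_trans (ler_normD _ _)); apply: lerD => //.
  by rewrite normrM (gtr0_norm df0) ler_pM2l.
have hr : `|h| < r.
  apply: le_lt_trans HK; rewrite ler_pdivlMr// mulrC.
  by move: whK; rewrite normrM (gtr0_norm w0).
rewrite -/h.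
have := qE (f x + h); rewrite increasing_pinvK// addrAC subrr add0r => ->.
have Hq : `|q (f x) - q (f x + h)| <= e / 2 / K.
  by apply: Hr; rewrite /ball/= opprD addrA subrr sub0r normrN.
have -> : w * (q (f x + h) * h) - s =
    (q (f x + h) - q (f x)) * (w * h) + df^-1 * (w * bias n).
  have -> : w * bias n = w * h - df * s by rewrite wh addrAC subrr add0r.
  by rewrite qx; field; rewrite gt_eqF.
rewrite (splitr e); apply: (le_trans (ler_normD _ _)); apply: lerD.
  rewrite normrM distrC -[leRHS](divfK (lt0r_neq0 K0)).
  by apply: ler_pM.
by rewrite normrM gtr0_norm ?invr_gt0// ler_pdivrMl// [df * _]mulrC.
Unshelve. all: by end_near. Qed.
End monotone_inverse.

(** * The bias due to the initial value *)

Section bias.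
Context {R : realType} (theta : R) (rho : int -> R).
Hypothesis th0 : 0 < theta.
Hypothesis th1 : theta < 1.
Hypothesis rho_ge0 : forall k, 0 <= rho k.
Hypothesis rho_le1 : forall k, rho k <= 1.

Lemma ar_box_cst N M k : ar_box theta (fun=> 1 : R) N M k =
  (\sum_(a < N) theta ^+ a) * \sum_(b < M) theta ^+ b.
Proof.
rewrite /ar_box mulr_suml; apply: eq_bigr => a _; rewrite mulr_sumr.
by apply: eq_bigr => b _; rewrite mulr1 exprD.
Qed.

(* Both rho and 1 - rho are nonnegative, and the box sums of the constant 1 are explicit. *)
Lemma ar_cov_box_le N : ar_cov theta rho 0 - ar_box theta rho N N 0 <=
  2 * (1 - theta)^-1 ^+ 2 * theta ^+ N.
Proof.
have g0 : 0 < 1 - theta by rewrite subr_gt0.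
have boxB K : ar_box theta (fun k => 1 - rho k) K K 0 =
    ar_box theta (fun=> 1) K K 0 - ar_box theta rho K K 0.
  rewrite /ar_box -sumrB; apply: eq_bigr => a _; rewrite -sumrB.
  by apply: eq_bigr => b _; rewrite mulrBr.
rewrite lerBlDr; have cR := @cvg_ar_box _ _ _ th0 th1 rho_ge0 rho_le1 0.
rewrite -(cvg_lim _ cR)//; apply: limr_le; first by apply: cvgP cR.
near=> M.
have NM : (N <= M)%N by near: M; exact: nbhs_infty_ge.
have h K : 0 <= 1 - rho K by rewrite subr_ge0.
have := @ler_ar_box _ _ (fun k => 1 - rho k) th0 h _ _ _ _ 0 NM NM.
rewrite !boxB !ar_box_cst => H.
have HG K : \sum_(a < K) theta ^+ a = (1 - theta ^+ K) * (1 - theta)^-1.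
  by rewrite -opprB subrX1 -mulNr opprB mulrAC divff ?mul1r// gt_eqF.
have tN K : 0 <= theta ^+ K by rewrite exprn_ge0// ltW.
have tN1 K : theta ^+ K <= 1 by rewrite exprn_ile1// ltW.
have HM : (\sum_(a < M) theta ^+ a) * (\sum_(b < M) theta ^+ b) <= (1 - theta)^-1 ^+ 2.
  rewrite expr2; apply: ler_pM; rewrite ?HG ?mulr_ge0 ?subr_ge0 ?invr_ge0 ?(ltW g0)//;
    by rewrite ler_piMl ?invr_ge0 ?(ltW g0)// gerBl.
have HN : (1 - theta)^-1 ^+ 2 - (\sum_(a < N) theta ^+ a) * (\sum_(b < N) theta ^+ b) <=
    2 * (1 - theta)^-1 ^+ 2 * theta ^+ N.
  rewrite HG -subr_ge0.
  have -> : 2 * (1 - theta)^-1 ^+ 2 * theta ^+ N - ((1 - theta)^-1 ^+ 2 -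
    (1 - theta ^+ N) / (1 - theta) * ((1 - theta ^+ N) / (1 - theta))) =
    (theta ^+ N / (1 - theta)) ^+ 2.
    by move: (theta ^+ N) ((1 - theta)^-1) => t g; ring.
  exact: sqr_ge0.
lra.
Unshelve. all: by end_near. Qed.

(** The gap n R(0) - tr A_n is a sum of geometrically small errors, at most 2 / (1 - theta)^3 for
    all n; after normalization it is O(1 / sqrt n). *)
Lemma cvg_trace_bias :
  Num.sqrt n%:R * (n%:R^-1 * \tr (acov_mx theta rho n) - ar_cov theta rho 0)
    @[n --> \oo] --> (0 : R).
Proof.
set g := (1 - theta)^-1.
have g0 : 0 < g by rewrite invr_gt0 subr_gt0.
have gap n : 0 <= n%:R * ar_cov theta rho 0 - \tr (acov_mx theta rho n) <= 2 * g ^+ 3.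
  have -> : n%:R * ar_cov theta rho 0 - \tr (acov_mx theta rho n) =
      \sum_(i < n) (ar_cov theta rho 0 - ar_box theta rho i.+1 i.+1 0).
    rewrite sumrB sumr_const card_ord mulr_natl; congr (_ - _).
    by apply: eq_bigr => i _; rewrite mxE /acov subrr.
  apply/andP; split.
    by apply: sumr_ge0 => i _; rewrite subr_ge0; exact: ar_box_le_cov.
  apply: (@le_trans _ _ (\sum_(i < n) 2 * g ^+ 2 * theta ^+ i)).
    apply: ler_sum => i _; apply: (le_trans (ar_cov_box_le _)).
    apply: ler_wpM2l; first by rewrite mulr_ge0// exprn_ge0// ltW.
    by rewrite exprS ler_piMl ?exprn_ge0// ltW.
  have -> : 2 * g ^+ 3 = 2 * g ^+ 2 * g by ring.
  rewrite -mulr_sumr ler_pM2l ?mulr_gt0 ?exprn_gt0//.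
  by apply: sum_geometric_le; rewrite (ltW th0).
apply/norm_cvg0P.
have c0 : 2 * g ^+ 3 * (Num.sqrt (n%:R : R))^-1 @[n --> \oo] --> (0 : R).
  by rewrite -(mulr0 (2 * g ^+ 3)); apply: cvgM; [exact: cvg_cst|exact: cvg_sqrt_infty].
apply: (@squeeze_cvgr _ _ _ _ (fun=> 0 : R) (fun n => 2 * g ^+ 3 * (Num.sqrt (n%:R : R))^-1)) => //; last exact: cvg_cst.
near=> n; rewrite normr_ge0/=.
have n0 : (0 < n)%N by near: n; exact: nbhs_infty_gt.
set w := Num.sqrt (n%:R : R).
have w0 : 0 < w by rewrite sqrtr_gt0 ltr0n.
have wn : n%:R = w ^+ 2 by rewrite sqr_sqrtr// ler0n.
have -> : w * (n%:R^-1 * \tr (acov_mx theta rho n) - ar_cov theta rho 0) =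
    - ((n%:R * ar_cov theta rho 0 - \tr (acov_mx theta rho n)) * w^-1).
  by rewrite wn; field; rewrite gt_eqF.
have /andP[g1 g2] := gap n.
by rewrite normrN normrM (ger0_norm g1) gtr0_norm ?invr_gt0// ler_pM2r// invr_gt0.
Unshelve. all: by end_near. Qed.
End bias.

(** * The noise and the autoregression *)

Section gaussian_noise.
Context d (Omega : measurableType d) (R : realType) (P : probability Omega R).
Implicit Type F : Omega -> R.
Local Notation Ex F := (Rintegral P setT F).

(** The parameters are existential in [gaussian_variable]. The case k = 0 of the moment recursion
    identifies m with the mean. *)
Lemma gaussian_variable_moments F : measurable_fun setT F -> gaussian_variable P F ->
  all_moments P F /\ exists v, forall k,
    Ex (fun w => (F w - Ex F) ^+ k.+1) = k%:R * v * Ex (fun w => (F w - Ex F) ^+ k.-1).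
Proof.
move=> mF [m [v [v0 law]]].
have mp j : measurable_fun [set: R] (fun x : R => (x - m) ^+ j).
  by apply: measurable_funX; apply: measurable_funB.
have mpE j : measurable_fun [set: R] (EFin \o (fun x : R => (x - m) ^+ j)).
  exact/measurable_EFinP.
have nI j : (normal_law m v).-integrable setT (EFin \o (fun x => (x - m) ^+ j)).
  by have [] := normal_law_moments m j v0.
have tr j : Ex (fun w => (F w - m) ^+ j) = \int[normal_law m v]_x ((x - m) ^+ j).
  by rewrite /Rintegral -(integral_image mF law (mpE j) (nI j)).
have aFm : all_moments P (fun w => F w - m).
  split; first by apply: measurable_funB.
  by move=> j; have /(integrable_image mF law (mpE j)) := nI j.
have aF : all_moments P F.
  have -> : F = (fun w => (F w - m) + m) by apply/funext => w; rewrite subrK.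
  by apply: am_add => //; exact: am_cst.
have EF : Ex F = m.
  have := tr 1%N; have [_ ->] := normal_law_moments m 0 v0.
  have aN : all_moments P (fun=> - m) by exact: am_cst.
  rewrite !mul0r; under eq_Rintegral do rewrite expr1.
  by rewrite (ExD aF aN) Ex_cst => /eqP; rewrite subr_eq0 => /eqP.
split=> //; exists v => k; rewrite EF !tr.
by have [] := normal_law_moments m k v0.
Qed.

Variable xi : int -> {RV P >-> R}.
Hypothesis gxi : gaussian_sequence P xi.
Hypothesis cxi : centered P xi.
Hypothesis sxi : stationary P xi.
Local Notation rho := (covariance_function P xi).

(** Finite combinations suffice: X_t involves only t values of the noise, since X_0 = 0. *)
Definition linear_combination : set (Omega -> R) := [set F |
  exists n (c : 'I_n -> R) (t : 'I_n -> int), F = (fun w => \sum_(i < n) c i * xi (t i) w)].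

Lemma linear_combination_noise t : linear_combination (xi t).
Proof.
exists 1%N, (fun=> 1), (fun=> t); apply/funext => w.
by rewrite big_ord1 mul1r.
Qed.

Lemma am_linear_combination F : linear_combination F -> all_moments P F.
Proof.
move=> [n [c [t ->]]].
have mF : measurable_fun setT (fun w => \sum_(i < n) c i * xi (t i) w).
  apply: measurable_sum => i; apply: measurable_funM => //.
by have [] := gaussian_variable_moments mF (gxi c t).
Qed.

Lemma am_noise t : all_moments P (xi t).
Proof. exact/am_linear_combination/linear_combination_noise. Qed.

Lemma Ex_linear_combination F : linear_combination F -> Ex F = 0.
Proof.
move=> [n [c [t ->]]]; rewrite Ex_sum => [|i]; last by apply: am_scale; exact: am_noise.
rewrite big1// => i _; rewrite ExZ; last exact: am_noise.
by have := cxi (t i); rewrite unlock /Rintegral => ->; rewrite mulr0.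
Qed.

Lemma linear_combination_gaussian_space : gaussian_space P linear_combination.
Proof.
constructor.
- exists 0%N, (fun=> 0), (fun=> 0); apply/funext => w; by rewrite big_ord0.
- move=> U V a [n [c [t ->]]] [m [c' [t' ->]]].
  exists (n + m)%N, (fun i => match fintype.split i with inl j => c j | inr j => a * c' j end),
    (fun i => match fintype.split i with inl j => t j | inr j => t' j end).
  apply/funext => w; rewrite big_split_ord/= mulr_sumr; congr (_ + _).
    by apply: eq_bigr => i _; rewrite (unsplitK (inl _ i)).
  by apply: eq_bigr => i _; rewrite (unsplitK (inr _ i)) mulrA.
- exact: am_linear_combination.
- move=> U m GU; have E0 := Ex_linear_combination GU.
  have [mU _] := am_linear_combination GU.
  have gU : gaussian_variable P U by move: GU => [n [c [t ->]]]; exact: gxi.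
  have [_ [v]] := gaussian_variable_moments mU gU.
  rewrite E0 => H0.
  have H k : Ex (fun w => U w ^+ k.+1) = k%:R * v * Ex (fun w => U w ^+ k.-1).
    by have := H0 k; under eq_Rintegral do rewrite subr0;
      under [in RHS]eq_Rintegral do rewrite subr0.
  rewrite H; congr (_ * _ * _).
  (* The recursion at m = 1 identifies v with E(U^2). *)
  have := H 1%N; rewrite mul1r /=.
  under eq_Rintegral do rewrite expr2; move=> ->.
  by under eq_Rintegral do rewrite expr0; rewrite Ex_cst mulr1.
Qed.

(** Stationarity is applied to the pair of times (0, t - s) shifted by s; the unshifted pair
    provides the reference law. *)
Lemma noise_covariance s t : Ex (fun w => xi s w * xi t w) = rho (t - s).
Proof.
rewrite /covariance_function unlock /Rintegral; congr fine.
pose u (i : 'I_2) : int := if i == ord0 then 0 else t - s.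
pose T h w := [tuple xi (u i + h) w | i < 2].
have mT h : measurable_fun setT (T h).
  apply/measurable_fun_tnthP => i.
  by rewrite (_ : _ \o _ = xi (u i + h))//; apply/funext => w /=; rewrite tnth_mktuple.
pose nu := measure_function_pushforward__canonical__measure_function_Measure P (mT 0).
pose f (p : 2.-tuple R) := (tnth p ord0 * tnth p (lift ord0 ord0))%:E.
have mf : measurable_fun setT f.
  by apply/measurable_EFinP; apply: measurable_funM; exact: measurable_tnth.
have law h A : measurable A -> P (T h @^-1` A) = nu A.
  move=> mA; have := sxi u h mA; rewrite /pushforward => ->.
  by congr (P (_ @^-1` A)); apply/funext => w; apply: eq_from_tnth => i; rewrite !tnth_mktuple addr0.
have fT h w : f (T h w) = (xi h w * xi (t - s + h) w)%:E.
  by rewrite /f !tnth_mktuple /u eqxx add0r.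
have iP h : P.-integrable setT (f \o T h).
  have -> : f \o T h = EFin \o (fun w => xi h w * xi (t - s + h) w).
    by apply/funext => w /=; rewrite fT.
  by apply: am_int; apply: am_mul; exact: am_noise.
have inu : nu.-integrable setT f by apply/(integrable_image (mT 0) (law 0) mf).
have := integral_image (mT s) (law s) mf inu.
rewrite -(integral_image (mT 0) (law 0) mf inu).
under eq_integral do rewrite fT subrK.
by under [in RHS]eq_integral do rewrite fT addr0.
Qed.

Lemma noise_covarianceN k : rho (- k) = rho k.
Proof.
have <- : 0 - k = - k by rewrite add0r.
rewrite -noise_covariance; under eq_Rintegral do rewrite mulrC.
by rewrite noise_covariance subr0.
Qed.

Hypothesis rho0 : rho 0 = 1.

(* 2 x y <= x^2 + y^2 *)
Lemma noise_covariance_le1 k : rho k <= 1.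
Proof.
have a0 := am_noise 0; have ak := am_noise k.
have H0 : Ex (fun w => xi 0 w * xi 0 w) = 1 by rewrite noise_covariance subr0.
have Hk : Ex (fun w => xi k w * xi k w) = 1 by rewrite noise_covariance subrr.
have Hc : Ex (fun w => xi 0 w * xi k w) = rho k by rewrite noise_covariance subr0.
have a00 := am_mul a0 a0; have akk := am_mul ak ak; have a0k := am_mul a0 ak.
have : 0 <= Ex (fun w => xi 0 w * xi 0 w + xi k w * xi k w + (-2) * (xi 0 w * xi k w)).
  apply: Rintegral_ge0 => w _.
  have -> : xi 0 w * xi 0 w + xi k w * xi k w + (-2) * (xi 0 w * xi k w) =
    (xi 0 w - xi k w) ^+ 2 by ring.
  exact: sqr_ge0.
rewrite (ExD (am_add a00 akk) (am_scale (-2) a0k)) (ExD a00 akk) (ExZ _ a0k) H0 Hk Hc.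
lra.
Qed.

End gaussian_noise.

(** * Square summability of the covariance of the noise *)

Section slow_variation.
Context {R : realType}.

(** Comparison with an integral done by telescoping: a^(-1-q) <= ((a - 1)^(-q) - a^(-q)) / q, a
    consequence of ln(1 + x) <= x and exp(x) >= 1 + x. *)
Lemma sum_powR_le (q : R) n : 0 < q ->
  \sum_(k < n) (k.+2%:R : R) `^ (- (1 + q)) <= q^-1.
Proof.
move=> q0; apply: (@le_trans _ _ (q^-1 * (1 - (n.+1%:R : R) `^ (- q)))); last first.
  by rewrite ler_piMr ?invr_ge0 ?(ltW q0)// gerBl powR_ge0.
elim: n => [|n IH]; first by rewrite big_ord0 powR1 subrr mulr0.
rewrite big_ord_recr/=; apply: (le_trans (lerD IH (lexx _))).
set a : R := n.+2%:R; set b : R := n.+1%:R.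
have a0 : 0 < a by rewrite ltr0n.
have b0 : 0 < b by rewrite ltr0n.
have abE : b = a * (1 + (- a^-1)).
  by rewrite mulrDr mulr1 mulrN divff ?gt_eqF// /a -[n.+2]addn1 natrD addrK.
have c0 : 0 < 1 + (- a^-1) by rewrite -(pmulr_rgt0 _ a0) -abE.
have lnb : ln b <= ln a - a^-1.
  rewrite abE lnM ?posrE//= lerD2l; apply: le_ln1Dx.
  by rewrite -subr_gt0 opprK addrC.
have key : a `^ (- q) * (1 + q / a) <= b `^ (- q).
  rewrite /powR !gt_eqF//; apply: (@le_trans _ _ (expR (- q * ln a) * expR (q / a))).
    by rewrite ler_wpM2l ?expR_ge0// expR_ge1Dx.
  rewrite -expRD ler_expR.
  have := ler_wpM2l (ltW q0) lnb; rewrite mulrBr !mulNr.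
  move: (q * ln a) (q * ln b) (q / a) => x y z; lra.
have -> : a `^ (- (1 + q)) = a `^ (- q) / a.
  rewrite opprD addrC powRD; last by rewrite (gt_eqF a0) implybT.
  by rewrite (powRN a 1) powRr1// ltW.
rewrite -(ler_pM2l q0) mulrDr !mulrA divff ?gt_eqF// !mul1r.
move: key; rewrite mulrDr mulr1 mulrA [_ * q]mulrC -!mulrA.
move: (a `^ _) (b `^ _) (_ / a) => x y z; lra.
Qed.

(* The exponent of the majorant k^(-(1+q)) is 2(2H-2+delta), with delta = 3/4 - H. *)
Lemma sum_long_memory_sqr_le (rho : int -> R) (L : R -> R) H :
  H < 3 / 4 -> (forall x, 0 < x -> 0 < L x) -> zygmund_slowly_varying L ->
  (forall k, `|rho k| <= 1) ->
  (forall k : int, k != 0 -> rho k = L `|k|%:~R * `|k|%:~R `^ (2 * H - 2)) ->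
  exists B, forall n, \sum_(k < n) rho k%:Z ^+ 2 <= B.
Proof.
move=> H34 Lpos [_ LZ] rho1 rhoE.
pose delta := 3 / 4 - H; have delta0 : 0 < delta by rewrite subr_gt0.
pose q := 3 / 2 - 2 * H; have q0 : 0 < q by rewrite /q; lra.
have [x0 [_ Lx0]] := LZ _ delta0.
pose N := (Num.bound `|x0|).+1.
have Nx0 m : (N <= m)%N -> x0 < m%:R.
  move=> Nm; apply: (le_lt_trans (ler_norm _)).
  apply: (lt_trans (archi_boundP (normr_ge0 x0))).
  by rewrite ltr_nat.
(* Beyond x0 the function x^(-delta) L(x) is nonincreasing, so its value at N bounds it from N
   on. *)
pose C := N%:R `^ (- delta) * L N%:R.
have rhoC m : (N <= m)%N -> rho m%:Z ^+ 2 <= C ^+ 2 * (m%:R : R) `^ (- (1 + q)).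
  move=> Nm; have m0 : (0 < m)%N by apply: leq_trans Nm.
  have mR : 0 < (m%:R : R) by rewrite ltr0n.
  have -> : rho m%:Z = (m%:R `^ (- delta) * L m%:R) * m%:R `^ (2 * H - 2 + delta).
    rewrite rhoE; last by rewrite -lt0n.
    rewrite ger0_norm// -[(m%:Z)%:~R]/(m%:R) [_ `^ (_ + delta)]powRD; last by rewrite (gt_eqF mR) implybT.
    have := powR_gt0 delta mR; rewrite powRN.
    move: (m%:R `^ delta) (m%:R `^ (2 * H - 2)) => a b a0; field.
    by rewrite gt_eqF.
  have /(Lx0 N%:R m%:R) Lm : (N%:R : R) \in `]x0, +oo[ by rewrite in_itv/= andbT Nx0.
  have {}Lm : m%:R `^ (- delta) * L m%:R <= C.
    by apply: Lm; rewrite ?ler_nat// in_itv/= andbT Nx0.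
  have -> : m%:R `^ (- (1 + q)) = (m%:R `^ (2 * H - 2 + delta)) ^+ 2.
    rewrite expr2 -powRD; last by rewrite (gt_eqF mR) implybT.
    by congr (_ `^ _); rewrite /q /delta; lra.
  rewrite -exprMn lerXn2r ?nnegrE ?mulr_ge0 ?powR_ge0 ?(ltW (Lpos _ _))//.
  by rewrite ler_wpM2r ?powR_ge0.
(* The first N + 2 terms are at most 1 each; the others are controlled by the power series bound,
   whose summation starts at 2. *)
exists (N.+2%:R + C ^+ 2 * q^-1) => n.
have r1 m : rho m%:Z ^+ 2 <= 1 by rewrite -real_normK ?num_real// exprn_ile1.
have := @ler_sum_ord _ (fun k => rho k%:Z ^+ 2) _ _ (fun k => sqr_ge0 _) (leq_addl N.+2 n).
move/le_trans; apply; rewrite (sum_ord_add (fun k => rho k%:Z ^+ 2)); apply: lerD.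
  by rewrite -[X in X%:R](card_ord N.+2) -sumr_const; apply: ler_sum => i _; exact: r1.
apply: (@le_trans _ _ (C ^+ 2 * \sum_(k < n) ((N.+2 + k)%:R : R) `^ (- (1 + q)))).
  rewrite mulr_sumr; apply: ler_sum => k _; apply: rhoC.
  by rewrite addSn leqW// addSn leqW// leq_addr.
rewrite ler_wpM2l ?sqr_ge0//.
apply: le_trans (sum_powR_le (N + n) q0).
rewrite (sum_ord_add (fun k => (k.+2%:R : R) `^ (- (1 + q)))) lerDr.
by apply: sumr_ge0 => k _; exact: powR_ge0.
Qed.
End slow_variation.

(** * Measurability of pointwise limits *)

Section measurable_limn.
Context d (T : measurableType d) (R : realType).

(** The Cauchy criterion with countable quantifiers only, so that the set of convergence is visibly
    measurable. *)
Lemma cvgn_cauchyP (u : nat -> R) : cvgn u <->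
  forall k, exists N, forall n, `|u (N + n)%N - u N| <= k.+1%:R^-1.
Proof.
split=> [cu k|H].
  have e0 : 0 < (k.+1%:R : R)^-1 / 2 by rewrite divr_gt0 ?invr_gt0 ?ltr0n.
  move/cvgrPdist_le : (cu) => /(_ _ e0)[N _ HN]; exists N => n.
  rewrite (splitr k.+1%:R^-1).
  have -> : u (N + n)%N - u N = (lim (u @ \oo) - u N) - (lim (u @ \oo) - u (N + n)%N) by ring.
  apply: (le_trans (ler_normB _ _)); apply: lerD; apply: HN => //=.
  exact: leq_addr.
apply/cauchy_cvgP/cauchy_exP => e e0.
have [k _ Hk] := near_infty_natSinv_lt (PosNum e0).
have [N HN] := H k; exists (u N), N => //= n Nn.
rewrite /ball/= distrC; apply: le_lt_trans (Hk k _) => //=.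
by rewrite -(subnKC Nn).
Qed.

(** [limn] is total: off the measurable set of convergence it is the constant [point]. *)
Lemma measurable_limn (h : nat -> T -> R) : (forall n, measurable_fun setT (h n)) ->
  measurable_fun setT (fun x => limn (h ^~ x)).
Proof.
move=> mh; pose D : set T := [set x | cvgn (h ^~ x)].
have mD : measurable D.
  have -> : D = \bigcap_k \bigcup_N \bigcap_n
      [set x | `|h (N + n)%N x - h N x| <= k.+1%:R^-1].
    apply/seteqP; split=> [x /cvgn_cauchyP H k _|x H]; rewrite /D /=.
      by have [N HN] := H k; exists N => // n _; exact: HN.
    by apply/cvgn_cauchyP => k; have [N _ HN] := H k I; exists N => n; exact: HN.
  apply: bigcapT_measurable => k; apply: bigcupT_measurable => N.
  apply: bigcapT_measurable => n; rewrite -[X in measurable X]setTI.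
  apply: measurable_fun_le => //; apply: measurableT_comp => //.
  exact: measurable_funB.
rewrite -(setUv D); apply/measurable_funU => //; first exact: measurableC.
split.
  apply: (@measurable_fun_cvg _ _ _ _ h) => // n.
  exact: measurable_funTS.
apply: (@eq_measurable_fun _ _ _ _ _ (cst (point : R))) => [x|]; last exact: measurable_cst.
by rewrite inE /D /= => nx; rewrite (dvgP nx).
Qed.
End measurable_limn.

Section autoregression.
Context d (Omega : measurableType d) (R : realType) (P : probability Omega R).
Variables (xi : int -> {RV P >-> R}) (theta : R).
Hypothesis gxi : gaussian_sequence P xi.
Hypothesis cxi : centered P xi.
Hypothesis sxi : stationary P xi.
Local Notation rho := (covariance_function P xi).
Local Notation Ex F := (Rintegral P setT F).

Definition ar_sum N (t : int) (w : Omega) := \sum_(a < N) theta ^+ a * xi (t - a%:Z) w.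

Lemma ar1_sum t w : ar1 theta xi t w = ar_sum t t w.
Proof.
elim: t => [|t IH]; first by rewrite /ar_sum big_ord0.
rewrite /= IH /ar_sum big_ord_recl/= expr0 mul1r subr0 addrC mulr_sumr.
congr (_ + _); apply: eq_bigr => i _.
rewrite exprS mulrA; congr (_ * xi _ w).
by rewrite /bump /= add1n -[t.+1]addn1 -[i.+1]addn1 !PoszD; ring.
Qed.

Lemma linear_combination_ar_sum N t : linear_combination xi (ar_sum N t).
Proof. by exists N, (fun a => theta ^+ a), (fun a => t - a%:Z). Qed.

Lemma ar_sum_covariance N M s t :
  Ex (fun w => ar_sum N s w * ar_sum M t w) = ar_box theta rho N M (t - s).
Proof.
have am := am_noise gxi.
under eq_Rintegral do rewrite /ar_sum mulr_suml.
rewrite (Ex_sum (F := fun a w => theta ^+ a * xi (s - a%:Z) w * ar_sum M t w)) => [|a].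
  apply: eq_bigr => a _; under eq_Rintegral do rewrite /ar_sum mulr_sumr.
  rewrite (Ex_sum (F := fun b w => theta ^+ a * xi (s - a%:Z) w * (theta ^+ b * xi (t - b%:Z) w))) => [|b].
    apply: eq_bigr => b _.
    under eq_Rintegral do rewrite mulrACA.
    rewrite ExZ; last by apply: am_mul.
    rewrite exprD (noise_covariance gxi sxi); congr (_ * rho _); ring.
  by apply: am_mul; apply: am_scale.
apply: am_mul; first exact: am_scale.
exact/(am_linear_combination gxi)/linear_combination_ar_sum.
Qed.
End autoregression.

(** * Covariance of the stationary solution *)

Section stationary_solution.
Context d (Omega : measurableType d) (R : realType) (P : probability Omega R).
Variables (xi : int -> {RV P >-> R}) (theta : R).
Hypothesis gxi : gaussian_sequence P xi.
Hypothesis cxi : centered P xi.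
Hypothesis sxi : stationary P xi.
Hypothesis th0 : 0 < theta.
Hypothesis th1 : theta < 1.
Local Notation rho := (covariance_function P xi).
Hypothesis rho0 : rho 0 = 1.
Hypothesis rho_ge0 : forall k, 0 <= rho k.
Local Notation Y := (stationary_solution theta xi).
Local Notation g := ((1 - theta)^-1).

Let g0 : 0 < g. Proof. by rewrite invr_gt0 subr_gt0. Qed.

Let term t (j : nat) w : \bar R := (theta ^+ j * xi (t - j%:Z) w ^+ 2)%:E.

Let term_ge0 t j w : (0 <= term t j w)%E.
Proof. by rewrite lee_fin; apply: mulr_ge0; [exact/exprn_ge0/ltW|exact: sqr_ge0]. Qed.

(** A weighted sum of squares with finite mean. Where it is finite, the series of Y converges
    absolutely, and up to the factor g it dominates the squares of all partial sums. *)
Let energy t w : \bar R := (\sum_(0 <= j <oo) term t j w)%E.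

Let measurable_term t j : measurable_fun setT (term t j).
Proof.
apply/measurable_EFinP; apply: measurable_funM => //.
exact: measurable_funX.
Qed.

Let energy_ge0 t w : (0 <= energy t w)%E.
Proof. by apply: nneseries_ge0 => j _ _; exact: term_ge0. Qed.

Let integrable_energy t : P.-integrable setT (energy t).
Proof.
apply/integrableP; split.
  apply: (@ge0_emeasurable_sum _ _ _ _ (term t) xpredT) => [j w _ _|j _].
    exact: term_ge0.
  exact: measurable_term.
under eq_integral do rewrite gee0_abs ?energy_ge0//.
rewrite integral_nneseries//.
rewrite (eq_eseriesr (g := fun j => (theta ^+ j)%:E)); last first.
  move=> j _; have a := am_noise gxi (t - j%:Z).
  have aX := am_scale (theta ^+ j) (am_exp 2 a).
  rewrite -[LHS]fineK; last exact: (integrable_fin_num _ (am_int aX)).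
  congr EFin; rewrite -[LHS]/(Rintegral P setT _) ExZ; last exact: am_exp.
  under eq_Rintegral do rewrite expr2.
  by rewrite (noise_covariance gxi sxi) subrr rho0 mulr1.
rewrite (@nneseries_suml _ _ g) ?ltry// => [j|n]; first by rewrite exprn_ge0 ?(ltW th0).
by apply: sum_geometric_le; rewrite (ltW th0).
Qed.

Let sum_term_le t N w : energy t w \is a fin_num ->
  \sum_(j < N) theta ^+ j * xi (t - j%:Z) w ^+ 2 <= fine (energy t w).
Proof.
move=> fE; rewrite -lee_fin fineK//.
have := nneseries_lim_ge (u_ := fun j => term t j w) (P := xpredT) (m := 0) N (fun j _ _ => term_ge0 t j w).
by rewrite big_mkord sumEFin.
Qed.

Let ar_sum_sqr_le N t w : energy t w \is a fin_num ->
  ar_sum xi theta N t w ^+ 2 <= g * fine (energy t w).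
Proof.
move=> fE; rewrite /ar_sum.
have tge0 (j : 'I_N) : 0 <= theta ^+ j by rewrite exprn_ge0 ?(ltW th0).
under eq_bigr do rewrite mulrC.
apply: (le_trans (cauchy_schwarz_weighted _ tge0)).
apply: ler_pM => //; first exact: sumr_ge0.
- by apply: sumr_ge0 => j _; rewrite mulr_ge0 ?sqr_ge0.
- by apply: sum_geometric_le; rewrite (ltW th0).
by under eq_bigr do rewrite mulrC; exact: sum_term_le.
Qed.

Let cvg_ar_sum t w : energy t w \is a fin_num ->
  ar_sum xi theta N t w @[N --> \oo] --> Y t w.
Proof.
move=> fE.
have E : (fun N => ar_sum xi theta N t w) = series (fun j : nat => theta ^+ j * xi (t - j%:Z) w).
  by apply/funext => N; rewrite /series/= big_mkord.
rewrite /stationary_solution E.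
apply: (@normed_cvg _ _ (fun j : nat => theta ^+ j * xi (t - j%:Z) w)).
apply: nondecreasing_is_cvgn; first by apply: nondecreasing_series => j _ _; exact: normr_ge0.
exists (g + fine (energy t w)) => _ [N _ <-].
rewrite [leLHS](_ : _ = \sum_(j < N) `|theta ^+ j * xi (t - j%:Z) w|); last exact: big_mkord.
have tge0 (j : 'I_N) : 0 <= theta ^+ j by rewrite exprn_ge0 ?(ltW th0).
apply: (@le_trans _ _ (\sum_(j < N) (theta ^+ j + theta ^+ j * xi (t - j%:Z) w ^+ 2))).
  apply: ler_sum => j _; rewrite normrM ger0_norm//.
  rewrite (_ : _ + _ = theta ^+ j * (1 + xi (t - j%:Z) w ^+ 2)); last by rewrite mulrDr mulr1.
  rewrite ler_wpM2l//; rewrite -[xi _ w ^+ 2]real_normK ?num_real//.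
  have := sqr_ge0 (`|xi (t - j%:Z) w| - 1); nra.
rewrite big_split/=; apply: lerD; last exact: sum_term_le.
by apply: sum_geometric_le; rewrite (ltW th0).
Qed.

Lemma measurable_stationary_solution t : measurable_fun setT (Y t).
Proof.
apply: (@measurable_limn _ _ _ (fun N w => series (fun j : nat => theta ^+ j * xi (t - j%:Z) w) N)).
move=> N; apply: measurable_sum => j; exact: measurable_funM.
Qed.

(** Dominated convergence for products of partial sums, whose means are box sums; |x y| <= x^2 + y^2
    and the energies at times 0 and k give the majorant. *)
Lemma covariance_stationary_solution k : covariance_function P Y k = ar_cov theta rho k.
Proof.
have rho_le1 := noise_covariance_le1 gxi sxi rho0.
transitivity (fine (\int[P]_w (Y 0 w * Y k w)%:E)%E).
  by rewrite {1}/covariance_function unlock.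
have am N t := am_linear_combination gxi (linear_combination_ar_sum xi theta N t).
pose f_ N w := (ar_sum xi theta N 0 w * ar_sum xi theta N k w)%:E.
pose f w := (Y 0 w * Y k w)%:E.
pose dom w := (g%:E * (energy 0 w + energy k w))%E.
have mf_ N : measurable_fun setT (f_ N).
  by apply/measurable_EFinP; apply: measurable_funM; apply: am_measurable (am _ _).
have mf : measurable_fun setT f.
  apply/measurable_EFinP.
  by apply: measurable_funM; exact: measurable_stationary_solution.
have aef : {ae P, forall w, energy 0 w \is a fin_num /\ energy k w \is a fin_num}.
  have a0 := integrable_ae measurableT (integrable_energy 0).
  have ak := integrable_ae measurableT (integrable_energy k).
  by apply: filterS2 a0 ak => w /(_ I) ? /(_ I) ?.
have idom : P.-integrable setT dom.
  by apply: integrableZl => //; apply: integrableD => //; exact: integrable_energy.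
have cf : {ae P, forall w, setT w -> f_ ^~ w @ \oo --> f w}.
  apply: filterS aef => w [E0 Ek] _; apply: cvg_EFin; first exact: nearW.
  by apply: cvgM; exact: cvg_ar_sum.
have df : {ae P, forall w N, setT w -> (`|f_ N w| <= dom w)%E}.
  apply: filterS aef => w [E0 Ek] N _.
  rewrite /dom -(fineK E0) -(fineK Ek) -EFinD -EFinM /f_ abse_EFin lee_fin.
  rewrite mulrDr; apply: le_trans (lerD (ar_sum_sqr_le N E0) (ar_sum_sqr_le N Ek)).
  move: (ar_sum _ _ _ _ _) (ar_sum _ _ _ _ _) => x y.
  rewrite ler_norml; apply/andP; split.
    have := sqr_ge0 (x + y); nra.
  have := sqr_ge0 (x - y); nra.
have [_ _ cI] := dominated_convergence measurableT mf_ mf cf idom df.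
have cB : (ar_box theta rho N N k)%:E @[N --> \oo] --> (ar_cov theta rho k)%:E.
  apply: cvg_EFin; first exact: nearW.
  exact: (cvg_ar_box th0 th1 rho_ge0 rho_le1).
have E : (fun N => \int[P]_w f_ N w)%E = (fun N => (ar_box theta rho N N k)%:E).
  apply/funext => N; rewrite -[LHS]fineK; last first.
    apply: integrable_fin_num => //.
    by apply: am_int; apply: am_mul; exact: am.
  congr EFin; rewrite -[LHS]/(Rintegral P setT (fun w => ar_sum xi theta N 0 w * ar_sum xi theta N k w)).
  by rewrite (ar_sum_covariance theta gxi sxi) subr0.
move: cI; rewrite E => cI.
by rewrite -/f (cvg_unique _ cI cB).
Qed.
End stationary_solution.

(** * Two-sided sums of even functions *)

Section limit_variance.
Context {R : realType}.

Lemma esum_int_even (F : int -> R) B : (forall k, 0 <= F k) -> (forall k, F (- k) = F k) ->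
  (forall n, \sum_(k < n) F k%:Z <= B) ->
  (\esum_(k in [set: int]) (F k)%:E = (F 0 + 2 * suml (fun k => F k.+1%:Z))%:E)%E.
Proof.
move=> F0 FN FB; have FE (k : int) : (0 <= (F k)%:E)%E by rewrite lee_fin.
have FB1 n : \sum_(k < n) F k.+1%:Z <= B.
  have := FB n.+1; rewrite big_ord_recl/= => /(le_trans _); apply.
  by rewrite (eq_bigr (fun k : 'I_n => F k.+1%:Z))// lerDr.
(* [Negz n] is - (n + 1): parity turns the negative half into the sum over k >= 1. *)
pose neg : set int := range Negz.
rewrite (esumID neg)// !setTI.
have -> : ~` neg = range Posz.
  apply/seteqP; split=> [[n|n] //= H|_ [n _ <-] [m _]//].
    by exists n.
  by exfalso; apply: H; exists n.
rewrite !esum_image; [|by move=> m n _ _ []|by move=> m n _ _ []].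
have esumE (a : nat -> \bar R) : (forall n, (0 <= a n)%E) ->
    (\esum_(n in [set: nat]) a n = \sum_(0 <= n <oo) a n)%E.
  by move=> a0; rewrite (nneseries_esum (P := xpredT))//; congr esum; apply/seteqP.
rewrite !esumE//.
rewrite (eq_eseriesr (g := fun k => (F k.+1%:Z)%:E)) => [|k _]; last by rewrite NegzE FN.
rewrite (nneseries_suml (F := fun k => F k.+1%:Z) (fun k => F0 _) FB1).
rewrite (nneseries_recl (f := fun k => (F k%:Z)%:E))//.
rewrite -(nneseries_addn (f := fun k => (F k%:Z)%:E) 1)//.
rewrite (eq_eseriesr (g := fun k => (F k.+1%:Z)%:E)) => [|k _]; last by rewrite addn1.
rewrite (nneseries_suml (F := fun k => F k.+1%:Z) (fun k => F0 _) FB1).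
by rewrite -!EFinD; congr EFin; ring.
Qed.
End limit_variance.

(** * Asymptotic normality *)

Lemma converges_in_law_Rintegral d (Omega : measurableType d) (R : realType)
    (P : probability Omega R) (U : nat -> Omega -> R) (nu : probability R R) :
  (forall n, measurable_fun setT (U n)) ->
  (forall (g : R -> R) M, continuous g -> (forall x, `|g x| <= M) ->
     \int[P]_w g (U n w) @[n --> \oo] --> \int[nu]_x g x) ->
  converges_in_law P U nu.
Proof.
move=> mU H; split=> // g cg [M0 [_ HM]].
(* [bounded_fun] provides only the bounds strictly above M0. *)
have gM x : `|g x| <= M0 + 1 by apply: HM => //; rewrite ltrDl.
have mg := continuous_measurable_fun cg.
have fE d' (T : measurableType d') (Q : probability T R) (F : T -> R) :
    measurable_fun setT F -> (forall w, `|F w| <= M0 + 1) ->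
    (\int[Q]_w (F w)%:E)%E = (Rintegral Q setT F)%:E.
  move=> mF FM; rewrite /Rintegral fineK//.
  by apply: integrable_fin_num => //; exact: (am_int (am_bounded Q mF FM)).
rewrite fE//.
have -> : (fun n => 'E_P[g \o U n])%E = (fun n => (\int[P]_w g (U n w))%:E).
  by apply/funext => n; rewrite unlock (fE _ _ P (g \o U n) (measurableT_comp mg (mU n)) (fun=> gM _)).
by apply: cvg_EFin; [exact: nearW|exact: H gM].
Qed.

(** The variance is expressed through limits of box sums, so that the stationary solution is left
    out of the asymptotic argument. *)
Lemma second_moment_estimator_cvg d (Omega : measurableType d) (R : realType)
    (P : probability Omega R) (xi : int -> {RV P >-> R}) (theta : R) B :
  let rho := covariance_function P xi in
  let f := second_moment_function rho in
  gaussian_sequence P xi -> centered P xi -> stationary P xi ->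
  0 < theta -> theta < 1 -> rho 0 = 1 -> (forall k, 0 <= rho k) ->
  (forall n, \sum_(k < n) rho k%:Z ^+ 2 <= B) ->
  converges_in_law P
    (fun n w => Num.sqrt n%:R * (second_moment_estimator f (ar1 theta xi) n w - theta))
    (normal_law 0 (2 * ar_cov_energy theta rho / (derive1 f theta) ^+ 2)).
Proof.
move=> rho f gxi cxi sxi th0 th1 rho0 rho_ge0 rhoB.
have rhoN := noise_covarianceN gxi sxi.
have rho_le1 := noise_covariance_le1 gxi sxi rho0.
have f_lt := second_moment_lt rho_ge0 rho_le1 rhoN rho0.
have f_cont x : 0 < x -> x < 1 -> {for x, continuous f}.
  move=> x0 x1; have [df _ [dx _]] := is_derive_second_moment rho_ge0 rho_le1 rhoN rho0 x0 x1.
  exact/differentiable_continuous/derivable1_diffP.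
have [df df0 dfD] := is_derive_second_moment rho_ge0 rho_le1 rhoN rho0 th0 th1.
have -> : derive1 f theta = df by rewrite derive1E (@derive_val _ _ _ _ _ _ _ dfD).
pose E := ar_cov_energy theta rho.
have E0 : 0 < E by exact: ar_cov_energy_gt0 rhoB.
set v := 2 * _ / _; have v0 : 0 <= v by rewrite divr_ge0 ?mulr_ge0 ?sqr_ge0// ltW.
pose X n (i : 'I_n) := ar1 theta xi i.+1.
have gG := linear_combination_gaussian_space gxi cxi.
have ar1E t : ar1 theta xi t = ar_sum xi theta t t.
  by apply/funext => w; exact: ar1_sum.
have XG n (i : 'I_n) : linear_combination xi (X n i).
  by rewrite /X ar1E; exact: linear_combination_ar_sum.
have covX n : cov_mx P (X n) = acov_mx theta rho n.
  by apply/matrixP => i j; rewrite !mxE /X !ar1E ar_sum_covariance.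
(* The factor df is included so that S_n itself has the limit law of the normalized error; the delta
   method then compares the two without rescaling. *)
pose c n : R := (Num.sqrt n%:R * df)^-1.
pose S n := quad P (X n) (c n).
pose bias n := n%:R^-1 * \tr (acov_mx theta rho n) - ar_cov theta rho 0.
have cb : Num.sqrt n%:R * bias n @[n --> \oo] --> (0 : R) by exact: cvg_trace_bias.
have empE n w : (0 < n)%N -> empirical_second_moment (ar1 theta xi) n w =
    f theta + (df * S n w / Num.sqrt n%:R + bias n).
  move=> n0; rewrite /f second_moment_ar_cov// /S /quad covX /bias /c.
  have -> : empirical_second_moment (ar1 theta xi) n w =
      n%:R^-1 * \sum_(i < n) X n i w ^+ 2.
    by rewrite /empirical_second_moment big_add1 succnK big_mkord.
  have w0 : 0 < Num.sqrt (n%:R : R) by rewrite sqrtr_gt0 ltr0n.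
  have -> : n%:R^-1 = (Num.sqrt (n%:R : R))^-1 ^+ 2 by rewrite exprVn sqr_sqrtr// ler0n.
  move: (Num.sqrt _) w0 => s s0; move: (\sum_(i < n) _) (\tr _) (ar_cov _ _ _) => a b z.
  by field; rewrite !gt_eqF.
have mU n : measurable_fun setT
    (fun w => Num.sqrt n%:R * (second_moment_estimator f (ar1 theta xi) n w - theta)).
  apply: measurable_funM => //; apply: measurable_funB => //.
  apply: (measurableT_comp (measurable_pinv f_lt f_cont)).
  apply: measurable_funM => //; apply: measurable_sum => t.
  apply: measurable_funX; rewrite ar1E.
  exact/am_measurable/(am_linear_combination gxi)/linear_combination_ar_sum.
apply: converges_in_law_Rintegral => // g M cg gM.
apply: (@cvg_bounded_continuous _ _ _ _ S (normal_law 0 v) _ _ _ _ _ _ M) => //.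
- by move=> n; exact: (am_quad gG (c n) (XG n)).
- exact: am_normal_law.
(* With the traces scaled by c^k and the mixed moments by c^(k+1), both recursions become free of
   c. *)
- apply: (@cvg_cumulant_recursion _ v (fun n k => c n ^+ k * \tr (acov_mx theta rho n ^+ k))
    (fun n m => \int[P]_w S n w ^+ m)
    (fun n k m => c n ^+ k.+1 * quad_moment P (X n) (c n) k m)).
  + by move=> n; under eq_Rintegral do rewrite expr0; exact: Ex_cst.
  + by move=> n m; rewrite (quad_moment_recS gG (c n) (XG n)); ring.
  + move=> n k m; rewrite (quad_moment_rec gG (c n) (XG n)) covX !exprS; ring.
  + have -> : v / 2 = E / df ^+ 2 by rewrite /v -[2 * _ / _]mulrA mulrC mulKf.
    exact: (cvg_scaled_trace2 th0 th1 rho_ge0 rho_le1 rhoN rhoB).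
  + by move=> k; exact: (cvg_scaled_trace3 th0 th1 rho_ge0 rho_le1 rhoN rho0 rhoB df0).
  + exact: normal_law_moment0.
  + exact: normal_law_momentS.
- exact: normal_law_moments_growth.
- move=> A e A0 e0.
  have H := pinv_delta_method f_lt f_cont th0 th1 dfD df0 cb A0 e0.
  near=> n; have n0 : (0 < n)%N by near: n; exact: nbhs_infty_gt.
  move=> w; rewrite /second_moment_estimator empE//.
  move: w; near: n; apply: filterS H => n Hn w; exact: Hn.
Unshelve. all: by end_near. Qed.

Theorem theorem1p3 (R : realType) (d : measure_display)
    (Omega : measurableType d) (P : probability Omega R)
    (xi : int -> {RV P >-> R}) (H theta : R) (L : R -> R)
    (hH : 1 / 2 < H < 3 / 4) (htheta : 0 < theta < 1)
    (hxi : long_memory_noise xi H L) :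
  let f := second_moment_function (covariance_function P xi) in
  let X := ar1 theta xi in
  let Y := stationary_solution theta xi in
  let sigma2 := limit_variance (covariance_function P Y) in
  converges_in_law P
    (fun (n : nat) (w : Omega) =>
       Num.sqrt n%:R * (second_moment_estimator f X n w - theta))
    (normal_law 0 (sigma2 / (derive1 f theta) ^+ 2)).
Proof.
move: hxi hH htheta => [[gxi cxi sxi] [[rho0 rhoE] [_ Lpos LZ _]]].
move=> /andP[_ H34] /andP[th0 th1] f X Y sigma2.
have rho_ge0 k : 0 <= covariance_function P xi k.
  have [->|k0] := eqVneq k 0; first by rewrite rho0.
  by rewrite rhoE// mulr_ge0 ?powR_ge0// ltW// Lpos// ltr0z normr_gt0.
have rho_le1 := noise_covariance_le1 gxi sxi rho0.
have rhoN := noise_covarianceN gxi sxi.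
have [B rhoB] : exists B, forall n, \sum_(k < n) covariance_function P xi k%:Z ^+ 2 <= B.
  apply: sum_long_memory_sqr_le H34 Lpos LZ _ rhoE => k.
  by rewrite ger0_norm.
(* The solution Y enters only here, through its covariance. *)
suff -> : sigma2 = 2 * ar_cov_energy theta (covariance_function P xi).
  exact: second_moment_estimator_cvg.
rewrite /sigma2 /limit_variance (eq_esum (b := fun k => (ar_cov theta (covariance_function P xi) k ^+ 2)%:E)).
  rewrite (esum_int_even (F := fun k => ar_cov theta (covariance_function P xi) k ^+ 2)
    (fun k => sqr_ge0 _) _ (sum_ar_cov_sqr th0 th1 rho_ge0 rho_le1 rhoN rhoB))//.
  by move=> k; rewrite ar_covN.
by move=> k _; rewrite (covariance_stationary_solution gxi sxi th0 th1 rho0 rho_ge0).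
Qed.
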